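(* Let $d\in\mathbb{N}$. In the fixed design regression setting on the simplex described in the context, suppose that Assumptions (A1)--(A4) listed in the context hold, and let $\boldsymbol{s}\in\mathrm{Int}(\mathcal{S}_d)$ be fixed. Then, as $n\to\infty$, $$\mathrm{MSE}\{\hat m_{n,b}^{\mathrm{GM}}(\boldsymbol{s})\}=\big[\mathsf{Bias}\{\hat m_{n,b}^{\mathrm{GM}}(\boldsymbol{s})\}\big]^2+\mathsf{Var}\{\hat m_{n,b}^{\mathrm{GM}}(\boldsymbol{s})\}=b^2g^2(\boldsymbol{s})+n^{-1}b^{-d/2}v(\boldsymbol{s})+\mathrm{o}(b^2)+\mathrm{o}_{\boldsymbol{s}}(n^{-1}b^{-d/2}),$$ where $g$ and $v$ are the functions defined in the context. In particular, if $g(\boldsymbol{s})\sigma^2(\boldsymbol{s})\neq0$ and $d\in\{1,2,3\}$, the asymptotically (pointwise) optimal smoothing parameter $b$, which minimizes $b^2g^2(\boldsymbol{s})+n^{-1}b^{-d/2}v(\boldsymbol{s})$ over $b\in(0,\infty)$, is $$b_{\mathrm{opt}}(\boldsymbol{s})=n^{-2/(d+4)}\left\{\frac d4\,\frac{v(\boldsymbol{s})}{g^2(\boldsymbol{s})}\right\}^{2/(d+4)},$$ and with the choice $b=b_{\mathrm{opt}}(\boldsymbol{s})$, $$\mathrm{MSE}\{\hat m_{n,b_{\mathrm{opt}}(\boldsymbol{s})}^{\mathrm{GM}}(\boldsymbol{s})\}=n^{-4/(d+4)}\left\{\frac{1+d/4}{(d/4)^{d/(d+4)}}\right\}\{v(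\boldsymbol{s})\}^{4/(d+4)}\{g^2(\boldsymbol{s})\}^{d/(d+4)}+\mathrm{o}_{\boldsymbol{s}}(n^{-4/(d+4)}).$$
   Context: Notation. $\mathcal{S}_d=\{\boldsymbol{s}\in[0,1]^d:\|\boldsymbol{s}\|_1\le 1\}$, $\mathrm{Int}(\mathcal{S}_d)=\{\boldsymbol{s}\in(0,1)^d:\|\boldsymbol{s}\|_1<1\}$, with $\|\cdot\|_1$ the $\ell^1$ norm; $[n]=\{1,\dots,n\}$; $\mathrm{Leb}$ is Lebesgue measure on $\mathbb{R}^d$. Subscripts on $\mathrm{o}$ indicate the quantities on which the rate of convergence may depend. For $\boldsymbol{\alpha}\in(0,\infty)^d$, $\beta\in(0,\infty)$, the $\mathrm{Dirichlet}(\boldsymbol{\alpha},\beta)$ density on $\mathcal{S}_d$ is $$K_{\boldsymbol{\alpha},\beta}(\boldsymbol{s})=\frac{\Gamma(\|\boldsymbol{\alpha}\|_1+\beta)}{\Gamma(\beta)\prod_{j=1}^d\Gamma(\alpha_j)}(1-\|\boldsymbol{s}\|_1)^{\beta-1}\prod_{j=1}^d s_j^{\alpha_j-1}.$$ For $\boldsymbol{s}\in\mathcal{S}_d$ and $b\in(0,\infty)$ put $\kappa_{\boldsymbol{s},b}=K_{\boldsymbol{s}/b+\boldsymbol{1},\,(1-\|\boldsymbol{s}\|_1)/b+1}$, with $\boldsymbol{1}=(1,\dots,1)$. Setting. For each $n$ there are deterministic design points $\boldsymbol{x}_1,\dots,\boldsymbol{x}_n\in\mathrm{Int}(\mathcal{S}_d)$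 (depending on $n$; the dependence is suppressed), with design density $f$, a probability density on $\mathcal{S}_d$: for every Borel set $B\subseteq\mathbb{R}^d$ with $\mathrm{Leb}(\partial B)=0$, $\lim_{n\to\infty}\frac1n\sum_{i=1}^n\mathbf{1}_B(\boldsymbol{x}_i)=\int_B f(\boldsymbol{x})\,d\boldsymbol{x}$. The responses are $Y_i=m(\boldsymbol{x}_i)+\varepsilon_i$, $i\in[n]$, where $m:\mathcal{S}_d\to\mathbb{R}$ and, for each $n$, the errors $\varepsilon_1,\dots,\varepsilon_n$ are mutually independent with $\varepsilon_i$ of mean zero and variance $\sigma^2(\boldsymbol{x}_i)$. Given a smoothing parameter $b=b(n)\in(0,\infty)$ and sets $B_1,\dots,B_n$ (depending on $n$) as in (A4) below, the Dirichlet-kernel Gasser--Müller estimator is $$\hat m_{n,b}^{\mathrm{GM}}(\boldsymbol{s})=\sum_{i=1}^n Y_i\int_{B_i}\kappa_{\boldsymbol{s},b}(\boldsymbol{x})\,d\boldsymbol{x},\qquad\boldsymbol{s}\in\mathcal{S}_d.$$ Its bias is $\mathsf{Bias}\{\hat m_{n,b}^{\mathrm{GM}}(\boldsymbol{s})\}=\mathsf{E}\{\hat m_{n,b}^{\mathrm{GM}}(\boldsymbol{s})\}-m(\boldsymbol{s})$ and its mean squared error is $\mathrm{MSE}\{\hat m_{n,b}^{\mathrm{GM}}(\boldsymbol{s})\}=\mathsf{E}[\{\hat m_{n,b}^{\mathrm{GM}}(\boldsymbol{s})-m(\boldsymbol{s})\}^2]$. Functions $g$ and $v$. $$g(\boldsymbol{s})=\sum_{j=1}^d\{1-(d+1)s_j\}\frac{\partial}{\partial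 s_j}m(\boldsymbol{s})+\frac12\sum_{j,k=1}^d s_j(\mathbf{1}_{\{j=k\}}-s_k)\frac{\partial^2}{\partial s_j\partial s_k}m(\boldsymbol{s}),$$ $$v(\boldsymbol{s})=\frac{\psi_\emptyset(\boldsymbol{s})\,\sigma^2(\boldsymbol{s})}{f(\boldsymbol{s})},\qquad\psi_\emptyset(\boldsymbol{s})=\Big\{(4\pi)^d(1-\|\boldsymbol{s}\|_1)\prod_{j=1}^d s_j\Big\}^{-1/2}.$$ Assumptions. (A1) $f$ and $\sigma^2$ are Lipschitz continuous on $\mathcal{S}_d$, and $m$ is twice continuously differentiable on $\mathcal{S}_d$ (in particular $\sigma^2$ is bounded on $\mathcal{S}_d$). (A2) $\min_{\mathcal{S}_d}f>0$ and $\min_{\mathcal{S}_d}\sigma^2>0$. (A3) $b=b(n)\to0$ and $n^{-1/d}=\mathrm{o}(b)$ as $n\to\infty$. (A4) For every $n\in\mathbb{N}$, $B_1,\dots,B_n$ are convex compact subsets of $\mathcal{S}_d$ such that: (a) $\mathrm{Int}(B_i)\cap\mathrm{Int}(B_j)=\emptyset$ for $i\ne j$ and $B_1\cup\dots\cup B_n=\mathcal{S}_d$; (b) $\boldsymbol{x}_i\in\mathrm{Int}(B_i)$ for every $i\in[n]$; (c) $\mathrm{Leb}(\partial B_i)=0$ for every $i\in[n]$; (d) $\mathrm{diam}(B_i)=\mathcal{O}(n^{-1/d})$ uniformly in $i$ as $n\to\infty$; (e) $|\int_{B_i}f(\boldsymbol{t})\,d\boldsymbol{t}-n^{-1}|=\mathcal{O}(n^{-1-1/d})$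 uniformly in $i$ as $n\to\infty$. *)

(* Defs.v *)
From HB Require Import structures.
From mathcomp Require Import all_boot all_order all_algebra.
From mathcomp Require Import all_classical all_reals all_analysis.

Set Implicit Arguments.
Unset Strict Implicit.
Unset Printing Implicit Defensive.

Import Order.TTheory GRing.Theory Num.Theory.
Import numFieldNormedType.Exports.

Local Open Scope classical_set_scope.
Local Open Scope ring_scope.

(* Lebesgue measure on R^d is the d-fold product of the one-dimensional one,
   built on tuples and transported to the Borel sets of 'rV[R]_d. *)

Definition pushforward_measure (d1 d2 : measure_display)
    (T1 : measurableType d1) (T2 : measurableType d2) (R : realFieldType)
    (mu : {measure set T1 -> \bar R}) (f : T1 -> T2)
    (mf : measurable_fun setT f) : {measure set T2 -> \bar R} :=
  measure_function_pushforward__canonical__measure_function_Measure mu mf.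

Section cons_measure.
Context (R : realType) (n : nat).
Variable mu : {sigma_finite_measure set (n.-tuple (measurableTypeR R)) -> \bar R}.

Definition tuple_cons (p : measurableTypeR R * n.-tuple (measurableTypeR R)) :
  n.+1.-tuple (measurableTypeR R) := [tuple of p.1 :: p.2].

Lemma measurable_tuple_cons : measurable_fun setT tuple_cons.
Proof. exact: measurable_cons. Qed.

Definition cons_measure : set (n.+1.-tuple (measurableTypeR R)) -> \bar R :=
  pushforward (lebesgue_measure \x mu)%E tuple_cons.

HB.instance Definition _ := Measure.copy cons_measure
  (pushforward_measure (lebesgue_measure \x mu)%E measurable_tuple_cons).

Let cons_measure_sigma_finite : sigma_finite setT cons_measure.
Proof.
have /sigma_finiteP[F [UF ndF Foo]] :=
  sigma_finiteT (@lebesgue_measure R : {sigma_finite_measure set _ -> \bar R}).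
have /sigma_finiteP[G [UG ndG Goo]] := sigma_finiteT mu.
pose h (t : n.+1.-tuple (measurableTypeR R)) :
  measurableTypeR R * n.-tuple (measurableTypeR R) :=
  (tnth t ord0, [tuple of behead t]).
have mh : measurable_fun setT h.
  apply/measurable_fun_pairP; split; first exact: measurable_tnth.
  exact: measurable_behead.
have hK p : h (tuple_cons p) = p.
  by case: p => a t; congr pair; apply/val_inj.
exists (fun k => h @^-1` (F k `*` G k)).
  rewrite -preimage_bigcup (_ : \bigcup_k _ = setT) ?preimage_setT//.
  rewrite -subTset => -[x t] _.
  have [i _ Fx] : (\bigcup_i F i) x by rewrite -UF.
  have [j _ Gt] : (\bigcup_i G i) t by rewrite -UG.
  exists (maxn i j) => //; split => /=.
    by move: x Fx; exact/subsetPset/ndF/leq_maxl.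
  by move: t Gt; exact/subsetPset/ndG/leq_maxr.
move=> k; have [mF ltF] := Foo k; have [mG ltG] := Goo k; split.
  by rewrite -[X in measurable X]setTI; apply: mh => //; exact: measurableX.
rewrite /cons_measure /pushforward -comp_preimage.
rewrite (_ : h \o _ = id); last exact/funext.
by rewrite preimage_id product_measure1E// lte_mul_pinfty// ge0_fin_numE.
Qed.

HB.instance Definition _ := Measure_isSigmaFinite.Build _ _ _ cons_measure
  cons_measure_sigma_finite.

End cons_measure.

Fixpoint lebesgue_tuple (R : realType) (n : nat) :
    {sigma_finite_measure set (n.-tuple (measurableTypeR R)) -> \bar R} :=
  match n with
  | 0 => \d_([tuple] : 0.-tuple (measurableTypeR R))
  | n'.+1 => cons_measure (lebesgue_tuple R n')
  end.

Definition borel (R : realType) (d : nat) :=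
  g_sigma_algebraType (@open 'rV[R]_d).

Definition row_of_tuple (R : realType) (d : nat)
  (t : d.-tuple (measurableTypeR R)) : borel R d := \row_j tnth t j.

Lemma measurable_row_of_tuple (R : realType) (d : nat) :
  measurable_fun setT (@row_of_tuple R d).
Proof.
apply: (@measurability _ _ _ (g_sigma_algebraType (@open 'rV[R]_d)) _ _ (@open 'rV[R]_d)) => //.
move=> _ [U oU <-]; rewrite setTI.
pose I := (nat * d.-tuple rat)%type.
pose V (p : I) : set 'rV[R]_d :=
  ball (\row_j ratr (tnth p.2 j) : 'rV[R]_d) p.1.+1%:R^-1.
pose D (p : I) := V p `<=` U.
have -> : @row_of_tuple R d @^-1` U =
    \bigcup_p (if `[<D p>] then @row_of_tuple R d @^-1` V p else set0).
  apply/seteqP; split => t /=; last first.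
    by move=> [p _]; case: asboolP => // Dp /Dp.
  move=> Ut.
  have [e /= e0 eU] : exists2 e : R, 0 < e & ball (row_of_tuple t : 'rV[R]_d) e `<=` U.
    have /nbhs_ballP[e /= e0 eU] := open_nbhs_nbhs (conj oU Ut).
    by exists e.
  have e20 : 0 < e / 2 by rewrite divr_gt0.
  have [k _ /(_ k (leqnn k)) ke] := near_infty_natSinv_lt (PosNum e20).
  have q_ i : exists q : rat, ball (ratr q : R) k.+1%:R^-1 (tnth t i : R).
    have k0 : 0 < k.+1%:R^-1 :> R by rewrite invr_gt0.
    have : (tnth t i : R) < (tnth t i : R) + k.+1%:R^-1 by rewrite ltrDl.
    move=> /rat_in_itvoo[q]; rewrite in_itv/= => /andP[q1 q2].
    exists q; rewrite -ball_normE/= ger0_norm ?subr_ge0 ?(ltW q1)//.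
    by rewrite ltrBlDl.
  pose q := [tuple projT1 (cid (q_ i)) | i < d].
  have Vt : V (k, q) (row_of_tuple t).
    split; first by rewrite invr_gt0.
    move=> i j; rewrite !mxE tnth_mktuple; exact: projT2 (cid (q_ j)).
  exists (k, q) => //=; case: asboolP => // -[].
  move=> y Vy; apply: eU; apply: (@le_ball _ _ _ (k.+1%:R^-1 + k.+1%:R^-1)).
    by rewrite [leRHS]splitr lerD ?ltW.
  exact: ball_triangle (ball_sym Vt) Vy.
apply: countable_bigcupT_measurable => [|p]; first exact: (countableP [set: (nat * d.-tuple rat)%type]).
case: ifPn => // _.
have -> : @row_of_tuple R d @^-1` V p =
    \bigcap_(j in [set: 'I_d]) ((fun t => tnth t j : measurableTypeR R) @^-1`
       (ball (ratr (tnth p.2 j) : R) p.1.+1%:R^-1)).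
  apply/seteqP; split => t /=.
    by move=> [_ Vt] j _; have := Vt ord0 j; rewrite !mxE.
  move=> Vt; split; first by rewrite invr_gt0.
  by move=> i j; rewrite !mxE; exact: Vt.
apply: fin_bigcap_measurable => // j _.
rewrite -[X in measurable X]setTI; apply: measurable_tnth => //.
by rewrite ball_itv; exact: measurable_itv.
Qed.

Definition lebesgue_rV (R : realType) (d : nat) :
    {measure set (borel R d) -> \bar R} :=
  pushforward_measure (lebesgue_tuple R d) (@measurable_row_of_tuple R d).

(* Functions on the simplex are total functions on 'rV[R]_d of which only the
   values on the simplex are constrained or used. *)

Section simplex.
Context (R : realType) (d : nat).
Implicit Types (s x y alpha : 'rV[R]_d) (B : set 'rV[R]_d).

Definition norm1 s : R := \sum_(j < d) `|s 0 j|.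

Definition simplex : set 'rV[R]_d :=
  [set s : 'rV[R]_d | (forall j, 0 <= s 0 j <= 1) /\ norm1 s <= 1].

Definition simplex_int : set 'rV[R]_d :=
  [set s : 'rV[R]_d | (forall j, 0 < s 0 j < 1) /\ norm1 s < 1].

Definition frontier B : set 'rV[R]_d := closure B `\` B°.

Definition dist2 x y : R := Num.sqrt (\sum_(j < d) (x 0 j - y 0 j) ^+ 2).

Definition diam B : R :=
  sup [set r | exists x y, [/\ B x, B y & r = dist2 x y]].

(* At an interior point this depends only on the values of h near s, hence on
   the simplex. *)
Definition partial (j : 'I_d) (h : 'rV[R]_d -> R) s : R :=
  'D_(delta_mx 0 j) (h : 'rV[R]_d -> R^o) s.

(* On the closed simplex, "twice continuously differentiable" means: the
   partial derivatives of order at most two exist in the interior and extend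
   continuously to the boundary. *)
Definition extends_continuously (h : 'rV[R]_d -> R) : Prop :=
  exists2 h' : 'rV[R]_d -> R, {within simplex, continuous h'} &
    {in simplex_int, h =1 h'}.

Definition C2_on_simplex (h : 'rV[R]_d -> R) : Prop :=
  [/\ {within simplex, continuous h},
      forall j s, simplex_int s ->
        derivable (h : 'rV[R]_d -> R^o) s (delta_mx 0 j),
      forall j, extends_continuously (partial j h),
      forall j k s, simplex_int s ->
        derivable (partial k h : 'rV[R]_d -> R^o) s (delta_mx 0 j) &
      forall j k, extends_continuously (partial j (partial k h))].

Definition lipschitz_on_simplex (h : 'rV[R]_d -> R) : Prop :=
  [lipschitz (h x : R^o) | x in simplex].

Definition positive_min_on_simplex (h : 'rV[R]_d -> R) : Prop :=
  exists2 s0, simplex s0 &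
    0 < h s0 /\ forall s, simplex s -> h s0 <= h s.

Definition density_on_simplex (f : 'rV[R]_d -> R) : Prop :=
  [/\ measurable_fun (simplex : set (borel R d)) f,
      forall s, simplex s -> 0 <= f s &
      (\int[lebesgue_rV R d]_(x in simplex) (f x)%:E = 1)%E].

Definition Gamma (a : R) : R :=
  \int[lebesgue_measure]_(t in `]0, +oo[) (t `^ (a - 1) * expR (- t)).

Definition dirichlet alpha (beta : R) s : R :=
  Gamma (norm1 alpha + beta) / (Gamma beta * \prod_(j < d) Gamma (alpha 0 j))
  * (1 - norm1 s) `^ (beta - 1) * \prod_(j < d) s 0 j `^ (alpha 0 j - 1).

Definition kappa s (b : R) : 'rV[R]_d -> R :=
  dirichlet (b^-1 *: s + const_mx 1) ((1 - norm1 s) / b + 1).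

Definition g_fun (m : 'rV[R]_d -> R) s : R :=
  \sum_(j < d) (1 - (d%:R + 1) * s 0 j) * partial j m s
  + 2^-1 * \sum_(j < d) \sum_(k < d)
      s 0 j * ((j == k)%:R - s 0 k) * partial j (partial k m) s.

Definition psi0 s : R :=
  ((4 * pi) ^+ d * (1 - norm1 s) * \prod_(j < d) s 0 j) `^ (- 2^-1).

Definition v_fun (f sigma2 : 'rV[R]_d -> R) s : R :=
  psi0 s * sigma2 s / f s.

Definition asymptotic_mse (f sigma2 m : 'rV[R]_d -> R) s (n : nat) (b : R) : R :=
  b ^+ 2 * g_fun m s ^+ 2 + n%:R^-1 * b `^ (- (d%:R / 2)) * v_fun f sigma2 s.

Definition b_opt (f sigma2 m : 'rV[R]_d -> R) s (n : nat) : R :=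
  n%:R `^ (- (2 / (d%:R + 4)))
  * (d%:R / 4 * (v_fun f sigma2 s / g_fun m s ^+ 2)) `^ (2 / (d%:R + 4)).

(* Little-o as n tends to infinity, at a rate independent of s in A. *)
Definition uniform_littleo (A : set 'rV[R]_d) (r : 'rV[R]_d -> nat -> R)
    (e : nat -> R) : Prop :=
  forall eps, 0 < eps -> \forall n \near \oo,
    forall s, A s -> `|r s n| <= eps * `|e n|.

Definition uniform_bigO (a : forall n, 'I_n -> R) (e : nat -> R) : Prop :=
  exists C, \forall n \near \oo, forall i, `|a n i| <= C * `|e n|.

Definition bandwidth (b : nat -> R) : Prop :=
  [/\ forall n, (0 < n)%N -> 0 < b n,
      b @ \oo --> (0 : R) &
      (fun n => n%:R `^ (- d%:R^-1) : R^o) =o_\oo (b : nat -> R^o)].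

Definition design (f : 'rV[R]_d -> R) (x : forall n, 'I_n -> 'rV[R]_d) : Prop :=
  (forall n i, simplex_int (x n i)) /\
  forall B : set (borel R d), measurable B ->
    lebesgue_rV R d (frontier B) = 0%E ->
    n%:R^-1 * (\sum_(i < n) \1_B (x n i)) @[n --> \oo] -->
      \int[lebesgue_rV R d]_(y in B `&` simplex) f y.

(* Sample sizes are positive: at n = 0 there is no cell and nothing to cover. *)
Record cells (f : 'rV[R]_d -> R) (x : forall n, 'I_n -> 'rV[R]_d)
    (B : forall n, 'I_n -> set 'rV[R]_d) : Prop := {
  cells_convex : forall n i, convex_set (B n i);
  cells_compact : forall n i, compact (B n i);
  cells_disjoint : forall n (i j : 'I_n), i != j -> (B n i)° `&` (B n j)° = set0;
  cells_cover : forall n, (0 < n)%N -> \bigcup_i B n i = simplex;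
  cells_design : forall n i, (B n i)° (x n i);
  cells_frontier : forall n i, lebesgue_rV R d (frontier (B n i)) = 0%E;
  cells_diam : uniform_bigO (fun n i => diam (B n i))
    (fun n => n%:R `^ (- d%:R^-1));
  cells_mass : uniform_bigO
    (fun n i => \int[lebesgue_rV R d]_(t in B n i) f t - n%:R^-1)
    (fun n => n%:R `^ (- 1 - d%:R^-1)) }.

End simplex.

Section estimator.
Context (R : realType) (d : nat).
Context (disp : measure_display) (T : measurableType disp) (P : probability T R).

Definition mutually_independent (n : nat) (X : 'I_n -> T -> R) : Prop :=
  forall (J : {set 'I_n}) (A : 'I_n -> set R), (forall i, measurable (A i)) ->
    P (\bigcap_(i in [set` J]) X i @^-1` A i) =
      (\prod_(i in J) P (X i @^-1` A i))%E.

(* The integral of a non-integrable function is infinite, so a zero expectation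
   includes integrability and a finite variance square integrability. *)
Definition error_model (n : nat) (sigma2 : 'rV[R]_d -> R)
    (x : 'I_n -> 'rV[R]_d) (eps : 'I_n -> {RV P >-> R}) : Prop :=
  [/\ mutually_independent (fun i => eps i : T -> R),
      forall i, ('E_P[eps i] = 0)%E &
      forall i, ('V_P[eps i] = (sigma2 (x i))%:E)%E].

Definition response (n : nat) (m : 'rV[R]_d -> R) (x : 'I_n -> 'rV[R]_d)
    (eps : 'I_n -> T -> R) (i : 'I_n) (w : T) : R := m (x i) + eps i w.

Definition gm_estimator (n : nat) (Y : 'I_n -> T -> R)
    (B : 'I_n -> set 'rV[R]_d) (b : R) (s : 'rV[R]_d) (w : T) : R :=
  \sum_(i < n) Y i w * \int[lebesgue_rV R d]_(y in B i) kappa s b y.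

Definition bias (X : T -> R) (theta : R) : \bar R := ('E_P[X] - theta%:E)%E.

Definition mse (X : T -> R) (theta : R) : \bar R :=
  ('E_P[fun w => ((X w - theta) ^+ 2)%R])%E.

End estimator.

(* Main.v *)
(* The estimator has mean sum_i m(x_i) w_i and, the errors being uncorrelated,
   variance sum_i sigma^2(x_i) w_i^2, with w_i the integral over B_i of the
   Dirichlet kernel kappa_{s,b}.

   Bias.  Replacing m(x_i) by m on B_i costs the Lipschitz constant of m times
   the mesh, which is o(b); what is left is the mean of m under kappa_{s,b}.
   The Dirichlet distribution has centred moments b (1 - (d+1) s_j) + O(b^2),
   b s_j (1_{j=k} - s_k) + O(b^2) and O(b^2) for orders one, two and four,
   uniformly in s, so a second-order Taylor expansion gives b g(s) + o(b), the
   fourth moment absorbing the points far from s.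

   Variance.  kappa_{s,b}^2 = A_b kappa_{s,b/2}, and b^{d/2} A_b tends to
   psi_0(s).  Instead of Stirling's formula this uses
   Gamma(2z+1) / Gamma(z+1)^2 = 1 / ((2z+1) B(z+1,z+1)), where the centred and
   rescaled beta integrand converges to a Gaussian.  As diam B_i = o(b), the
   kernel is almost constant on a cell near s, where sigma^2(x_i) w_i^2 is thus
   close to n^{-1} times the integral of (sigma^2 / f) kappa_{s,b}^2; on the
   other cells Cauchy-Schwarz and the second moment of kappa_{s,b/2} suffice.

   Optimal bandwidth.  At b_opt e^u the two terms of the asymptotic MSE are
   b_opt^2 g^2 times e^{2u} and (4/d) e^{-du/2}; e^x > 1 + x for nonzero x makes
   their sum strictly minimal at u = 0. *)

Require Import Defs.
From mathcomp Require Import all_boot all_order all_algebra.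
From mathcomp Require Import all_classical all_reals all_analysis.
From mathcomp Require Import measurable_realfun.
From mathcomp Require Import ring lra.

Import Order.TTheory GRing.Theory Num.Theory.
Import numFieldNormedType.Exports.

Set Implicit Arguments.
Unset Strict Implicit.
Unset Printing Implicit Defensive.

Local Open Scope classical_set_scope.
Local Open Scope ring_scope.

(** * Gamma and beta integrals *)

(** The obstacle is uniformity. The bias remainder must be uniform over the open simplex, where
    nothing keeps s away from the boundary, while the variance remainder may depend on s. Hence the
    moments are not estimated but computed: a monomial shifts the Gamma arguments by integers, the
    recurrence turns the quotients into rational functions of b, and the resulting bounds involve
    only d. The order b^2 of the centred fourth moment hides a cancellation, which comes from a
    second difference vanishing to first order in b.

    The variance does use the position of s, through a radius on which every barycentric coordinate
    stays above half its value at s, and through the limit psi_0(s). The squared weights are not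
    given individual asymptotics: the error on a cell is bounded by an integral over that same cell,
    so that summation produces one integral over the simplex, whatever the number of cells.

    The two remainders of the expansion are then exact differences: squared bias minus b^2 g^2, and
    variance minus its leading term. *)

Section half_line_powers.
Context {R : realType}.
Local Notation mu := (@lebesgue_measure R).
Implicit Types (a c r t : R).

(** At negative bases [powR] only has a default value. Cutting it off there lets all integrals run
    over the whole line, and makes products of such factors vanish off the simplex. *)
Definition pospow a t : R := if 0 <= t then t `^ a else 0.

Lemma pospow_ge0 a t : 0 <= pospow a t.
Proof. by rewrite /pospow; case: ifP => // _; exact: powR_ge0. Qed.

Lemma measurable_pospow a : measurable_fun setT (pospow a).
Proof.
apply: measurable_fun_if => //=.
- exact: measurable_fun_ler.
- by apply: measurable_funTS; exact: measurable_powR.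
Qed.

(** Lebesgue measure is [c] times its image under the affine map: the two agree on half-open
    intervals, and these determine it. *)
Lemma ge0_integral_affine c r (G : R -> \bar R) : 0 < c ->
  measurable_fun setT G -> (forall t, (0 <= G t)%E) ->
  (\int[mu]_t G t = c%:E * \int[mu]_t G (c * t + r)%R)%E.
Proof.
move=> c0 mG G0.
have mphi : measurable_fun setT (fun t : measurableTypeR R => c * t + r : measurableTypeR R).
  by apply: measurable_funD => //; exact: measurable_funM.
pose nu := pushforward_measure (@lebesgue_measure R) mphi.
pose cn := NngNum (ltW c0).
have e A : measurable A -> mu A = mscale cn nu A.
  apply: lebesgue_measure_unique => /= _ [[a b]] _ <-.
  rewrite /mscale/= /pushforward/=.
  rewrite (_ : _ @^-1` _ = `]((a - r) / c), ((b - r) / c)]%classic); last first.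
    apply/seteqP; split => t /=; rewrite !in_itv/= ltr_pdivrMr// ler_pdivlMr// mulrC;
      by rewrite ltrBlDr lerBrDr.
  rewrite !lebesgue_measure_itv/= !lte_fin ltr_pM2r ?invr_gt0// ltrD2r.
  case: ifPn => _; last by rewrite mule0.
  by rewrite -!EFinD -EFinM; congr EFin; field; rewrite gt_eqF.
rewrite (@eq_measure_integral _ _ _ _ (mscale cn nu))//; last by move=> A mA _; exact: e.
rewrite ge0_integral_mscale//=; congr (_ * _)%E.
by rewrite ge0_integral_pushforward.
Qed.

Lemma pospowZ a c t : 0 < c -> pospow a (c * t) = c `^ a * pospow a t.
Proof.
move=> c0; rewrite /pospow pmulr_rge0//; case: ifPn => t0; last by rewrite mulr0.
by rewrite powRM// ltW.
Qed.

(** In the usual normalisation this is B(a+1, c+1), and [gamma_int a] is Gamma(a+1). The arguments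
    are exponents rather than parameters because the kernel has the exponents s_j/b. *)
Definition beta_int a c : \bar R :=
  (\int[mu]_t (pospow a t * pospow c (1 - t))%:E)%E.

Definition gamma_int a : \bar R := (\int[mu]_t (pospow a t * expR (- t))%:E)%E.

Let mconv a c r : measurable_fun setT (fun t => (pospow a t * pospow c (r - t))%:E).
Proof.
apply/measurable_EFinP; apply: measurable_funM; first exact: measurable_pospow.
by apply: measurableT_comp; [exact: measurable_pospow|exact: measurable_funB].
Qed.

Lemma beta_int_ge0 a c : (0 <= beta_int a c)%E.
Proof. by apply: integral_ge0 => t _; rewrite lee_fin mulr_ge0 ?pospow_ge0. Qed.

(** Substitute t = r u; the Jacobian supplies the extra 1 in the exponent. At r = 0 the left side is
    0 but, as 0^0 = 1, the right side need not be; that null set is discarded wherever r is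
    integrated. *)
Lemma pospow_convolution a c r : r != 0 ->
  (\int[mu]_t (pospow a t * pospow c (r - t))%:E =
   beta_int a c * (pospow (a + c + 1) r)%:E)%E.
Proof.
move=> rn0; have [r0|r0] := ltP 0 r; last first.
  have {}r0 : r < 0 by rewrite lt_neqAle rn0.
  rewrite [in RHS]/pospow leNgt r0/= mule0 integral0_eq// => t _.
  rewrite /pospow subr_ge0; case: ifPn => t0; last by rewrite mul0r.
  by rewrite leNgt (lt_le_trans r0 t0)/= mulr0.
rewrite (@ge0_integral_affine r 0)//; last first.
  by move=> t; rewrite lee_fin mulr_ge0 ?pospow_ge0.
under eq_integral.
  move=> t _; rewrite addr0 pospowZ// (_ : r - r * t = r * (1 - t)); last by ring.
  rewrite pospowZ// mulrACA EFinM; over.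
rewrite ge0_integralZl_EFin//; last 3 first.
- by move=> t _; rewrite lee_fin mulr_ge0 ?pospow_ge0.
- exact: mconv.
- by rewrite mulr_ge0 ?powR_ge0.
rewrite muleA -EFinM muleC /pospow (ltW r0); congr (_ * _%:E)%E.
rewrite -{1}(powRr1 (ltW r0)) -!powRD ?rn0 ?implybT//.
by rewrite addrC.
Qed.

Lemma ge0_integral_neq (G : R -> \bar R) (r : R) : measurable_fun setT G ->
  (forall t, (0 <= G t)%E) -> (\int[mu]_t G t = \int[mu]_(t in ~` [set r]) G t)%E.
Proof.
move=> mG G0; rewrite -setTD; apply: ge0_negligible_integral => //.
exact: lebesgue_measure_set1.
Qed.

(* Both sides are the integral of the convolution of the two powers against
   exp(-t), by Tonelli. *)
Lemma beta_gamma_int a c :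
  (beta_int a c * gamma_int (a + c + 1) = gamma_int a * gamma_int c)%E.
Proof.
pose H (p : R * R) := ((pospow a p.1 * pospow c (p.2 - p.1) * expR (- p.2))%:E)%E.
have mH : measurable_fun setT H.
  apply/measurable_EFinP; apply: measurable_funM; last first.
    by apply: measurableT_comp => //; exact: measurableT_comp.
  apply: measurable_funM.
    by apply: measurableT_comp; first exact: measurable_pospow.
  by apply: measurableT_comp; [exact: measurable_pospow|exact: measurable_funB].
have H0 p : (0 <= H p)%E by rewrite lee_fin !mulr_ge0 ?pospow_ge0 ?expR_ge0.
have mg b : measurable_fun setT (fun t => (pospow b t * expR (- t))%:E).
  apply/measurable_EFinP; apply: measurable_funM; first exact: measurable_pospow.
  exact: measurableT_comp.
have g0 b t : (0 <= (pospow b t * expR (- t))%:E)%E.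
  by rewrite lee_fin mulr_ge0 ?pospow_ge0 ?expR_ge0.
transitivity (\int[mu]_x \int[mu]_y H (x, y))%E; last first.
  rewrite muleC -ge0_integralZl//; [|exact: mg|exact: integral_ge0].
  apply: eq_integral => x _.
  rewrite muleC -ge0_integralZl//; last exact: mg.
  (* The shift t = y - x turns the product of the two Gamma integrands into the integrand of the
     convolution. *)
  rewrite [RHS](@ge0_integral_affine 1 (- x))//; last 2 first.
  - by apply: measurable_funeM; exact: mg.
  - by move=> t; rewrite mule_ge0.
  rewrite mul1e; apply: eq_integral => y _.
  rewrite /H/= !mul1r -EFinM; congr EFin.
  by rewrite mulrACA -expRD (_ : - x - (y - x) = - y)//; ring.
rewrite fubini_tonelli// (ge0_integral_neq 0); last 2 first.
- exact: measurable_fun_fubini_tonelli_G.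
- by move=> y; exact: integral_ge0.
rewrite [in LHS]/gamma_int (ge0_integral_neq 0)//.
rewrite -ge0_integralZl//; last 3 first.
- exact: measurableC.
- by apply: measurable_funTS; exact: mg.
- exact: beta_int_ge0.
apply: eq_integral => r; rewrite inE/= => /eqP rn0.
under [RHS]eq_integral do rewrite /H/= mulrC EFinM.
rewrite ge0_integralZl_EFin//; last 2 first.
- by move=> t _; rewrite lee_fin mulr_ge0 ?pospow_ge0.
- exact: mconv.
by rewrite pospow_convolution// EFinM [RHS]muleC muleA.
Qed.


Let mgamma a : measurable_fun setT (fun t => (pospow a t * expR (- t))%:E).
Proof.
apply/measurable_EFinP; apply: measurable_funM; first exact: measurable_pospow.
exact: measurableT_comp.
Qed.

(** Half of the exponential pays for the power: x <= exp x at x = t/(2a), raised to the power a,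
    gives t^a <= (2a)^a exp(t/2). What is left is a multiple of the exponential density of rate
    1/2. *)
Lemma gamma_int_lty a : 0 <= a -> (gamma_int a < +oo)%E.
Proof.
move=> a0.
have [K K0 hK] : exists2 K, 0 <= K & forall t, 0 <= t -> t `^ a <= K * expR (t / 2).
  have [->|an0] := eqVneq a 0.
    exists 1 => // t t0; rewrite powRr0 mul1r -expR0 ler_expR.
    by rewrite divr_ge0.
  have {an0}a0 : 0 < a by rewrite lt_neqAle eq_sym an0.
  exists ((2 * a) `^ a); first exact: powR_ge0.
  move=> t t0.
  have a20 : 0 < 2 * a by rewrite mulr_gt0.
  have -> : t = (2 * a) * (t / (2 * a)) by rewrite mulrC divfK// gt_eqF.
  rewrite powRM; [|exact: ltW|by rewrite divr_ge0// ltW].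
  apply: ler_wpM2l; first exact: powR_ge0.
  have -> : 2 * a * (t / (2 * a)) / 2 = t / (2 * a) * a.
    by field; rewrite gt_eqF.
  rewrite (_ : expR (_ * a) = expR (t / (2 * a)) `^ a); last first.
    by rewrite /powR gt_eqF ?expR_gt0// expRK mulrC.
  apply: ge0_ler_powR; rewrite ?nnegrE ?expR_ge0 ?divr_ge0 ?(ltW a0) ?(ltW a20)//.
  by apply: le_trans (expR_ge1Dx _); rewrite lerDr.
have ie := @integrable_exponential_pdf R 2^-1 ltac:(by rewrite invr_gt0).
apply: (@le_lt_trans _ _ (\int[mu]_t ((2 * K)%:E * (exponential_pdf 2^-1 t)%:E))%E).
  apply: ge0_le_integral => //.
  - by move=> t _; rewrite lee_fin mulr_ge0 ?pospow_ge0 ?expR_ge0.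
  - exact: mgamma.
  - apply: measurable_funeM; exact: (measurable_int _ ie).
  move=> t _; rewrite lee_fin /pospow; case: ifPn => t0; last first.
    by rewrite mul0r !mulr_ge0// exponential_pdf_ge0.
  rewrite exponential_pdfE//.
  apply: (le_trans (ler_wpM2r (expR_ge0 _) (hK _ t0))).
  rewrite -mulrA -expRD (_ : 2 * K * _ = K * expR (- 2^-1 * t)); last by field.
  by rewrite (_ : t / 2 - t = - 2^-1 * t)//; field.
rewrite integralZl// integral_exponential_pdf ?invr_gt0//.
by rewrite mule1 ltry.
Qed.

Lemma gamma_int_gt0 a : 0 <= a -> (0 < gamma_int a)%E.
Proof.
move=> a0.
apply: (@lt_le_trans _ _ (\int[mu]_(t in `[1%R, 2%R]) (cst (expR (- 2))%:E) t)%E).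
  rewrite integral_cst//= lebesgue_measure_itv/= lte_fin ltr1n -EFinD.
  by rewrite -EFinM lte_fin mulr_gt0 ?expR_gt0//; lra.
rewrite [leLHS]integral_mkcond/=; apply: ge0_le_integral => //.
- by move=> t _; rewrite patchE; case: ifP => // _; rewrite lee_fin expR_ge0.
- apply/(measurable_restrictT _ _).1 => //.
- exact: mgamma.
move=> t _; rewrite patchE; case: ifPn => [|_]; last first.
  by rewrite lee_fin mulr_ge0 ?pospow_ge0 ?expR_ge0.
rewrite inE/= in_itv/= => /andP[t1 t2]; have t0 : 0 <= t by rewrite (le_trans _ t1).
rewrite lee_fin /pospow t0 -[leLHS]mul1r ler_pM ?expR_ge0 ?ler_expR ?lerN2//.
by rewrite -[leLHS](congr1 (@^~ a) (@powR1 R)) ge0_ler_powR ?nnegrE.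
Qed.

Lemma gamma_intE a : 0 <= a -> gamma_int a = (Gamma (a + 1))%:E.
Proof.
move=> a0; rewrite /Gamma /Rintegral addrK.
suff -> : (\int[mu]_(t in `]0%R, +oo[) (t `^ a * expR (- t))%:E)%E = gamma_int a.
  by rewrite fineK// ge0_fin_numE ?gamma_int_lty// ltW ?gamma_int_gt0.
rewrite /gamma_int (ge0_integral_neq 0); last 2 first.
- exact: mgamma.
- by move=> t; rewrite lee_fin mulr_ge0 ?pospow_ge0 ?expR_ge0.
rewrite integral_mkcond [RHS]integral_mkcond; apply: eq_integral => t _.
rewrite !patchE !(in_setE,mem_setE)/= in_itv/= andbT.
case: ifPn => t0.
  by rewrite ifT; [rewrite /pospow ltW|rewrite inE/=; apply/eqP; rewrite gt_eqF].
case: ifPn => //; rewrite inE/= => /eqP tn0.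
by rewrite /pospow le_eqVlt eq_sym (negbTE tn0)/= (negbTE t0) mul0r.
Qed.

Lemma Gamma_gt0 a : 1 <= a -> 0 < Gamma a.
Proof.
move=> a1; have a0 : 0 <= a - 1 by rewrite subr_ge0.
by rewrite -lte_fin -[a](subrK 1) -gamma_intE//; exact: gamma_int_gt0.
Qed.

Lemma beta_intE a c : 0 <= a -> 0 <= c ->
  beta_int a c = (Gamma (a + 1) * Gamma (c + 1) / Gamma (a + c + 1 + 1))%:E.
Proof.
move=> a0 c0; have := beta_gamma_int a c.
rewrite !gamma_intE//; last by rewrite !addr_ge0.
have G0 : 0 < Gamma (a + c + 1 + 1) :> R by rewrite Gamma_gt0// lerDr !addr_ge0.
case: (beta_int a c) (beta_int_ge0 a c) => [r _| |]//=.
  rewrite -!EFinM => -[<-]; congr EFin; rewrite mulfK// gt_eqF//.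
(* An infinite beta integral would make the left side of the identity infinite, while the right side
   is finite. *)
by move=> _; rewrite gt0_mulye// -EFinM.
Qed.

Lemma Gamma1 : Gamma 1 = 1 :> R.
Proof.
have := @gamma_intE 0 (lexx 0); rewrite add0r => h; apply/EFin_inj; rewrite -h.
rewrite -(@integral_exponential_pdf R 1 ltr01); apply: eq_integral => t _.
rewrite /pospow; case: ifPn => t0.
  by rewrite powRr0 mul1r exponential_pdfE// mul1r mulN1r.
by rewrite mul0r lt0_exponential_pdf// ltNge.
Qed.

Lemma beta_int0 a : 0 <= a -> beta_int a 0 = ((a + 1)^-1)%:E.
Proof.
move=> a0; have a10 : 0 < a + 1 by rewrite ltr_wpDl.
transitivity (\int[mu]_(t in `[0%R, 1%R]) (t `^ a)%:E)%E.
  rewrite [RHS]integral_mkcond; apply: eq_integral => t _.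
  rewrite patchE mem_setE in_itv/= /pospow subr_ge0 powRr0.
  by case: (0 <= t); case: (t <= 1); rewrite /= ?mul0r ?mulr0 ?mulr1.
pose F (t : R) := (a + 1)^-1 * t `^ (a + 1).
have c0 (p : R) : 0 < p -> t `^ p @[t --> (0:R)^'+] --> 0 `^ p.
  by move=> p0; rewrite powR0 ?gt_eqF//; exact: powR_cvg0.
have cp (p t : R) : 0 < t -> u `^ p @[u --> t] --> t `^ p.
  move=> t0; apply/(@differentiable_continuous R R R t (fun u : R => u `^ p))/derivable1_diffP.
  by apply: derivable_powR; rewrite in_itv/= t0.
rewrite (@continuous_FTC2 _ _ F)//.
- by rewrite /F powR1 mulr1 powR0 ?gt_eqF// mulr0 sube0.
- have [->|an0] := eqVneq a 0.
    rewrite (_ : (fun t : R => t `^ 0) = cst 1); first by apply: continuous_subspaceT; exact: cst_continuous.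
    by apply/funext => t; rewrite powRr0.
  apply/continuous_within_itvP => //; split.
  + by move=> t; rewrite in_itv/= => /andP[t0 _]; exact: cp.
  + by apply: c0; rewrite lt_neqAle eq_sym an0.
  + by apply: cvg_at_left_filter; exact: cp.
- split.
  + move=> t; rewrite in_itv/= => /andP[t0 _]; apply: derivableM => //.
    by apply: derivable_powR; rewrite in_itv/= t0.
  + by apply: cvgM; [exact: cvg_cst|exact: c0].
  + by apply: cvgM; [exact: cvg_cst|apply: cvg_at_left_filter; exact: cp].
- move=> t; rewrite in_itv/= => /andP[t0 _]; rewrite /F.
  have dp : derivable (fun u : R => u `^ (a + 1)) t 1.
    by apply: derivable_powR; rewrite in_itv/= t0.
  rewrite derive1Ml// powR_derive1 ?in_itv/= ?t0// addrK mulrA mulVf ?mul1r//.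
  by rewrite gt_eqF.
Qed.

(** In place of an integration by parts on the half-line: B(a, 1) is 1/a by direct integration on
    [0, 1], and Gamma(a) Gamma(1) / Gamma(a+1) by the beta-Gamma identity. *)
Lemma GammaS a : 1 <= a -> Gamma (a + 1) = a * Gamma a.
Proof.
move=> a1; have a0 : 0 <= a - 1 by rewrite subr_ge0.
have := beta_int0 a0; rewrite beta_intE// addr0 add0r Gamma1 mulr1 !subrK => -[].
have G1 : 0 < Gamma a by exact: Gamma_gt0.
have G2 : 0 < Gamma (a + 1) by rewrite Gamma_gt0// (le_trans a1)// lerDl.
move=> /(congr1 (fun z => z * a * Gamma (a + 1))).
rewrite mulVf ?mul1r; last by rewrite gt_eqF// (lt_le_trans _ a1).
move=> <-; move: G1 G2; move: (Gamma a) (Gamma (a + 1)) => u v u0 v0.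
by field; rewrite gt_eqF.
Qed.

End half_line_powers.

(** * Dirichlet integrals in any dimension *)

Section dirichlet_integral.
Context {R : realType}.
Local Notation mu := (@lebesgue_measure R).

Let dirichlet_integrand n (a : 'I_n -> R) (c r : R) (t : n.-tuple (measurableTypeR R)) : R :=
  \prod_(j < n) pospow (a j) (tnth t j) * pospow c (r - \sum_(j < n) tnth t j).

Let dirichlet_integrand_ge0 n (a : 'I_n -> R) c r t : 0 <= dirichlet_integrand a c r t.
Proof. by rewrite mulr_ge0 ?pospow_ge0// prodr_ge0// => j _; rewrite pospow_ge0. Qed.

Let measurable_dirichlet_integrand n (a : 'I_n -> R) c r :
  measurable_fun setT (dirichlet_integrand a c r).
Proof.
apply: measurable_funM.
  apply: measurable_prod => j _.
  by apply: measurableT_comp; [exact: measurable_pospow|exact: measurable_tnth].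
apply: measurableT_comp; first exact: measurable_pospow.
by apply: measurable_funB => //; apply: measurable_sum => j; exact: measurable_tnth.
Qed.

(** Induction on the dimension. Once the first coordinate x is split off by Tonelli, the others form
    a Dirichlet integral of total r - x, which is why the total is kept general; its value is a
    power of r - x, and the remaining integral in x is a beta convolution. The point x = r, where
    the induction hypothesis is silent, is null. *)
Lemma tuple_dirichlet_integral n (a : 'I_n -> R) c r : (forall j, 0 <= a j) -> 0 <= c -> r != 0 ->
  (\int[lebesgue_tuple R n]_t
    (\prod_(j < n) pospow (a j) (tnth t j) * pospow c (r - \sum_(j < n) tnth t j))%:E =
  ((\prod_(j < n) Gamma (a j + 1)) * Gamma (c + 1) / Gamma (\sum_(j < n) a j + n%:R + c + 1) *
     pospow (\sum_(j < n) a j + n%:R + c) r)%:E)%E.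
Proof.
elim: n a c r => [|n IHn] a c r a0 c0 r0.
  rewrite /= integral_dirac//; last first.
    by apply/measurable_EFinP; exact: measurable_dirichlet_integrand.
  rewrite diracT mul1e !big_ord0 subr0 !add0r !mul1r mulfV ?mul1r//.
  by rewrite gt_eqF// Gamma_gt0// lerDr.
rewrite /= ge0_integral_pushforward//=; last 3 first.
- exact: measurable_tuple_cons.
- by apply/measurable_EFinP; exact: measurable_dirichlet_integrand.
- by move=> t _; rewrite lee_fin dirichlet_integrand_ge0.
pose H p := (dirichlet_integrand a c r (@tuple_cons R n p))%:E.
have mH : measurable_fun setT H.
  apply/measurable_EFinP.
  exact: (measurableT_comp (@measurable_dirichlet_integrand n.+1 a c r) (@measurable_tuple_cons R n)).
rewrite preimage_setT (fubini_tonelli1 H)//; last first.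
  by move=> t; rewrite lee_fin dirichlet_integrand_ge0.
set a' := fun j => a (lift ord0 j).
set e := \sum_(j < n) a' j + n%:R + c.
have a'0 j : 0 <= a' j by exact: a0.
have e0 : 0 <= e by rewrite !addr_ge0// sumr_ge0.
set K := (\prod_(j < n) Gamma (a' j + 1)) * Gamma (c + 1) / Gamma (e + 1).
have K0 : 0 <= K.
  rewrite divr_ge0 ?mulr_ge0 ?prodr_ge0//; last 2 first.
  - by rewrite ltW// Gamma_gt0// lerDr.
  - by rewrite ltW// Gamma_gt0// lerDr.
  by move=> j _; rewrite ltW// Gamma_gt0// lerDr.
rewrite (ge0_integral_neq r); last 2 first.
- by apply: (measurable_fun_fubini_tonelli_F H) => // t; rewrite lee_fin dirichlet_integrand_ge0.
- by move=> x; apply: integral_ge0 => t _; rewrite lee_fin dirichlet_integrand_ge0.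
transitivity (\int[mu]_(x in [set~ r]) (K%:E * (pospow (a ord0) x * pospow e (r - x))%:E))%E.
  apply: eq_integral => x; rewrite inE/= => /eqP xr.
  rewrite /fubini_F.
  transitivity (\int[lebesgue_tuple R n]_t ((pospow (a ord0) x)%:E *
    (\prod_(j < n) pospow (a' j) (tnth t j) * pospow c (r - x - \sum_(j < n) tnth t j))%:E))%E.
    apply: eq_integral => t _; rewrite /H /dirichlet_integrand -EFinM !big_ord_recl/=.
    rewrite (tnth_nth 0)/= -mulrA opprD addrA; congr (_ * (_ * pospow c (_ - _))%R)%:E.
      by apply: eq_bigr => j _; rewrite [in LHS](tnth_nth 0)/= -tnth_nth.
    by apply: eq_bigr => j _; rewrite [in LHS](tnth_nth 0)/= -tnth_nth.
  rewrite ge0_integralZl_EFin ?pospow_ge0//; last 2 first.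
  - by move=> t _; rewrite lee_fin dirichlet_integrand_ge0.
  - by apply/measurable_EFinP; exact: measurable_dirichlet_integrand.
  rewrite IHn// ?subr_eq0 1?eq_sym// -!EFinM; congr EFin.
  by rewrite mulrCA.
rewrite -ge0_integral_neq; last 2 first.
- apply: measurable_funeM; apply/measurable_EFinP; apply: measurable_funM; first exact: measurable_pospow.
  by apply: measurableT_comp; [exact: measurable_pospow|exact: measurable_funB].
- move=> x; rewrite -EFinM lee_fin; apply: mulr_ge0 => //.
  by apply: mulr_ge0; exact: pospow_ge0.
rewrite ge0_integralZl_EFin//; last 2 first.
- by move=> t _; rewrite lee_fin mulr_ge0 ?pospow_ge0.
- apply/measurable_EFinP; apply: measurable_funM; first exact: measurable_pospow.
  by apply: measurableT_comp; [exact: measurable_pospow|exact: measurable_funB].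
rewrite pospow_convolution// beta_intE// -!EFinM mulrA; congr (_ * pospow _ _)%:E; last first.
  by rewrite big_ord_recl -natr1 /e /a'; ring.
rewrite /K big_ord_recl.
rewrite (_ : a ord0 + e + 1 + 1 = \sum_(j < n.+1) a j + n.+1%:R + c + 1); last first.
  by rewrite big_ord_recl -natr1 /e /a'; ring.
have : Gamma (e + 1) != 0 by rewrite gt_eqF// Gamma_gt0// lerDr.
set G1 := Gamma (e + 1) => G10.
have : Gamma (\sum_(j < n.+1) a j + n.+1%:R + c + 1) != 0.
  by rewrite gt_eqF// Gamma_gt0// lerDr !addr_ge0// sumr_ge0.
move: G10; rewrite -/G1; move: G1 (Gamma _) => {}G1 G2 G10 G20.
rewrite -[\prod_(i < n) Gamma (a (lift ord0 i) + 1)]/(\prod_(j < n) Gamma (a' j + 1)).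
move: (\prod_(j < n) _) (Gamma _) (Gamma (c + 1)) => p u v.
by field; apply/andP.
Qed.

End dirichlet_integral.

(** * The simplex and the Dirichlet kernel *)

Section borel.
Context {R : realType} {d : nat}.
Implicit Types (h : 'rV[R]_d -> R) (A : set 'rV[R]_d).

Lemma closed_measurable_borel A : closed A -> measurable (A : set (borel R d)).
Proof.
move=> cA; rewrite -[A]setCK; apply: measurableC; apply: sub_sigma_algebra.
exact: closed_openC.
Qed.

Lemma open_measurable_borel A : open A -> measurable (A : set (borel R d)).
Proof. by move=> oA; apply: sub_sigma_algebra. Qed.

Lemma within_continuous_measurable_borel A h : closed A ->
  {within A, continuous h} -> measurable_fun (A : set (borel R d)) h.
Proof.
move=> cA /continuousP ch mA; apply: (measurability _ (RGenOpens.measurableE R)) => //.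
move=> _ [_ [a [b ->] <-]].
have ho : @open (subspace A) (h @^-1` `]a, b[) by apply: ch; exact: interval_open.
have [U oU UE] := (open_subspaceP _ _).1 ho.
rewrite setIC -UE setIC; apply: measurableI => //.
exact: open_measurable_borel.
Qed.

Lemma continuous_measurable_borel h : continuous h ->
  measurable_fun (setT : set (borel R d)) h.
Proof.
move=> ch; apply: within_continuous_measurable_borel; first exact: closedT.
exact: continuous_subspaceT.
Qed.

Lemma measurable_coord (j : 'I_d) :
  measurable_fun (setT : set (borel R d)) (fun y : 'rV[R]_d => y 0 j).
Proof. apply: continuous_measurable_borel; exact: coord_continuous. Qed.

Lemma norm1_continuous : continuous (@norm1 R d).
Proof.
apply: continuous_big => [|j _ y]; first exact: add_continuous.
have h : (z 0 j : R) @[z --> (y : 'rV[R]_d)] --> (y 0 j : R) by exact: coord_continuous.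
exact: (cvg_norm h).
Qed.

Lemma simplexE (y : 'rV[R]_d) :
  simplex y <-> (forall j, 0 <= y 0 j) /\ \sum_(j < d) y 0 j <= 1.
Proof.
split=> [[y0]|[y0 y1]].
  rewrite /norm1 (eq_bigr (fun j => y 0 j)) => [y1|j _]; last first.
    by rewrite ger0_norm//; case/andP: (y0 j).
  by split => // j; case/andP: (y0 j).
split; last by rewrite /norm1 (eq_bigr (fun j => y 0 j))// => j _; rewrite ger0_norm.
move=> j; rewrite y0/=; apply: le_trans y1.
by rewrite (bigD1 j)//= lerDl sumr_ge0.
Qed.

Lemma norm1_simplex (y : 'rV[R]_d) : simplex y -> norm1 y = \sum_(j < d) y 0 j.
Proof.
by move=> /simplexE[y0 _]; apply: eq_bigr => j _; rewrite ger0_norm.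
Qed.

Lemma simplex_ge0 (y : 'rV[R]_d) j : simplex y -> 0 <= y 0 j.
Proof. by case=> y0 _; case/andP: (y0 j). Qed.

Lemma simplex_le1 (y : 'rV[R]_d) j : simplex y -> y 0 j <= 1.
Proof. by case=> y0 _; case/andP: (y0 j). Qed.

Lemma simplex_int_simplex (y : 'rV[R]_d) : simplex_int y -> simplex y.
Proof.
move=> [y0 y1]; split; last exact: ltW.
by move=> j; case/andP: (y0 j) => /ltW-> /ltW->.
Qed.

Lemma simplex_int_gt0 (y : 'rV[R]_d) j : simplex_int y -> 0 < y 0 j.
Proof. by case=> y0 _; case/andP: (y0 j). Qed.

Lemma simplex_closed : closed (@simplex R d).
Proof.
rewrite (_ : @simplex R d = \bigcap_j ((fun y : 'rV[R]_d => y 0 j) @^-1` `[0, 1]%classic) `&`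
  (@norm1 R d @^-1` `]-oo, 1]%classic)); last first.
  apply/seteqP; split => y.
    by case=> y0 y1; split=> [j _|] /=; rewrite in_itv//=; exact: y0.
  case=> y0; rewrite /= in_itv/= => y1; split=> // j.
  by have := y0 j I; rewrite /= in_itv.
apply: closedI.
  apply: closed_bigI => j _; apply: closed_comp; last exact: interval_closed.
  by move=> y _; exact: coord_continuous.
apply: closed_comp; last exact: interval_closed.
by move=> y _; exact: norm1_continuous.
Qed.

Lemma measurable_simplex : measurable (@simplex R d : set (borel R d)).
Proof. exact: closed_measurable_borel simplex_closed. Qed.

Lemma norm_coord_le (y : 'rV[R]_d) j : `|y 0 j| <= `|y|.
Proof.
rewrite /Num.norm/= mx_normrE.
exact: (@le_bigmax _ _ _ 0 (fun ij => `|y ij.1 ij.2|) (0, j)).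
Qed.

Lemma norm_rV_le (y : 'rV[R]_d) r : 0 <= r -> (forall j, `|y 0 j| <= r) -> `|y| <= r.
Proof.
move=> r0 h; rewrite /Num.norm/= mx_normrE; apply: bigmax_le => //= -[i j] _ /=.
by rewrite ord1.
Qed.

Lemma simplex_compact : compact (@simplex R d).
Proof.
apply: bounded_closed_compact; last exact: simplex_closed.
exists 1; split => // x x1 y sy; apply: (le_trans _ (ltW x1)).
apply: norm_rV_le => // j; rewrite ger0_norm ?simplex_le1//; exact: simplex_ge0.
Qed.

(** Off the simplex some coordinate or the slack is negative and the corresponding [pospow]
    vanishes, so the domain can be extended to the whole space and pulled back to tuples. *)
Lemma simplex_dirichlet_integral (a : 'I_d -> R) c : (forall j, 0 <= a j) -> 0 <= c ->
  (\int[lebesgue_rV R d]_(y in @simplex R d)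
    (\prod_(j < d) y 0 j `^ a j * (1 - norm1 y) `^ c)%:E =
  ((\prod_(j < d) Gamma (a j + 1)) * Gamma (c + 1) / Gamma (\sum_(j < d) a j + d%:R + c + 1))%:E)%E.
Proof.
move=> a0 c0.
pose G (y : 'rV[R]_d) := \prod_(j < d) pospow (a j) (y 0 j) * pospow c (1 - \sum_(j < d) y 0 j).
have mG : measurable_fun (setT : set (borel R d)) G.
  apply: measurable_funM.
    apply: measurable_prod => j _.
    by apply: measurableT_comp; [exact: measurable_pospow|exact: measurable_coord].
  apply: measurableT_comp; first exact: measurable_pospow.
  by apply: measurable_funB => //; apply: measurable_sum => j; exact: measurable_coord.
transitivity (\int[lebesgue_rV R d]_y (G y)%:E)%E.
  rewrite [LHS]integral_mkcond; apply: eq_integral => y _; rewrite patchE.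
  case: ifPn => [|ny].
    rewrite inE => sy; rewrite /G norm1_simplex//; have [y0 y1] := (simplexE y).1 sy.
    rewrite /pospow subr_ge0 y1; congr (_ * _)%:E; apply: eq_bigr => j _.
    by rewrite y0.
  case: (pselect (forall j, 0 <= y 0 j)) => y0.
    rewrite /G [X in _ * X](_ : _ = 0) ?mulr0// /pospow ifF//.
    apply/negP; rewrite subr_ge0 => y1; move/negP: ny; apply.
    by rewrite inE; apply/simplexE.
  move/existsNP : y0 => [j /negP y0].
  by rewrite /G (bigD1 j)//= {1}/pospow (negbTE y0) !mul0r.
rewrite ge0_integral_pushforward//; last 3 first.
- exact: measurable_row_of_tuple.
- exact/measurable_EFinP.
- by move=> y _; rewrite lee_fin mulr_ge0 ?pospow_ge0// prodr_ge0// => j _; exact: pospow_ge0.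
rewrite preimage_setT.
transitivity (\int[lebesgue_tuple R d]_t
    (\prod_(j < d) pospow (a j) (tnth t j) * pospow c (1 - \sum_(j < d) tnth t j))%:E)%E.
  apply: eq_integral => t _; rewrite /G/=; congr (_ * pospow c (_ - _))%:E.
    by apply: eq_bigr => j _; rewrite mxE.
  by apply: eq_bigr => j _; rewrite mxE.
rewrite tuple_dirichlet_integral// /pospow ler01 powR1 mulr1//.
Qed.

(** The volume is the Dirichlet integral with all exponents 0, where x^0 = 1 even on the
    boundary. *)
Lemma simplex_finite : (lebesgue_rV R d (@simplex R d) < +oo)%E.
Proof.
have := @simplex_dirichlet_integral (fun=> 0) 0 (fun=> lexx 0) (lexx 0).
set K := ((_ * _ / _)%:E)%E => e.
suff -> : lebesgue_rV R d (@simplex R d) = K by exact: ltry.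
rewrite -e -[LHS]mul1e -integral_cst//; last exact: measurable_simplex.
apply: eq_integral => y _; rewrite powRr0 mulr1 big1// => j _.
by rewrite powRr0.
Qed.

End borel.

Section bounded_measurable.
Context {R : realType} {d : nat}.
Implicit Types (h : 'rV[R]_d -> R) (A : set 'rV[R]_d).

(** A class closed under the algebraic operations and containing every integrand used below. As the
    simplex has finite volume, membership settles integrability on the simplex and on each cell at
    once. *)
Definition bounded_measurable h : Prop :=
  measurable_fun (@simplex R d : set (borel R d)) h /\
  exists M, forall y, simplex y -> `|h y| <= M.

Lemma bm_integrable A h : measurable (A : set (borel R d)) -> A `<=` @simplex R d ->
  bounded_measurable h -> (lebesgue_rV R d).-integrable A (EFin \o h).
Proof.
move=> mA AS [mh [M hM]].
have mS := @measurable_simplex R d.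
apply: (integrableS mS mA AS); apply: measurable_bounded_integrable => //.
  exact: simplex_finite.
exists M; split; first exact: num_real.
by move=> x Mx y /hM h1; apply: (le_trans h1); exact: ltW.
Qed.

Lemma bm_integrable_simplex h :
  bounded_measurable h -> (lebesgue_rV R d).-integrable (@simplex R d) (EFin \o h).
Proof. by apply: bm_integrable => //; exact: measurable_simplex. Qed.

Lemma bm_cst (r : R) : bounded_measurable (fun=> r).
Proof. by split; [exact: measurable_cst | exists `|r|]. Qed.

Lemma bmD h1 h2 : bounded_measurable h1 -> bounded_measurable h2 ->
  bounded_measurable (fun y => h1 y + h2 y).
Proof.
move=> [m1 [M1 H1]] [m2 [M2 H2]]; split; first exact: measurable_funD.
exists (M1 + M2) => y sy; apply: (le_trans (ler_normD _ _)).
by apply: lerD; [exact: H1|exact: H2].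
Qed.

Lemma bmM h1 h2 : bounded_measurable h1 -> bounded_measurable h2 ->
  bounded_measurable (fun y => h1 y * h2 y).
Proof.
move=> [m1 [M1 H1]] [m2 [M2 H2]]; split; first exact: measurable_funM.
exists (M1 * M2) => y sy; rewrite normrM.
by apply: ler_pM => //; [exact: H1|exact: H2].
Qed.

Lemma bmN h : bounded_measurable h -> bounded_measurable (fun y => - h y).
Proof.
move=> [m1 [M1 H1]]; split; first exact: measurableT_comp.
by exists M1 => y sy; rewrite normrN; exact: H1.
Qed.

Lemma bmB h1 h2 : bounded_measurable h1 -> bounded_measurable h2 ->
  bounded_measurable (fun y => h1 y - h2 y).
Proof. by move=> H1 H2; apply: bmD => //; exact: bmN. Qed.

Lemma bmX h n : bounded_measurable h -> bounded_measurable (fun y => h y ^+ n).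
Proof.
move=> H; elim: n => [|n IH].
  by rewrite (_ : (fun y => _) = fun=> 1)//; exact: bm_cst.
rewrite (_ : (fun y => _) = fun y => h y * h y ^+ n); first exact: bmM.
by apply/funext => y; rewrite exprS.
Qed.

Lemma bm_norm h : bounded_measurable h -> bounded_measurable (fun y => `|h y|).
Proof.
move=> [m1 [M1 H1]]; split; first exact: measurableT_comp.
by exists M1 => y sy; rewrite normr_id; exact: H1.
Qed.

Lemma bm_sum (I : Type) (r : seq I) (P : pred I) (F : I -> 'rV[R]_d -> R) :
  (forall i, P i -> bounded_measurable (F i)) ->
  bounded_measurable (fun y => \sum_(i <- r | P i) F i y).
Proof.
move=> HF; elim: r => [|i r IH].
  rewrite (_ : (fun y => _) = fun=> \big[+%R/0]_(i <- [::] | P i) 0); first exact: bm_cst.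
  by apply/funext => y; rewrite !big_nil.
rewrite (_ : (fun y => _) = fun y => if P i then +%R (F i y) (\big[+%R/0]_(i <- r | P i) F i y)
  else \big[+%R/0]_(i <- r | P i) F i y); last by apply/funext => y; rewrite big_cons.
by case Pi: (P i) => //; apply: bmD => //; exact: HF.
Qed.

Lemma bm_prod (I : Type) (r : seq I) (P : pred I) (F : I -> 'rV[R]_d -> R) :
  (forall i, P i -> bounded_measurable (F i)) ->
  bounded_measurable (fun y => \prod_(i <- r | P i) F i y).
Proof.
move=> HF; elim: r => [|i r IH].
  rewrite (_ : (fun y => _) = fun=> \big[*%R/1]_(i <- [::] | P i) 0); first exact: bm_cst.
  by apply/funext => y; rewrite !big_nil.
rewrite (_ : (fun y => _) = fun y => if P i then *%R (F i y) (\big[*%R/1]_(i <- r | P i) F i y)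
  else \big[*%R/1]_(i <- r | P i) F i y); last by apply/funext => y; rewrite big_cons.
by case Pi: (P i) => //; apply: bmM => //; exact: HF.
Qed.

Lemma bm_coord (j : 'I_d) : bounded_measurable (fun y => y 0 j).
Proof.
split; first by apply: measurable_funTS; exact: measurable_coord.
by exists 1 => y sy; rewrite ger0_norm ?simplex_le1//; exact: simplex_ge0.
Qed.

Lemma bm_continuous h : {within @simplex R d, continuous h} -> bounded_measurable h.
Proof.
move=> ch; split; first exact: within_continuous_measurable_borel simplex_closed ch.
have := continuous_compact ch simplex_compact => /compact_bounded[M [_ hM]].
exists (M + 1) => y sy; apply: (hM (M + 1)); first by rewrite ltrDl.
by exists y.
Qed.

Lemma bm_powR_coord p (j : 'I_d) : 0 <= p -> bounded_measurable (fun y => y 0 j `^ p).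
Proof.
move=> p0; split.
  apply: measurable_funTS; exact: (measurableT_comp (measurable_powR p) (measurable_coord j)).
exists 1 => y sy; rewrite ger0_norm ?powR_ge0// -[leRHS](congr1 (@^~ p) (@powR1 R)).
by rewrite ge0_ler_powR ?nnegrE ?simplex_le1//; exact: simplex_ge0.
Qed.

Lemma bm_powR_slack p : 0 <= p -> bounded_measurable (fun y : 'rV[R]_d => (1 - norm1 y) `^ p).
Proof.
move=> p0; split.
  apply: measurable_funTS.
  have mn : measurable_fun (setT : set (borel R d)) (fun y : 'rV[R]_d => 1 - norm1 y).
    apply: measurable_funB => //; apply: continuous_measurable_borel.
    exact: norm1_continuous.
  exact: (measurableT_comp (measurable_powR p) mn).
exists 1 => y sy; rewrite ger0_norm ?powR_ge0// -[leRHS](congr1 (@^~ p) (@powR1 R)).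
rewrite ge0_ler_powR ?nnegrE ?subr_ge0//; first by case: sy.
by rewrite gerBl sumr_ge0.
Qed.

End bounded_measurable.

(** * The Dirichlet kernel and its mixed moments *)

Section kernel.
Context {R : realType} {d : nat}.
Implicit Types (s y : 'rV[R]_d) (b : R).

(** The normalising constant is kept apart from the shape, since b acts on the shape only as a
    power: products and squares of shapes are again shapes with other exponents. *)
Definition kernel_shape s b y : R :=
  \prod_(j < d) y 0 j `^ (s 0 j / b) * (1 - norm1 y) `^ ((1 - norm1 s) / b).

Definition kernel_cst s b : R :=
  Gamma (b^-1 + d%:R + 1) /
  ((\prod_(j < d) Gamma (s 0 j / b + 1)) * Gamma ((1 - norm1 s) / b + 1)).

Lemma simplex_slack_ge0 s : simplex s -> 0 <= 1 - norm1 s.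
Proof. by case=> _; rewrite subr_ge0. Qed.

Lemma simplex_int_slack_gt0 s : simplex_int s -> 0 < 1 - norm1 s.
Proof. by case=> _; rewrite subr_gt0. Qed.

Lemma kappaE s b y : simplex s -> 0 < b ->
  kappa s b y = kernel_cst s b * kernel_shape s b y.
Proof.
move=> ss b0; rewrite /kappa /dirichlet /kernel_cst /kernel_shape.
have e j : (b^-1 *: s + const_mx 1) 0 j = s 0 j / b + 1 by rewrite !mxE mulrC.
have -> : norm1 (b^-1 *: s + const_mx 1) + ((1 - norm1 s) / b + 1) = b^-1 + d%:R + 1.
  rewrite {1}/norm1 (eq_bigr (fun j => s 0 j / b + 1)) => [|j _]; last first.
    by rewrite e ger0_norm// addr_ge0// divr_ge0 ?simplex_ge0// ltW.
  rewrite big_split/= -mulr_suml sumr_const card_ord norm1_simplex//.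
  by rewrite mulrBl mul1r; ring.
rewrite addrK (eq_bigr (fun j => Gamma (s 0 j / b + 1))) => [|j _]; last by rewrite e.
rewrite [X in _ * X = _](eq_bigr (fun j => y 0 j `^ (s 0 j / b))) => [|j _]; last first.
  by rewrite e addrK.
rewrite -[LHS]mulrA; congr (_ / _ * _); last exact: mulrC.
exact: mulrC.
Qed.

(** The expectation under the Dirichlet law with density [kappa s b]; that this has total mass one
    appears below as the moment of the empty monomial. *)
Definition simplex_mean s b (h : 'rV[R]_d -> R) : R :=
  \int[lebesgue_rV R d]_(y in @simplex R d) (kappa s b y * h y).

Lemma kernel_cst_gt0 s b : simplex s -> 0 < b -> 0 < kernel_cst s b.
Proof.
move=> ss b0; have bi0 : 0 < b^-1 by rewrite invr_gt0.
rewrite divr_gt0//; first by rewrite Gamma_gt0// lerDr addr_ge0// ltW.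
rewrite mulr_gt0//.
  apply: prodr_gt0 => j _; rewrite Gamma_gt0// lerDr divr_ge0 ?simplex_ge0//.
  exact: ltW.
by rewrite Gamma_gt0// lerDr divr_ge0 ?simplex_slack_ge0// ltW.
Qed.

Lemma kernel_shape_ge0 s b y : 0 <= kernel_shape s b y.
Proof.
by rewrite mulr_ge0 ?powR_ge0// prodr_ge0// => j _; rewrite powR_ge0.
Qed.

Lemma kappa_ge0 s b y : simplex s -> 0 < b -> 0 <= kappa s b y.
Proof.
move=> ss b0; rewrite kappaE// mulr_ge0 ?kernel_shape_ge0// ltW//.
exact: kernel_cst_gt0.
Qed.

Lemma bm_kappa s b : simplex s -> 0 < b -> bounded_measurable (kappa s b).
Proof.
move=> ss b0.
rewrite (_ : kappa s b = fun y => kernel_cst s b * kernel_shape s b y); last first.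
  by apply/funext => y; rewrite kappaE.
apply: bmM; first exact: bm_cst.
apply: bmM; last by apply: bm_powR_slack; rewrite divr_ge0 ?simplex_slack_ge0// ltW.
apply: bm_prod => j _; apply: bm_powR_coord.
by rewrite divr_ge0 ?simplex_ge0// ltW.
Qed.

Lemma simplex_meanD s b h1 h2 : simplex s -> 0 < b ->
  bounded_measurable h1 -> bounded_measurable h2 ->
  simplex_mean s b (fun y => h1 y + h2 y) = simplex_mean s b h1 + simplex_mean s b h2.
Proof.
move=> ss b0 H1 H2; rewrite /simplex_mean -RintegralD.
- by apply: eq_Rintegral => y _; rewrite mulrDr.
- exact: measurable_simplex.
- by apply: bm_integrable_simplex; apply: bmM => //; exact: bm_kappa.
- by apply: bm_integrable_simplex; apply: bmM => //; exact: bm_kappa.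
Qed.

Lemma simplex_meanZ s b r h : simplex s -> 0 < b -> bounded_measurable h ->
  simplex_mean s b (fun y => r * h y) = r * simplex_mean s b h.
Proof.
move=> ss b0 H; rewrite /simplex_mean -RintegralZl.
- by apply: eq_Rintegral => y _; rewrite mulrCA.
- exact: measurable_simplex.
- by apply: bm_integrable_simplex; apply: bmM => //; exact: bm_kappa.
Qed.

Lemma eq_simplex_mean s b h1 h2 : (forall y, simplex y -> h1 y = h2 y) ->
  simplex_mean s b h1 = simplex_mean s b h2.
Proof.
by move=> h; apply: eq_Rintegral => y; rewrite inE => sy; rewrite h.
Qed.

Lemma le_simplex_mean s b h1 h2 : simplex s -> 0 < b ->
  bounded_measurable h1 -> bounded_measurable h2 ->
  (forall y, simplex y -> h1 y <= h2 y) -> simplex_mean s b h1 <= simplex_mean s b h2.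
Proof.
move=> ss b0 H1 H2 h12; apply: le_Rintegral.
- exact: measurable_simplex.
- by apply: bm_integrable_simplex; apply: bmM => //; exact: bm_kappa.
- by apply: bm_integrable_simplex; apply: bmM => //; exact: bm_kappa.
- by move=> y sy; apply: ler_wpM2l; [exact: kappa_ge0|exact: h12].
Qed.

Lemma normr_simplex_mean s b h1 h2 : simplex s -> 0 < b ->
  bounded_measurable h1 -> bounded_measurable h2 ->
  (forall y, simplex y -> `|h1 y| <= h2 y) -> `|simplex_mean s b h1| <= simplex_mean s b h2.
Proof.
move=> ss b0 H1 H2 h12; rewrite ler_norml; apply/andP; split.
  rewrite lerNl -mulN1r -simplex_meanZ//; apply: le_simplex_mean => //.
    by apply: bmM => //; exact: bm_cst.
  by move=> y sy; rewrite mulN1r; apply: le_trans (h12 _ sy); rewrite -normrN ler_norm.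
by apply: le_simplex_mean => // y sy; apply: le_trans (h12 _ sy); rewrite ler_norm.
Qed.

Lemma simplex_mean_sum s b (I : Type) (r : seq I) (F : I -> 'rV[R]_d -> R) :
  simplex s -> 0 < b -> (forall i, bounded_measurable (F i)) ->
  simplex_mean s b (fun y => \sum_(i <- r) F i y) = \sum_(i <- r) simplex_mean s b (F i).
Proof.
move=> ss b0 HF; elim: r => [|i r IH].
  rewrite big_nil -[RHS](mul0r (simplex_mean s b (fun=> 0))) -simplex_meanZ//; last exact: bm_cst.
  by apply: eq_simplex_mean => y _; rewrite big_nil mul0r.
rewrite big_cons -IH -simplex_meanD//; last by apply: bm_sum.
by apply: eq_simplex_mean => y _; rewrite big_cons.
Qed.

Definition rising (z : R) (k : nat) : R := \prod_(i < k) (z + i%:R).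

Lemma Gamma_rising z k : 1 <= z -> Gamma (z + k%:R) = rising z k * Gamma z.
Proof.
move=> z1; elim: k => [|k IH]; first by rewrite addr0 /rising big_ord0 mul1r.
rewrite -natr1 addrA GammaS; last by rewrite (le_trans z1)// lerDl.
by rewrite IH /rising big_ord_recr/= mulrA; congr (_ * _); exact: mulrC.
Qed.

(** A monomial raises the exponents by integers, so the quotient of two Dirichlet integrals
    collapses, by the recurrence of Gamma, to a quotient of Pochhammer symbols. *)
Lemma simplex_mean_monomial s b (k : 'I_d -> nat) : simplex_int s -> 0 < b ->
  simplex_mean s b (fun y => \prod_(j < d) y 0 j ^+ k j) =
  (\prod_(j < d) rising (s 0 j / b + 1) (k j)) / rising (b^-1 + d%:R + 1) (\sum_(j < d) k j).
Proof.
move=> si b0; have ss := simplex_int_simplex si.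
have a0 j : 0 < s 0 j / b by rewrite divr_gt0// simplex_int_gt0.
have c0 : 0 <= (1 - norm1 s) / b by rewrite divr_ge0 ?simplex_slack_ge0// ltW.
have A1 : 1 <= b^-1 + d%:R + 1 by rewrite lerDr addr_ge0// invr_ge0 ltW.
rewrite /simplex_mean /Rintegral.
transitivity (fine (\int[lebesgue_rV R d]_(y in @simplex R d) ((kernel_cst s b)%:E *
   (\prod_(j < d) y 0 j `^ (s 0 j / b + (k j)%:R) * (1 - norm1 y) `^ ((1 - norm1 s) / b))%:E)%E)).
  congr fine; apply: eq_integral => y; rewrite inE => sy.
  rewrite kappaE// -EFinM; congr EFin; rewrite -mulrA; congr (_ * _).
  rewrite /kernel_shape mulrAC -big_split/=; congr (_ * _); apply: eq_bigr => j _.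
  rewrite powRD ?powR_mulrn ?simplex_ge0//.
  by rewrite gt_eqF// ltr_pwDl.
rewrite ge0_integralZl_EFin; last 4 first.
- exact: measurable_simplex.
- move=> y sy; rewrite lee_fin mulr_ge0 ?powR_ge0// prodr_ge0// => j _.
  exact: powR_ge0.
- apply/measurable_EFinP.
  suff [] : bounded_measurable (fun y => \prod_(j < d) y 0 j `^ (s 0 j / b + (k j)%:R) *
     (1 - norm1 y) `^ ((1 - norm1 s) / b)) by [].
  apply: bmM; last exact: bm_powR_slack.
  by apply: bm_prod => j _; apply: bm_powR_coord; rewrite addr_ge0// ltW.
- by rewrite ltW// kernel_cst_gt0.
rewrite simplex_dirichlet_integral//; last by move=> j; rewrite addr_ge0// ltW.
rewrite /= big_split/= -mulr_suml -natr_sum -norm1_simplex// /kernel_cst.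
have -> : \prod_(j < d) Gamma (s 0 j / b + (k j)%:R + 1) =
    \prod_(j < d) rising (s 0 j / b + 1) (k j) * \prod_(j < d) Gamma (s 0 j / b + 1).
  by rewrite -big_split/=; apply: eq_bigr => j _; rewrite addrAC Gamma_rising// lerDr ltW.
rewrite (_ : _ + d%:R + _ + 1 = b^-1 + d%:R + 1 + (\sum_(i < d) k i)%:R); last first.
  by rewrite mulrBl mul1r; ring.
rewrite (Gamma_rising _ A1).
have : Gamma (b^-1 + d%:R + 1) != 0 by rewrite gt_eqF// Gamma_gt0.
have : Gamma ((1 - norm1 s) / b + 1) != 0 by rewrite gt_eqF// Gamma_gt0// lerDr.
have : \prod_(j < d) Gamma (s 0 j / b + 1) != 0.
  by rewrite gt_eqF// prodr_gt0// => j _; rewrite Gamma_gt0// lerDr ltW.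
have : rising (b^-1 + d%:R + 1) (\sum_(i < d) k i) != 0.
  rewrite gt_eqF// prodr_gt0// => j _; rewrite ltr_pwDl// (lt_le_trans _ A1)//.
move: (rising _ _) => r1; move: (\prod_(j < d) Gamma _) => g1.
move: (Gamma ((1 - norm1 s) / b + 1)) => g2; move: (Gamma _) => g3.
move: (\prod_(j < d) rising _ _) => r2 r10 g10 g20 g30.
by field; rewrite r10 g10 g20 g30.
Qed.

End kernel.

(** * Centred moments of the Dirichlet distribution *)

Section moments.
Context {R : realType} {d : nat}.
Implicit Types (s y : 'rV[R]_d) (b : R).

Lemma rising_scaled (z b : R) k : b != 0 ->
  rising (z / b + 1) k = \prod_(i < k) ((z + b * i.+1%:R) / b).
Proof.
by move=> b0; apply: eq_bigr => i _; rewrite -natr1; field.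
Qed.

Lemma simplex_mean_coordX s b (j : 'I_d) n : simplex_int s -> 0 < b ->
  simplex_mean s b (fun y => y 0 j ^+ n) =
  \prod_(i < n) ((s 0 j + b * i.+1%:R) / (1 + b * (d%:R + i.+1%:R))).
Proof.
move=> si b0; have bn0 : b != 0 by rewrite gt_eqF.
pose k (i : 'I_d) := if i == j then n else 0%N.
rewrite -(@eq_simplex_mean _ _ s b (fun y => \prod_(i < d) y 0 i ^+ k i)); last first.
  move=> y _; rewrite (bigD1 j)//= /k eqxx big1 ?mulr1// => i /negbTE->.
  by rewrite expr0.
rewrite simplex_mean_monomial//.
have -> : \prod_(i < d) rising (s 0 i / b + 1) (k i) = rising (s 0 j / b + 1) n.
  rewrite (bigD1 j)//= big1 ?mulr1 => [|i /negbTE ij]; first by rewrite /k eqxx.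
  by rewrite /k ij /rising big_ord0.
have -> : (\sum_(i < d) k i = n)%N.
  rewrite (bigD1 j)//= big1 => [|i /negbTE ij]; first by rewrite addn0 /k eqxx.
  by rewrite /k ij.
rewrite rising_scaled// /rising -prodf_div; apply: eq_bigr => i _.
have q0 : 0 < 1 + b * (d%:R + i.+1%:R) by rewrite ltr_pwDl// mulr_ge0 ?addr_ge0// ltW.
rewrite (_ : _ + 1 + _ = (1 + b * (d%:R + i.+1%:R)) / b).
  by rewrite -natr1 in q0 *; field; rewrite bn0 gt_eqF.
by rewrite -natr1; field.
Qed.

Lemma simplex_mean_coord2 s b (j k : 'I_d) : j != k -> simplex_int s -> 0 < b ->
  simplex_mean s b (fun y => y 0 j * y 0 k) =
  (s 0 j + b) * (s 0 k + b) / ((1 + b * (d%:R + 1)) * (1 + b * (d%:R + 2))).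
Proof.
move=> jk si b0; have bn0 : b != 0 by rewrite gt_eqF.
pose h (i : 'I_d) : nat := (i == j) || (i == k).
rewrite -(@eq_simplex_mean _ _ s b (fun y => \prod_(i < d) y 0 i ^+ h i)); last first.
  move=> y _; rewrite (bigD1 j)//= (bigD1 k) 1?eq_sym//= /h !eqxx orbT big1 ?mulr1//.
  by move=> i /andP[/negbTE-> /negbTE->]; rewrite expr0.
rewrite simplex_mean_monomial//.
have -> : \prod_(i < d) rising (s 0 i / b + 1) (h i) = (s 0 j / b + 1) * (s 0 k / b + 1).
  rewrite (bigD1 j)//= (bigD1 k) 1?eq_sym//= /h !eqxx orbT big1 => [|i].
    by rewrite /rising !big_ord_recl !big_ord0 !mulr1 !addr0.
  by move=> /andP[/negbTE-> /negbTE->]; rewrite /rising big_ord0.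
have -> : (\sum_(i < d) h i = 2)%N.
  rewrite (bigD1 j)//= (bigD1 k) 1?eq_sym//= /h !eqxx orbT big1 => // i.
  by move=> /andP[/negbTE-> /negbTE->].
have q1 : 0 < 1 + b * (d%:R + 1) by rewrite ltr_pwDl// mulr_ge0 ?addr_ge0// ltW.
have q2 : 0 < 1 + b * (d%:R + 2) by rewrite ltr_pwDl// mulr_ge0 ?addr_ge0// ltW.
rewrite /rising !big_ord_recl big_ord0 /= mulr1 addr0.
rewrite (_ : b^-1 + d%:R + 1 = (1 + b * (d%:R + 1)) / b); last by field.
rewrite (_ : (1 + b * (d%:R + 1)) / b + 1%:R = (1 + b * (d%:R + 2)) / b); last by field.
by field; rewrite bn0 !gt_eqF.
Qed.

(** The difference is -w t/(1+t), a product of two quantities of order b. This replaces the exact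
    rational moments by their first-order parts, with explicit constants. *)
Lemma perturbed_ratio (c b w t : R) : 0 < b -> 0 <= t <= c * b -> `|w| <= c * b ->
  `|w / (1 + t) - w| <= c ^+ 2 * b ^+ 2.
Proof.
move=> b0 /andP[t0 tc] wc; have t1 : 0 < 1 + t by rewrite ltr_pwDl.
rewrite (_ : w / (1 + t) - w = - (w * (t / (1 + t)))); last by field; rewrite gt_eqF.
rewrite normrN normrM -exprMn expr2; apply: ler_pM => //.
rewrite ger0_norm ?divr_ge0// ?(ltW t1)// ler_pdivrMr//.
by apply: (le_trans tc); rewrite ler_peMr ?(le_trans t0 tc)// lerDl.
Qed.

(** The n-th raw moment of coordinate j is the product of the n factors s_j + [dev s b j i], i < n.
    Each deviation is O(b), uniformly in s. *)
Let dev s b (j : 'I_d) (i : nat) : R :=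
  b * (i.+1%:R - s 0 j * (d%:R + i.+1%:R)) / (1 + b * (d%:R + i.+1%:R)).

Let coord_ratioE s b (j : 'I_d) i : 0 < b ->
  (s 0 j + b * i.+1%:R) / (1 + b * (d%:R + i.+1%:R)) = s 0 j + dev s b j i.
Proof.
move=> b0; rewrite /dev; field.
by rewrite gt_eqF// ltr_pwDl// mulr_ge0 ?addr_ge0// ltW.
Qed.

Let bm_dev s (j : 'I_d) : bounded_measurable (fun y : 'rV[R]_d => y 0 j - s 0 j).
Proof. by apply: bmB; [exact: bm_coord|exact: bm_cst]. Qed.

Lemma simplex_mean_cst s b r : simplex_int s -> 0 < b -> simplex_mean s b (fun=> r) = r.
Proof.
move=> si b0.
have h1 : simplex_mean s b (fun=> 1) = 1.
  rewrite -[LHS](@eq_simplex_mean _ _ s b (fun y => \prod_(j < d) y 0 j ^+ 0)); last first.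
    by move=> y _; rewrite big1// => j _; rewrite expr0.
  rewrite simplex_mean_monomial// big1_eq /rising big_ord0 invr1 mulr1.
  by rewrite big1// => j _; rewrite big_ord0.
have -> : (fun=> r) = (fun y : 'rV[R]_d => r * 1) by apply/funext => y; rewrite mulr1.
rewrite simplex_meanZ ?h1 ?mulr1//; first exact: simplex_int_simplex.
exact: bm_cst.
Qed.

Lemma simplex_mean_dev s b (j : 'I_d) : simplex_int s -> 0 < b ->
  simplex_mean s b (fun y => y 0 j - s 0 j) = dev s b j 0.
Proof.
move=> si b0; have ss := simplex_int_simplex si.
rewrite simplex_meanD ?simplex_mean_cst//; [|exact: bm_coord|exact: bm_cst].
have := simplex_mean_coordX j 1 si b0.
rewrite (@eq_simplex_mean _ _ _ _ _ (fun y => y 0 j)); last by move=> y _; rewrite expr1.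
by move=> ->; rewrite big_ord_recl big_ord0 mulr1 coord_ratioE// addrAC subrr add0r.
Qed.

Lemma simplex_mean_dev2 s b (j : 'I_d) : simplex_int s -> 0 < b ->
  simplex_mean s b (fun y => (y 0 j - s 0 j) ^+ 2) =
  dev s b j 0 * dev s b j 1 + s 0 j * (dev s b j 1 - dev s b j 0).
Proof.
move=> si b0; have ss := simplex_int_simplex si.
have bmc n : bounded_measurable (fun y : 'rV[R]_d => y 0 j ^+ n) by apply: bmX; exact: bm_coord.
rewrite (@eq_simplex_mean _ _ _ _ _
  (fun y => y 0 j ^+ 2 + ((- (2 * s 0 j)) * y 0 j ^+ 1 + (s 0 j) ^+ 2))); last first.
  by move=> y _; ring.
rewrite simplex_meanD//; last first.
  by apply: bmD; [apply: bmM => //; exact: bm_cst|exact: bm_cst].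
rewrite simplex_meanD//; [|by apply: bmM => //; exact: bm_cst|exact: bm_cst].
rewrite simplex_meanZ// simplex_mean_cst// !simplex_mean_coordX//.
rewrite !big_ord_recl !big_ord0 /= !coord_ratioE//.
by rewrite /bump /=; ring.
Qed.

(** Let M_n(k) be the centred n-th moment formed from the products of s_j + v_i that start at i = k.
    Splitting off the first factor gives M_(n+1)(k) = v_k M_n(k+1) + s_j (M_n(k+1) - M_n(k)). The
    recursion exhibits the cancellations, which the binomial expansion of the fourth power hides. *)
Lemma simplex_mean_dev4 s b (j : 'I_d) (v := dev s b j)
    (M2 := fun k => v k * v k.+1 + s 0 j * (v k.+1 - v k))
    (M3 := fun k => v k * M2 k.+1 + s 0 j * (M2 k.+1 - M2 k)) : simplex_int s -> 0 < b ->
  simplex_mean s b (fun y => (y 0 j - s 0 j) ^+ 4) =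
  v 0 * M3 1%N + s 0 j * (M3 1%N - M3 0%N).
Proof.
move=> si b0; have ss := simplex_int_simplex si.
have bmc n : bounded_measurable (fun y : 'rV[R]_d => y 0 j ^+ n) by apply: bmX; exact: bm_coord.
have bmcZ r n : bounded_measurable (fun y : 'rV[R]_d => r * y 0 j ^+ n).
  by apply: bmM => //; exact: bm_cst.
rewrite (@eq_simplex_mean _ _ _ _ _
  (fun y => y 0 j ^+ 4 + ((- (4 * s 0 j)) * y 0 j ^+ 3 + ((6 * s 0 j ^+ 2) * y 0 j ^+ 2 +
    ((- (4 * s 0 j ^+ 3)) * y 0 j ^+ 1 + (s 0 j) ^+ 4))))); last first.
  by move=> y _; ring.
rewrite !simplex_meanD//; do ?[by repeat (first [exact: bmcZ|exact: bm_cst|apply: bmD])].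
rewrite simplex_mean_cst// !simplex_meanZ// !simplex_mean_coordX//.
rewrite !big_ord_recl !big_ord0 /= !coord_ratioE//.
rewrite /bump !leq0n !add1n /M3 /M2 -/v.
by ring.
Qed.

(** The largest shift d + i + 1 among the four factors, i <= 3, that enter a fourth moment. *)
Let c : R := d%:R + 4.

Let lead s b (j : 'I_d) (i : nat) : R := b * (i.+1%:R - s 0 j * (d%:R + i.+1%:R)).

Let shift_le b i : 0 < b -> (i <= 3)%N -> 0 <= b * (d%:R + i.+1%:R) <= c * b.
Proof.
move=> b0 i3; rewrite mulr_ge0 ?addr_ge0//= ?(ltW b0)// mulrC ler_pM2r// /c lerD2l.
by rewrite ler_nat.
Qed.

Let lead_le s b j i : simplex s -> 0 < b -> (i <= 3)%N -> `|lead s b j i| <= c * b.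
Proof.
move=> ss b0 i3; have s0 := simplex_ge0 j ss; have s1 := simplex_le1 j ss.
rewrite /lead normrM gtr0_norm// mulrC ler_pM2r// /c.
have i4 : (i.+1%:R : R) <= 4 by rewrite ler_nat.
have i0 : 0 <= (i.+1%:R : R) by [].
have d0 : 0 <= (d%:R : R) by [].
have p1 : s 0 j * (d%:R + i.+1%:R) <= d%:R + i.+1%:R by rewrite ler_piMl// addr_ge0.
have p2 : 0 <= s 0 j * (d%:R + i.+1%:R) by rewrite mulr_ge0// addr_ge0.
rewrite ler_norml; apply/andP; split; lra.
Qed.

Let dev_lead s b j i : simplex s -> 0 < b -> (i <= 3)%N ->
  `|dev s b j i - lead s b j i| <= c ^+ 2 * b ^+ 2.
Proof.
move=> ss b0 i3; apply: perturbed_ratio => //; first exact: shift_le.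
exact: lead_le.
Qed.

Let dev_le s b j i : simplex s -> 0 < b -> (i <= 3)%N -> `|dev s b j i| <= c * b.
Proof.
move=> ss b0 i3; apply: le_trans (lead_le j ss b0 i3).
have /andP[t0 _] := shift_le b0 i3.
rewrite /dev normrM ler_piMr// ger0_norm ?invr_ge0 ?addr_ge0//.
by rewrite invf_le1 ?lerDl// ltr_pwDl.
Qed.

Let c_ge1 : 1 <= c.
Proof. by rewrite /c ler_wpDl// ler1n. Qed.

Lemma simplex_mean_dev_bound s b (j : 'I_d) : simplex_int s -> 0 < b ->
  `|simplex_mean s b (fun y => y 0 j - s 0 j) - b * (1 - (d%:R + 1) * s 0 j)|
    <= (d%:R + 4) ^+ 2 * b ^+ 2.
Proof.
move=> si b0; rewrite simplex_mean_dev//.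
have := dev_lead j (simplex_int_simplex si) b0 (leq0n 3).
by rewrite /lead mulrC [s 0 j * _]mulrC mulrC.
Qed.

(** The constant 3 counts one product of two deviations and two replacements of a deviation by its
    first-order part. Off the diagonal the mean of a product comes from [simplex_mean_coord2], since
    the law has dependent coordinates. *)
Lemma simplex_mean_dev2_bound s b (j k : 'I_d) : simplex_int s -> 0 < b ->
  `|simplex_mean s b (fun y => (y 0 j - s 0 j) * (y 0 k - s 0 k)) -
    b * (s 0 j * ((j == k)%:R - s 0 k))| <= 3 * (d%:R + 4) ^+ 2 * b ^+ 2.
Proof.
move=> si b0; have ss := simplex_int_simplex si.
have s0 := simplex_ge0 j ss; have s1 := simplex_le1 j ss.
rewrite -/c.
have tri (x1 x2 x3 : R) : `|x1| <= c ^+ 2 * b ^+ 2 -> `|x2| <= c ^+ 2 * b ^+ 2 ->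
    `|x3| <= c ^+ 2 * b ^+ 2 -> `|x1 + s 0 j * (x2 - x3)| <= 3 * c ^+ 2 * b ^+ 2.
  move=> h1 h2 h3; apply: (le_trans (ler_normD _ _)).
  rewrite normrM ger0_norm//.
  have : `|x2 - x3| <= 2 * c ^+ 2 * b ^+ 2.
    by apply: (le_trans (ler_normB _ _)); lra.
  move=> h4; have : s 0 j * `|x2 - x3| <= `|x2 - x3| by rewrite ler_piMl.
  by lra.
have prod2 (x1 x2 : R) : `|x1| <= c * b -> `|x2| <= c * b -> `|x1 * x2| <= c ^+ 2 * b ^+ 2.
  by move=> h1 h2; rewrite normrM -exprMn expr2 ler_pM.
have [ejk|jk] := eqVneq j k.
  subst k; rewrite (@eq_simplex_mean _ _ _ _ _ (fun y => (y 0 j - s 0 j) ^+ 2)) => [|//].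
  rewrite simplex_mean_dev2//.
  rewrite (_ : _ - _ = dev s b j 0 * dev s b j 1 +
    s 0 j * ((dev s b j 1 - lead s b j 1) - (dev s b j 0 - lead s b j 0))); last first.
    by rewrite /lead -natr1 /=; ring.
  by apply: tri; [apply: prod2; exact: dev_le|exact: dev_lead|exact: dev_lead].
rewrite (@eq_simplex_mean _ _ _ _ _ (fun y => y 0 j * y 0 k + (- s 0 k * (y 0 j - s 0 j) +
   (- s 0 j * (y 0 k - s 0 k) + - (s 0 j * s 0 k))))); last by move=> y _; ring.
have bmZ r i : bounded_measurable (fun y : 'rV[R]_d => r * (y 0 i - s 0 i)).
  by apply: bmM; [exact: bm_cst|exact: bm_dev].
have bm0 := @bm_cst R d (- (s 0 j * s 0 k)).
rewrite simplex_meanD//; last first.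
- by apply: bmD => //; apply: bmD.
- by apply: bmM; exact: bm_coord.
rewrite simplex_meanD//; last by apply: bmD.
rewrite simplex_meanD// simplex_mean_cst// !simplex_meanZ//; try exact: bm_dev.
rewrite simplex_mean_coord2// !simplex_mean_dev//.
(* Once coordinate j has used the factor 1 + b(d+1) of the denominator, coordinate k gets the next
   one: (s_k + b)/(1 + b(d+2)) = s_k + z, and w is the first-order part of z. *)
set w := b * (1 - s 0 k * (d%:R + 2)); set z := w / (1 + b * (d%:R + 2)).
have wc : `|w| <= c * b.
  rewrite /w normrM gtr0_norm// mulrC ler_pM2r// /c.
  have d0 : 0 <= (d%:R : R) by [].
  have sk0 := simplex_ge0 k ss; have sk1 := simplex_le1 k ss.
  have p1 : s 0 k * (d%:R + 2) <= d%:R + 2 by rewrite ler_piMl// addr_ge0.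
  have p2 : 0 <= s 0 k * (d%:R + 2) by rewrite mulr_ge0// addr_ge0.
  by rewrite ler_norml; apply/andP; split; lra.
have t2 : 0 <= b * (d%:R + 2) <= c * b.
  rewrite mulr_ge0 ?addr_ge0 ?(ltW b0)//= mulrC ler_pM2r// /c; lra.
have zw : `|z - w| <= c ^+ 2 * b ^+ 2 by exact: perturbed_ratio.
have zc : `|z| <= c * b.
  apply: le_trans wc; case/andP: t2 => t20 _.
  rewrite /z normrM ler_piMr// ger0_norm ?invr_ge0 ?addr_ge0//.
  by rewrite invf_le1 ?lerDl// ltr_pwDl.
have q1 : 0 < 1 + b * (d%:R + 1) by rewrite ltr_pwDl// mulr_ge0 ?addr_ge0// ltW.
have q2 : 0 < 1 + b * (d%:R + 2) by case/andP: t2 => t20 _; rewrite ltr_pwDl.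
rewrite (_ : _ - _ = dev s b j 0 * z + s 0 j * ((z - w) - (dev s b k 0 - lead s b k 0))).
  by apply: tri => //; [apply: prod2 => //; exact: dev_le|exact: dev_lead].
by rewrite /lead /z /w /dev mulr0n; field; rewrite !gt_eqF.
Qed.

(** In the recursion M2 is only O(b), but its difference in k is O(b^2), so M3 and then the fourth
    moment are O(b^2). The two terms of the last level contribute 9 c^5 and 18 c^4, which is the
    stated constant; b <= 1 absorbs surplus powers of b. *)
Lemma simplex_mean_dev4_bound s b (j : 'I_d) : simplex_int s -> 0 < b <= 1 ->
  simplex_mean s b (fun y => (y 0 j - s 0 j) ^+ 4) <=
  9 * (d%:R + 4) ^+ 4 * (d%:R + 6) * b ^+ 2.
Proof.
move=> si /andP[b0 b1]; have ss := simplex_int_simplex si.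
have s0 := simplex_ge0 j ss; have s1 := simplex_le1 j ss.
rewrite simplex_mean_dev4// -/c.
set v := dev s b j.
set M2 := fun k => v k * v k.+1 + s 0 j * (v k.+1 - v k).
set M3 := fun k => v k * M2 k.+1 + s 0 j * (M2 k.+1 - M2 k).
have v_le i : (i <= 3)%N -> `|v i| <= c * b by move=> i3; exact: dev_le.
have sM (x K : R) : `|x| <= K -> `|s 0 j * x| <= K.
  by move=> xK; rewrite normrM ger0_norm// (le_trans _ xK)// ler_piMl.
have c0 : 0 <= c by rewrite (le_trans _ c_ge1).
have M2_le k : (k <= 2)%N -> `|M2 k| <= 3 * c ^+ 2 * b.
  move=> k2; rewrite /M2; apply: (le_trans (ler_normD _ _)).
  have h1 : `|v k * v k.+1| <= c ^+ 2 * b.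
    rewrite normrM; apply: (@le_trans _ _ (c * b * (c * b))).
      by apply: ler_pM => //; apply: v_le => //; exact: leqW.
    rewrite (_ : c * b * (c * b) = c ^+ 2 * b * b); last by ring.
    by rewrite ler_piMr// mulr_ge0 ?exprn_ge0// ltW.
  have h2 : `|s 0 j * (v k.+1 - v k)| <= 2 * c ^+ 2 * b.
    apply: sM; apply: (le_trans (ler_normB _ _)).
    have h3 : `|v k| <= c * b by apply: v_le; exact: leqW.
    have h4 : `|v k.+1| <= c * b by exact: v_le.
    have h5 : c * b <= c ^+ 2 * b by rewrite ler_pM2r// expr2 ler_peMr.
    lra.
  lra.
have dM2_le k : (k <= 1)%N -> `|M2 k.+1 - M2 k| <= 6 * c ^+ 2 * b ^+ 2.
  move=> k1.
  have k3 : (k <= 3)%N by apply: leq_trans k1 _.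
  have k3' : (k.+1 <= 3)%N by apply: leq_trans (_ : 2 <= 3)%N.
  have k3'' : (k.+2 <= 3)%N by [].
  (* [lead] is affine in its index, so its second difference is zero and may be subtracted for free;
     only the errors [dev] - [lead], of order b^2, remain. *)
  rewrite (_ : M2 k.+1 - M2 k = (v k.+1 * v k.+2 - v k * v k.+1) +
     s 0 j * ((v k.+2 - lead s b j k.+2) - 2 * (v k.+1 - lead s b j k.+1)
       + (v k - lead s b j k))); last first.
    by rewrite /M2 /lead -!natr1; ring.
  have pv i : (i < 3)%N -> `|v i * v i.+1| <= c ^+ 2 * b ^+ 2.
    move=> i3; rewrite normrM -exprMn expr2.
    by apply: ler_pM => //; apply: v_le => //; exact: ltnW.
  have h1 := pv k.+1 k3''; have h2 := pv k k3'.
  have h3 := dev_lead j ss b0 k3; have h4 := dev_lead j ss b0 k3'.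
  have h5 := dev_lead j ss b0 k3''.
  apply: (le_trans (ler_normD _ _)).
  have h6 : `|v k.+1 * v k.+2 - v k * v k.+1| <= 2 * c ^+ 2 * b ^+ 2.
    by apply: (le_trans (ler_normB _ _)); lra.
  set x := (X in s 0 j * X).
  have h7 : `|s 0 j * x| <= 4 * c ^+ 2 * b ^+ 2.
    apply: sM; rewrite /x; apply: (le_trans (ler_normD _ _)).
    have h8 : `|v k.+2 - lead s b j k.+2 - 2 * (v k.+1 - lead s b j k.+1)| <= 3 * c ^+ 2 * b ^+ 2.
      by apply: (le_trans (ler_normB _ _)); rewrite normrM gtr0_norm//; lra.
    by rewrite -/v in h3; lra.
  lra.
have M3_le k : (k <= 1)%N -> `|M3 k| <= 9 * c ^+ 3 * b ^+ 2.
  move=> k1; apply: (le_trans (ler_normD _ _)).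
  have h1 : `|v k * M2 k.+1| <= 3 * c ^+ 3 * b ^+ 2.
    rewrite normrM (_ : 3 * c ^+ 3 * b ^+ 2 = c * b * (3 * c ^+ 2 * b)); last by ring.
    apply: ler_pM => //; last exact: M2_le.
    by apply: v_le; apply: leq_trans k1 _.
  have h2 : `|s 0 j * (M2 k.+1 - M2 k)| <= 6 * c ^+ 3 * b ^+ 2.
    apply: sM; apply: (le_trans (dM2_le _ k1)).
    rewrite ler_wpM2r ?exprn_ge0// ?(ltW b0)// ler_wpM2l//.
    by rewrite [leRHS]exprS ler_peMl// exprn_ge0.
  lra.
apply: (le_trans (ler_norm _)); apply: (le_trans (ler_normD _ _)).
have h1 : `|v 0%N * M3 1%N| <= 9 * c ^+ 4 * b ^+ 2 * (c * b).
  rewrite normrM mulrC; apply: ler_pM => //; last exact: v_le.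
  apply: (le_trans (M3_le _ (leqnn 1))).
  rewrite ler_wpM2r ?exprn_ge0// ?(ltW b0)// ler_wpM2l//.
  by rewrite [leRHS]exprS ler_peMl// exprn_ge0.
have h2 : 9 * c ^+ 4 * b ^+ 2 * (c * b) <= 9 * c ^+ 4 * b ^+ 2 * c.
  rewrite ler_wpM2l ?mulr_ge0 ?exprn_ge0 ?(ltW b0)//.
  by rewrite ler_piMr.
have h3 : `|s 0 j * (M3 1%N - M3 0%N)| <= 18 * c ^+ 4 * b ^+ 2.
  apply: sM; apply: (le_trans (ler_normB _ _)).
  have k1 := M3_le _ (leqnn 1); have k0 := M3_le _ (leq0n 1).
  have : 9 * c ^+ 3 * b ^+ 2 <= 9 * c ^+ 4 * b ^+ 2.
    rewrite ler_wpM2r ?exprn_ge0// ?(ltW b0)// ler_wpM2l//.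
    by rewrite [leRHS]exprS ler_peMl// exprn_ge0.
  lra.
have -> : d%:R + 6 = c + 2 :> R by rewrite /c; ring.
by rewrite -/v -/M2 -/M3; lra.
Qed.

End moments.

(** * The square of the kernel *)

Section central_gamma_ratio.
Context {R : realType}.
Local Notation mu := (@lebesgue_measure R).
Implicit Types (c u z : R).

(** The central binomial coefficient C(2z, z) for real z. It appears because squaring the kernel
    sets Gamma at doubled arguments against squares of Gamma. *)
Definition central_gamma_ratio z : R := Gamma (2 * z + 1) / Gamma (z + 1) ^+ 2.

(* The beta integrand after the substitution t = 1/2 + u / (2 sqrt z). *)
Let bump_int z : \bar R := (\int[mu]_u (pospow z (1 - u ^+ 2 / z))%:E)%E.

Let mbump z : measurable_fun setT (fun u => (pospow z (1 - u ^+ 2 / z))%:E).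
Proof.
apply/measurable_EFinP; apply: measurableT_comp; first exact: measurable_pospow.
by apply: measurable_funB => //; apply: measurable_funM => //; exact: measurable_funX.
Qed.

Let beta_int_bump z : 0 < z ->
  beta_int z z = (((4 `^ z)^-1 / (2 * Num.sqrt z))%:E * bump_int z)%E.
Proof.
move=> z0; have sz0 : 0 < Num.sqrt z by rewrite sqrtr_gt0.
have c0 : 0 < (2 * Num.sqrt z)^-1 by rewrite invr_gt0 mulr_gt0.
rewrite /beta_int (@ge0_integral_affine _ (2 * Num.sqrt z)^-1 2^-1)//; last 2 first.
- apply/measurable_EFinP; apply: measurable_funM; first exact: measurable_pospow.
  by apply: measurableT_comp; [exact: measurable_pospow|exact: measurable_funB].
- by move=> t; rewrite lee_fin mulr_ge0 ?pospow_ge0.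
rewrite (mulrC (4 `^ z)^-1) EFinM -muleA; congr (_ * _)%E.
rewrite /bump_int -[RHS]ge0_integralZl_EFin; last 4 first.
- exact: measurableT.
- by move=> u _; rewrite lee_fin pospow_ge0.
- exact: mbump.
- by rewrite invr_ge0 powR_ge0.
apply: eq_integral => u _; rewrite -EFinM; congr EFin.
set v := (2 * Num.sqrt z)^-1 * u.
have e : 1 - u ^+ 2 / z = 4 * ((v + 2^-1) * (1 - (v + 2^-1))).
  by rewrite /v -[in LHS](sqr_sqrtr (ltW z0)); field; rewrite gt_eqF.
rewrite e pospowZ// mulKf; last by rewrite gt_eqF// powR_gt0.
rewrite /pospow; case: (lerP 0 (v + 2^-1)) => v1; case: (lerP 0 (1 - (v + 2^-1))) => v2.
- by rewrite mulr_ge0// powRM.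
- by rewrite mulr0 ifF//; apply/negbTE; rewrite -ltNge pmulr_rlt0//; lra.
- by rewrite mul0r ifF//; apply/negbTE; rewrite -ltNge nmulr_rlt0//; lra.
- lra.
Qed.

Let gauss_powR (z x : R) : 0 < z -> expR (- (x / z)) `^ z = expR (- x).
Proof.
by move=> z0; rewrite /powR gt_eqF ?expR_gt0// expRK mulrN mulrCA divff ?mulr1// gt_eqF.
Qed.

(** The inequality 1 + x <= exp x provides both the dominating function and the upper half of the
    squeeze for the Gaussian limit. *)
Let bump_le_gauss z u : 0 < z -> pospow z (1 - u ^+ 2 / z) <= gauss_fun u.
Proof.
move=> z0; rewrite /gauss_fun /pospow; case: ifPn => [h|_]; last exact: expR_ge0.
rewrite -(gauss_powR _ z0) ge0_ler_powR ?nnegrE ?expR_ge0 ?(ltW z0)//.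
exact: expR_ge1Dx.
Qed.

(** The same inequality applied to the reciprocal: with x = u^2, 1/(1 - x/z) = 1 + x/(z-x) <=
    exp(x/(z-x)). No expansion of the logarithm is needed. *)
Let bump_ge z u : u ^+ 2 < z ->
  expR (- (u ^+ 2 + (u ^+ 2) ^+ 2 / (z - u ^+ 2))) <= pospow z (1 - u ^+ 2 / z).
Proof.
set x := u ^+ 2 => xz; have x0 : 0 <= x by exact: sqr_ge0.
have z0 : 0 < z by exact: le_lt_trans xz.
have zx0 : 0 < z - x by rewrite subr_gt0.
have h : 0 < 1 - x / z by rewrite subr_gt0 ltr_pdivrMr// mul1r.
rewrite /pospow (ltW h) (_ : x + _ = z * (x / (z - x))); last by field; rewrite gt_eqF.
have -> : expR (- (z * (x / (z - x)))) = expR (- (x / (z - x))) `^ z.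
  by rewrite /powR gt_eqF ?expR_gt0// expRK mulrN.
rewrite ge0_ler_powR ?nnegrE ?expR_ge0 ?(ltW z0) ?(ltW h)//.
rewrite expRN invf_ple ?posrE ?expR_gt0// ?invr_gt0//.
apply: le_trans (expR_ge1Dx _).
by rewrite le_eqVlt; apply/orP; left; apply/eqP; field; rewrite !gt_eqF.
Qed.

Let bump_cvg (c : R^nat) u : (forall n, 0 < c n) -> c @ \oo --> (0 : R) ->
  pospow (c n)^-1 (1 - u ^+ 2 / (c n)^-1) @[n --> \oo] --> gauss_fun u.
Proof.
move=> c0 cc; set x := u ^+ 2; have x0 : 0 <= x by exact: sqr_ge0.
have h n : c n * x < 1 -> x < (c n)^-1.
  by move=> h; rewrite -[ltRHS]mul1r ltr_pdivlMr// mulrC.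
have near1 : \forall n \near \oo, c n * x < 1.
  have : c n * x @[n --> \oo] --> (0 * x : R) by apply: cvgM => //; exact: cvg_cst.
  by rewrite mul0r => /cvgr_lt; apply.
apply: (@squeeze_cvgr _ _ _ _ (fun n => expR (- (x + c n * (x ^+ 2 / (1 - c n * x))))) (cst (gauss_fun u))).
- near=> n; have hn : c n * x < 1 by near: n.
  rewrite bump_le_gauss ?invr_gt0// andbT.
  apply: le_trans (bump_ge (h _ hn)); rewrite -/x le_eqVlt; apply/orP; left; apply/eqP.
  congr (expR (- (_ + _))).
  have -> : (c n)^-1 - x = (1 - c n * x) / c n by field; rewrite gt_eqF.
  by rewrite invf_div; ring.
- apply: (cvg_comp _ expR); last exact: continuous_expR.
  rewrite -[X in - X](addr0 x) -[X in _ + X](mul0r (x ^+ 2 / (1 - 0 * x))).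
  apply: cvgN; apply: cvgD; first exact: cvg_cst.
  apply: cvgM => //; apply: cvgM; first exact: cvg_cst.
  apply: cvgV; first by rewrite mul0r subr0.
  by apply: cvgB; [exact: cvg_cst|apply: cvgM => //; exact: cvg_cst].
- exact: cvg_cst.
Unshelve. all: by end_near. Qed.

Let bump_int_cvg (c : R^nat) : (forall n, 0 < c n) -> c @ \oo --> (0 : R) ->
  bump_int (c n)^-1 @[n --> \oo] --> (Num.sqrt pi)%:E.
Proof.
move=> c0 cc; rewrite -(@integralT_gauss R).
have [] := @dominated_convergence _ _ _ mu setT measurableT
  (fun n u => (pospow (c n)^-1 (1 - u ^+ 2 / (c n)^-1))%:E) (EFin \o gauss_fun) (EFin \o gauss_fun).
- by move=> n; exact: mbump.
- by apply/measurable_EFinP; exact: measurable_gauss_fun.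
- apply: aeW => u _; apply: (cvg_comp _ EFin); first exact: bump_cvg.
  exact: cvg_id.
- exact: integrableT_gauss.
- apply: aeW => u n _; rewrite /= lee_fin ger0_norm ?pospow_ge0//.
  by rewrite bump_le_gauss// invr_gt0.
by [].
Qed.

(** This is C(2z, z) ~ 4^z / sqrt(pi z) with z = 1/c. The expression equals 2/(2+c) divided by the
    bump integral, where 2/(2+c) = 2z/(2z+1) comes from one use of the recurrence. Passing to
    sequences makes dominated convergence available. *)
Lemma central_gamma_ratio_cvg :
  ((4 `^ c^-1)^-1 * (Num.sqrt c)^-1 * central_gamma_ratio c^-1 : R) @[c --> (0 : R)^'+]
    --> ((Num.sqrt pi)^-1 : R).
Proof.
apply/cvg_at_rightP => c [c0 cc].
have I_fin n : bump_int (c n)^-1 \is a fin_num.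
  rewrite ge0_fin_numE; last by apply: integral_ge0 => u _; rewrite lee_fin pospow_ge0.
  apply: (@le_lt_trans _ _ (\int[mu]_u (gauss_fun u)%:E)%E); last first.
    by rewrite integralT_gauss ltry.
  apply: ge0_le_integral => //.
  - by move=> u _; rewrite lee_fin pospow_ge0.
  - exact: mbump.
  - by apply/measurable_EFinP; exact: measurable_gauss_fun.
  - by move=> u _; rewrite lee_fin bump_le_gauss// invr_gt0.
have e n : (4 `^ (c n)^-1)^-1 * (Num.sqrt (c n))^-1 * central_gamma_ratio (c n)^-1 =
    2 / (2 + c n) / fine (bump_int (c n)^-1).
  have cn0 : 0 < c n by [].
  set z := (c n)^-1; have z0 : 0 < z by rewrite invr_gt0.
  have sz0 : 0 < Num.sqrt z by rewrite sqrtr_gt0.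
  have G1 : 0 < Gamma (z + 1) by rewrite Gamma_gt0// lerDr ltW.
  have G2 : 0 < Gamma (2 * z + 1) by rewrite Gamma_gt0// lerDr mulr_ge0// ltW.
  have p4 : 0 < 4 `^ z :> R by rewrite powR_gt0.
  have := beta_int_bump z0; rewrite beta_intE ?(ltW z0)//.
  have -> : z + z + 1 + 1 = 2 * z + 1 + 1 by ring.
  rewrite (@GammaS _ (2 * z + 1)); last by rewrite lerDr mulr_ge0// ltW.
  rewrite -(fineK (I_fin n)) -/z -EFinM => -[].
  set I := fine _ => eI.
  have I0 : I != 0.
    apply/eqP => I0; move: eI; rewrite I0 mulr0; apply/eqP.
    apply: lt0r_neq0; apply: divr_gt0; first exact: (mulr_gt0 G1 G1).
    by apply: mulr_gt0 => //; rewrite addr_gt0// mulr_gt0.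
  have -> : Num.sqrt (c n) = (Num.sqrt z)^-1 by rewrite /z sqrtrV ?invrK// ltW.
  have zz : c n = z^-1 by rewrite invrK.
  rewrite zz /central_gamma_ratio.
  have -> : Gamma (z + 1) ^+ 2 = (4 `^ z)^-1 / (2 * Num.sqrt z) * I * ((2 * z + 1) * Gamma (2 * z + 1)).
    by rewrite -eI expr2 divfK// gt_eqF// mulr_gt0// addr_gt0// mulr_gt0.
  move: p4 G2; move: (4 `^ z) (Gamma (2 * z + 1)) => p G p0 G0.
  move: (esym (sqr_sqrtr (ltW z0))) sz0; move: (Num.sqrt z) => q -> q0.
  rewrite [fine _]/=; field; rewrite I0 !gt_eqF//= ?addr_gt0// ?mulr_gt0// ?exprn_gt0.
rewrite (_ : (fun _ => _) = fun n => 2 / (2 + c n) / fine (bump_int (c n)^-1)); last exact/funext.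
rewrite -[X in _ --> X]mul1r.
apply: cvgM; last first.
  apply: cvgV; first by rewrite gt_eqF// sqrtr_gt0 pi_gt0.
  by apply: fine_cvg; exact: bump_int_cvg.
have : 2 / (2 + c n) @[n --> \oo] --> (2 / (2 + 0) : R).
  apply: cvgM; first exact: cvg_cst.
  by apply: cvgV; [rewrite addr0|apply: cvgD => //; exact: cvg_cst].
by rewrite addr0 divff.
Qed.

End central_gamma_ratio.

Section kernel_square.
Context {R : realType} {d : nat}.
Implicit Types (s y : 'rV[R]_d) (b : R).

(** Squaring doubles the exponents s_j/b of the shape, which amounts to halving b; this quotient is
    what the normalising constants leave over. *)
Definition square_cst s b : R := kernel_cst s b ^+ 2 / kernel_cst s (b / 2).

Lemma kappa_sqr s b y : simplex s -> 0 < b -> simplex y ->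
  kappa s b y ^+ 2 = square_cst s b * kappa s (b / 2) y.
Proof.
move=> ss b0 sy; have b20 : 0 < b / 2 by rewrite divr_gt0.
have K0 := kernel_cst_gt0 ss b20.
rewrite !kappaE// exprMn /square_cst mulrA divfK ?gt_eqF//; congr (_ * _).
have e (p x : R) : (x `^ (p / b)) ^+ 2 = x `^ (p / (b / 2)).
  rewrite -powR_mulrn ?powR_ge0// -powRrM; congr (_ `^ _).
  by field; rewrite gt_eqF.
by rewrite /kernel_shape exprMn e -prodrXl; congr (_ * _); apply: eq_bigr => j _; rewrite e.
Qed.

Let rho (c : R) : R := (4 `^ c^-1)^-1 * (Num.sqrt c)^-1 * central_gamma_ratio c^-1.

Let rho_gt0 (c : R) : 0 < c -> 0 < rho c.
Proof.
move=> c0; have ci0 : 0 < c^-1 by rewrite invr_gt0.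
rewrite /rho /central_gamma_ratio !mulr_gt0 ?invr_gt0 ?powR_gt0 ?sqrtr_gt0 ?exprn_gt0//.
  by rewrite Gamma_gt0// lerDr mulr_ge0// ltW.
by rewrite Gamma_gt0// lerDr ltW.
Qed.

Let ratio_rho (t b : R) : 0 < t -> 0 < b ->
  central_gamma_ratio (t / b) = rho (b / t) * 4 `^ (t / b) * Num.sqrt b / Num.sqrt t.
Proof.
move=> t0 b0; have q0 : 0 < b / t by rewrite divr_gt0.
rewrite /rho invf_div sqrtrM ?(ltW b0)// sqrtrV ?(ltW t0)//.
have st : 0 < Num.sqrt t by rewrite sqrtr_gt0.
have sb : 0 < Num.sqrt b by rewrite sqrtr_gt0.
have p4 : 0 < 4 `^ (t / b) :> R by rewrite powR_gt0.
by field; rewrite !gt_eqF.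
Qed.

Let powR4_sum (a : 'I_d -> R) (c : R) :
  \prod_(j < d) 4 `^ a j * 4 `^ c = 4 `^ (\sum_(j < d) a j + c) :> R.
Proof.
rewrite powRD ?pnatr_eq0 ?implybT//; congr (_ * _).
elim/big_rec2 : _ => [|j y1 y2 _ ->]; first by rewrite powRr0.
by rewrite powRD// pnatr_eq0 implybT.
Qed.

(** Each Gamma ratio at t/b is [rho (b / t)] times 4^(t/b) sqrt(b/t). The d + 1 barycentric
    coordinates of s sum to one, so the powers of 4 cancel against the ratio at 1/b. One factor sqrt
    b cancels as well, and the Pochhammer quotient contributes b^-d; after multiplication by
    sqrt(b)^d every remaining factor has a limit. *)
Let square_cstE s b : simplex_int s -> 0 < b ->
  square_cst s b * Num.sqrt b ^+ d =
  \prod_(i < d) ((1 + b * i.+1%:R) ^+ 2 / (2 + b * i.+1%:R)) *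
  ((\prod_(j < d) (rho (b / s 0 j) / Num.sqrt (s 0 j))) *
    (rho (b / (1 - norm1 s)) / Num.sqrt (1 - norm1 s)) / rho b).
Proof.
move=> si b0; have ss := simplex_int_simplex si.
have s0 := simplex_int_slack_gt0 si.
have sj j := simplex_int_gt0 j si.
have sb : 0 < Num.sqrt b by rewrite sqrtr_gt0.
have bi0 : 0 < b^-1 by rewrite invr_gt0.
have a1 (t : R) : 0 < t -> 1 <= t / b + 1 by move=> t0; rewrite lerDr divr_ge0// ltW.
have a2 (t : R) : 0 < t -> 1 <= 2 * (t / b) + 1.
  by move=> t0; rewrite lerDr mulr_ge0// divr_ge0// ltW.
have tb (t : R) : t / (b / 2) = 2 * (t / b) by field; rewrite gt_eqF.
rewrite /square_cst /kernel_cst !tb.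
have -> : \prod_(j < d) Gamma (s 0 j / (b / 2) + 1) =
    \prod_(j < d) (central_gamma_ratio (s 0 j / b)) * (\prod_(j < d) Gamma (s 0 j / b + 1)) ^+ 2.
  rewrite -prodrXl -big_split/=; apply: eq_bigr => j _.
  by rewrite /central_gamma_ratio tb divfK// gt_eqF// exprn_gt0// Gamma_gt0// a1.
have -> : Gamma (2 * ((1 - norm1 s) / b) + 1) =
    central_gamma_ratio ((1 - norm1 s) / b) * Gamma ((1 - norm1 s) / b + 1) ^+ 2.
  by rewrite /central_gamma_ratio divfK// gt_eqF// exprn_gt0// Gamma_gt0// a1.
have -> : (b / 2)^-1 + d%:R + 1 = 2 * b^-1 + 1 + d%:R by field; rewrite gt_eqF.
rewrite (addrAC b^-1) !Gamma_rising; last 2 first.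
- by rewrite lerDr mulr_ge0// ltW.
- by rewrite lerDr ltW.
have -> : Gamma (2 * b^-1 + 1) = central_gamma_ratio b^-1 * Gamma (b^-1 + 1) ^+ 2.
  by rewrite /central_gamma_ratio divfK// gt_eqF// exprn_gt0// Gamma_gt0// lerDr ltW.
have -> : \prod_(i < d) ((1 + b * i.+1%:R) ^+ 2 / (2 + b * i.+1%:R)) =
    b ^+ d * rising (b^-1 + 1) d ^+ 2 / rising (2 * b^-1 + 1) d.
  have -> : b ^+ d = \prod_(i < d) b by rewrite prodr_const card_ord.
  rewrite /rising -prodrXl -big_split/= -prodf_div; apply: eq_bigr => i _.
  have bi : 0 <= b * i%:R by rewrite mulr_ge0// ltW.
  by rewrite -natr1; field; rewrite !gt_eqF//=; lra.
have -> : \prod_(j < d) (central_gamma_ratio (s 0 j / b)) =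
    \prod_(j < d) (rho (b / s 0 j) / Num.sqrt (s 0 j)) * Num.sqrt b ^+ d *
    \prod_(j < d) 4 `^ (s 0 j / b).
  have -> : Num.sqrt b ^+ d = \prod_(i < d) Num.sqrt b by rewrite prodr_const card_ord.
  rewrite -!big_split/=; apply: eq_bigr => j _.
  by rewrite ratio_rho//; ring.
rewrite ratio_rho//.
have -> : central_gamma_ratio b^-1 = rho b * 4 `^ b^-1 * Num.sqrt b.
  rewrite -[b^-1]div1r ratio_rho// sqrtr1 !divr1//.
have -> : 4 `^ b^-1 = \prod_(j < d) 4 `^ (s 0 j / b) * 4 `^ ((1 - norm1 s) / b) :> R.
  by rewrite powR4_sum -mulr_suml -norm1_simplex// -mulrDl subrKC div1r.
have g1 : 0 < Gamma (b^-1 + 1) by rewrite Gamma_gt0// lerDr ltW.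
have g2 : 0 < \prod_(j < d) Gamma (s 0 j / b + 1).
  by apply: prodr_gt0 => j _; exact/Gamma_gt0/a1.
have g3 : 0 < Gamma ((1 - norm1 s) / b + 1) by rewrite Gamma_gt0// a1.
have g4 : 0 < rising (b^-1 + 1) d by rewrite prodr_gt0// => j _; rewrite ltr_wpDr// addr_gt0.
have g5 : 0 < rising (2 * b^-1 + 1) d.
  by rewrite prodr_gt0// => j _; rewrite ltr_wpDr// addr_gt0// mulr_gt0.
have g6 : 0 < \prod_(j < d) (4 `^ (s 0 j / b) : R) by rewrite prodr_gt0// => j _; rewrite powR_gt0.
have g7 : 0 < (4 `^ ((1 - norm1 s) / b) : R) by rewrite powR_gt0.
have g8 := rho_gt0 b0.
have g9 : 0 < Num.sqrt (1 - norm1 s) by rewrite sqrtr_gt0.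
have -> : b ^+ d = (Num.sqrt b ^+ d) ^+ 2 by rewrite -exprM mulnC exprM sqr_sqrtr// ltW.
have g10 : 0 < Num.sqrt b ^+ d by rewrite exprn_gt0.
have g11 : 0 < rho (b / (1 - norm1 s)) by rewrite rho_gt0// divr_gt0.
have g12 : 0 < \prod_(j < d) (rho (b / s 0 j) / Num.sqrt (s 0 j)).
  apply: prodr_gt0 => j _; apply: divr_gt0; last by rewrite sqrtr_gt0.
  by apply: rho_gt0; exact: divr_gt0.
move: g1 g2 g3 g4 g5 g6 g7 g8 g9 g10 g11 g12 sb.
move: (Gamma (b^-1 + 1)) (\prod_(j < d) Gamma (s 0 j / b + 1)) (Gamma ((1 - norm1 s) / b + 1))
  (rising (b^-1 + 1) d) (rising (2 * b^-1 + 1) d) (\prod_(j < d) (4 `^ (s 0 j / b) : R))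
  (4 `^ ((1 - norm1 s) / b) : R) (rho b) (Num.sqrt (1 - norm1 s)) (Num.sqrt b ^+ d)
  (rho (b / (1 - norm1 s))) (\prod_(j < d) (rho (b / s 0 j) / Num.sqrt (s 0 j))) (Num.sqrt b)
  => x1 x2 x3 x4 x5 x6 x7 x8 x9 x10 x11 x12 x13 h1 h2 h3 h4 h5 h6 h7 h8 h9 h10 h11 h12 h13.
by field; rewrite !gt_eqF.
Qed.

Lemma psi0E s : simplex_int s ->
  psi0 s = (2 ^+ d * Num.sqrt pi ^+ d * Num.sqrt (1 - norm1 s) * \prod_(j < d) Num.sqrt (s 0 j))^-1.
Proof.
move=> si; have s0 := simplex_int_slack_gt0 si.
have sj j := simplex_int_gt0 j si.
have p0 := @pi_gt0 R.
rewrite /psi0 powRN powR12_sqrt; last first.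
  by rewrite !mulr_ge0 ?exprn_ge0 ?mulr_ge0 ?prodr_ge0 ?(ltW p0) ?(ltW s0)// => j _; exact: ltW.
congr (_^-1).
set X := RHS.
have X0 : 0 <= X by rewrite !mulr_ge0 ?exprn_ge0 ?sqrtr_ge0 ?prodr_ge0// => j _; exact: sqrtr_ge0.
rewrite -[RHS](ger0_norm X0) -sqrtr_sqr; congr Num.sqrt.
rewrite /X !exprMn -prodrXl sqr_sqrtr ?(ltW s0)//; congr (_ * _ * _); last first.
  by apply: eq_bigr => j _; rewrite sqr_sqrtr// ltW.
rewrite -{1}(sqr_sqrtr (ltW p0)) (_ : 4 = 2 ^+ 2); last by ring.
by rewrite -!exprM mulnC.
Qed.

(** Each of the d Pochhammer factors tends to 1/2, and [rho] tends to pi^(-1/2) at d + 1 places in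
    the numerator and one in the denominator. This leaves (4 pi)^(-d/2) and the square roots of the
    barycentric coordinates. *)
Lemma square_cst_cvg s : simplex_int s ->
  (square_cst s b * Num.sqrt b ^+ d : R) @[b --> (0 : R)^'+] --> psi0 s.
Proof.
move=> si; have s0 := simplex_int_slack_gt0 si.
have sj j := simplex_int_gt0 j si.
have rho_cvg (t : R) : 0 < t -> rho (b / t) @[b --> (0 : R)^'+] --> (Num.sqrt pi)^-1.
  move=> t0; apply: (@cvg_comp _ _ _ (fun b => b / t) rho _ ((0 : R)^'+)).
    move=> A [e /= e0 eA]; exists (e * t); first by rewrite /= mulr_gt0.
    move=> b /=; rewrite sub0r normrN => bet b0; apply: eA; last by rewrite divr_gt0.
    by rewrite /= sub0r normrN normrM [`|t^-1|]gtr0_norm ?invr_gt0// ltr_pdivrMr.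
  exact: central_gamma_ratio_cvg.
have id0 : (b : R) @[b --> (0 : R)^'+] --> (0 : R) by apply: cvg_at_right_filter; exact: cvg_id.
rewrite psi0E//.
pose L : R := \prod_(i < d) ((1 + 0 * i.+1%:R) ^+ 2 / (2 + 0 * i.+1%:R)) *
  ((\prod_(j < d) ((Num.sqrt pi)^-1 / Num.sqrt (s 0 j))) *
    ((Num.sqrt pi)^-1 / Num.sqrt (1 - norm1 s)) / (Num.sqrt pi)^-1).
have LE : L = (2 ^+ d * Num.sqrt pi ^+ d * Num.sqrt (1 - norm1 s) * \prod_(j < d) Num.sqrt (s 0 j))^-1.
  rewrite /L (eq_bigr (fun=> 2^-1)) => [|i _]; last by rewrite !mul0r !addr0 expr1n div1r.
  rewrite prodr_const card_ord big_split/= prodr_const card_ord prodfV.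
  have g1 : 0 < Num.sqrt (pi : R) by rewrite sqrtr_gt0 pi_gt0.
  have g2 : 0 < Num.sqrt (1 - norm1 s) by rewrite sqrtr_gt0.
  have g3 : 0 < \prod_(j < d) Num.sqrt (s 0 j) by rewrite prodr_gt0// => j _; rewrite sqrtr_gt0.
  have g4 : 0 < Num.sqrt (pi : R) ^+ d by rewrite exprn_gt0.
  have g5 : 0 < (2 : R) ^+ d by rewrite exprn_gt0.
  rewrite !exprVn; move: g1 g2 g3 g4 g5.
  move: (Num.sqrt (pi : R) ^+ d) (Num.sqrt (pi : R)) (Num.sqrt (1 - norm1 s))
    (\prod_(j < d) Num.sqrt (s 0 j)) ((2 : R) ^+ d) => x1 x2 x3 x4 x5 h1 h2 h3 h4 h5.
  by field; rewrite !gt_eqF.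
rewrite -LE.
apply: (@cvg_trans _ ((fun b => \prod_(i < d) ((1 + b * i.+1%:R) ^+ 2 / (2 + b * i.+1%:R)) *
  ((\prod_(j < d) (rho (b / s 0 j) / Num.sqrt (s 0 j))) *
    (rho (b / (1 - norm1 s)) / Num.sqrt (1 - norm1 s)) / rho b)) b @[b --> (0 : R)^'+])).
  apply: near_eq_cvg; near=> b; rewrite square_cstE//.
have mulc := @mul_continuous R.
apply: cvgM.
  apply: (@cvg_big _ _ _ _ _ mulc) => i _.
  have h : b * i.+1%:R @[b --> (0 : R)^'+] --> (0 * i.+1%:R : R) by apply: cvgM => //; exact: cvg_cst.
  apply: cvgM.
    by apply: cvgM; apply: cvgD => //; exact: cvg_cst.
  apply: cvgV; first by rewrite mul0r addr0.
  by apply: cvgD => //; exact: cvg_cst.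
apply: cvgM; last first.
  apply: cvgV; first by rewrite invr_eq0 gt_eqF// sqrtr_gt0 pi_gt0.
  exact: central_gamma_ratio_cvg.
apply: cvgM; last by apply: cvgM; [exact: rho_cvg|exact: cvg_cst].
apply: (@cvg_big _ _ _ _ _ mulc) => j _.
by apply: cvgM; [exact: rho_cvg|exact: cvg_cst].
Unshelve. all: by end_near. Qed.

End kernel_square.

(** * Second-order Taylor expansion on the simplex *)

Section taylor.
Context {R : realType} {d : nat}.
Implicit Types (s y a v w : 'rV[R]_d) (h m : 'rV[R]_d -> R).

(** Heine-Cantor for continuity relative to the simplex, by compactness in its near-covering form:
    half of the radius at x is spent on moving the centre, half on the distance to y. *)
Lemma simplex_uniformly_continuous h : {within @simplex R d, continuous h} ->
  forall e, 0 < e -> exists2 r, 0 < r &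
    forall x y, simplex x -> simplex y -> `|x - y| < r -> `|h x - h y| < e.
Proof.
move=> /subspace_continuousP ch e e0.
pose P (r : R) x := forall y, simplex y -> `|x - y| < r -> `|h x - h y| < e.
have cov := (near_covering_withinP _).2 ((compact_near_coveringP _).1 (@simplex_compact R d)).
have : \forall r \near (0 : R)^'+, @simplex R d `<=` P r.
  apply: cov => x sx; have e20 : 0 < e / 2 by rewrite divr_gt0.
  have /cvgrPdist_lt /(_ _ e20) := ch _ sx.
  rewrite near_withinE => /nbhs_ballP[r /= r0 hr].
  have hr' y : simplex y -> `|x - y| < r -> `|h x - h y| < e / 2.
    by move=> sy xy; apply: hr => //; rewrite mx_norm_ball.
  have r20 : 0 < r / 2 by rewrite divr_gt0.
  exists (ball x (r / 2), [set t : R | 0 < t < r / 2]) => /=.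
    split; first exact: nbhsx_ballx.
    near=> t; apply/andP; split; near: t; first exact: nbhs_right_gt.
    exact: nbhs_right_lt.
  move=> [x' t] [/=]; rewrite mx_norm_ball /= => xx' /andP[t0 tr] sx' y sy x'y.
  rewrite (splitr e); apply: (le_lt_trans (ler_distD (h x) _ _)); apply: ltrD.
    by rewrite distrC; apply: hr' => //; apply: (lt_trans xx'); rewrite ltr_pdivrMr// ltr_pMr// ltr1n.
  apply: hr' => //; apply: (le_lt_trans (ler_distD x' _ _)).
  by rewrite (splitr r); apply: ltrD => //; exact: lt_trans x'y tr.
move=> hn; near ((0 : R)^'+) => r.
have sP : @simplex R d `<=` P r by near: r.
exists r; first by near: r; exact: nbhs_right_gt.
by move=> x y sx sy xy; exact: (sP x sx y sy xy).
Unshelve. all: by end_near. Qed.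

Lemma simplex_int_nbhs a : simplex_int a -> \forall y \near a, simplex_int y.
Proof.
move=> [a0 a1].
have h (j : 'I_d) : \forall y \near a, 0 < (y : 'rV[R]_d) 0 j < 1.
  have cj : ((y : 'rV[R]_d) 0 j : R) @[y --> a] --> (a 0 j : R) by exact: coord_continuous.
  have /andP[aj0 aj1] := a0 j.
  near=> y; apply/andP; split; near: y.
    exact: cvgr_gt cj _ aj0.
  exact: cvgr_lt cj _ aj1.
near=> y; split; first by near: y; exact: filter_forall.
by near: y; apply: (cvgr_lt _ (@norm1_continuous R d a)).
Unshelve. all: by end_near. Qed.

Lemma simplex_int_ball a : simplex_int a ->
  exists2 r, 0 < r & forall w, `|w| < r -> simplex_int (a + w).
Proof.
move=> /simplex_int_nbhs /nbhs_ballP[r /= r0 hr]; exists r => // w wr.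
by apply: hr; rewrite mx_norm_ball /= opprD addrA subrr sub0r normrN.
Qed.

Lemma is_derive_line h a v (t : R) : derivable (h : 'rV[R]_d -> R^o) (a + t *: v) v ->
  is_derive t 1 (fun u : R => h (a + u *: v)) ('D_v (h : 'rV[R]_d -> R^o) (a + t *: v)).
Proof.
move=> dh.
have e : (fun k : R => k^-1 *: (((fun u : R => h (a + u *: v) : R^o) \o shift t) (k *: 1) - h (a + t *: v))) =
    (fun k : R => k^-1 *: (((h : 'rV[R]_d -> R^o) \o shift (a + t *: v)) (k *: v) - h (a + t *: v))).
  apply/funext => k /=; congr (_ *: (h _ - _)).
  by rewrite [k *: 1]mulr1 scalerDl addrCA.
by split; rewrite /derivable /derive e.
Qed.

(* Coordinatewise mean value theorem: only the partial derivatives of [h] are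
   known to exist, so differentiability must be derived before the chain rule. *)
Lemma partial_expansion h a :
  (forall j y, simplex_int y -> derivable (h : 'rV[R]_d -> R^o) y (delta_mx 0 j)) ->
  (forall j, {for a, continuous (partial j h)}) -> simplex_int a ->
  forall e, 0 < e -> exists2 r, 0 < r & forall w, `|w| < r ->
    `|h (a + w) - h a - \sum_(j < d) w 0 j * partial j h a| <= e * `|w|.
Proof.
move=> dh ch sa e e0.
have ed0 : 0 < e / d.+1%:R by rewrite divr_gt0.
have [r1 r10 hr1] := simplex_int_ball sa.
have [r2 r20 hr2] : exists2 r, 0 < r & forall w, `|w| < r -> forall j,
    `|partial j h (a + w) - partial j h a| <= e / d.+1%:R.
  have : \forall y \near a, forall j, `|partial j h a - partial j h y| <= e / d.+1%:R.
    have hj (j : 'I_d) : \forall y \near a, `|partial j h a - partial j h y| <= e / d.+1%:R.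
      by have /cvgrPdist_le := ch j; apply.
    exact: filter_forall hj.
  move=> /nbhs_ballP[r /= r0 hr]; exists r => // w wr j.
  by rewrite distrC; apply: hr; rewrite mx_norm_ball /= opprD addrA subrr sub0r normrN.
exists (Num.min r1 r2); first by rewrite lt_min r10.
move=> w; rewrite lt_min => /andP[wr1 wr2].
(* [q k] keeps the first k coordinates of w. The points a + q k go from a to a + w along the axes,
   and all the connecting segments stay in the ball of radius |w| of the sup norm. *)
pose q (k : nat) : 'rV[R]_d := \row_j (if (j < k)%N then w 0 j else 0).
have q0 : q 0%N = 0 by apply/rowP => j; rewrite !mxE.
have qd : q d = w by apply/rowP => j; rewrite !mxE ltn_ord.
have qS (k : 'I_d) : q k.+1 = q k + w 0 k *: delta_mx 0 k.
  apply/rowP => j; rewrite !mxE eqxx /= ltnS leq_eqVlt.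
  have [->|jk] := eqVneq j k; first by rewrite eqxx ltnn mulr1 add0r.
  by rewrite (negbTE (_ : val j != val k)) ?mulr0 ?addr0//.
have hE : h (a + w) - h a = \sum_(k < d) (h (a + q k.+1) - h (a + q k)).
  by rewrite -(big_mkord xpredT (fun k => h (a + q k.+1) - h (a + q k))) telescope_sumr// qd q0 addr0.
rewrite hE -sumrB; apply: (le_trans (ler_norm_sum _ _ _)).
apply: (@le_trans _ _ (\sum_(k < d) (e / d.+1%:R * `|w|))); last first.
  rewrite sumr_const card_ord -[_ *+ d]mulr_natr mulrAC ler_wpM2r//.
  by rewrite -mulrA ler_piMr ?(ltW e0)// mulrC ler_pdivrMr// mul1r ler_nat.
apply: ler_sum => k _.
have qle (t : R) : 0 <= t <= 1 -> `|q k + (t * w 0 k) *: delta_mx 0 k| <= `|w|.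
  move=> /andP[t0 t1]; apply: norm_rV_le => // j; rewrite !mxE eqxx /=.
  have [->|jk] := eqVneq j k.
    rewrite ltnn add0r mulr1 normrM ger0_norm//; apply: le_trans (norm_coord_le w k).
    by rewrite ler_piMl.
  rewrite mulr0 addr0; case: ifPn => _; first exact: norm_coord_le.
  by rewrite normr0.
have wk : w 0 k = w 0 k * 1 by rewrite mulr1.
pose g (t : R) := h (a + q k + t *: (w 0 k *: delta_mx 0 k)).
have dline (t : R) : 0 <= t <= 1 ->
    is_derive t 1 g (w 0 k * partial k h (a + q k + t *: (w 0 k *: delta_mx 0 k))).
  move=> t01.
  have -> : g = (fun u : R => h (a + q k + u *: delta_mx 0 k)) \o (fun u => w 0 k * u).
    by apply/funext => u; rewrite /g /= scalerA mulrC.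
  have si : simplex_int (a + q k + (w 0 k * t) *: delta_mx 0 k).
    by rewrite -addrA; apply: hr1; apply: le_lt_trans wr1; rewrite mulrC; exact: qle.
  rewrite scalerA [t * _]mulrC [X in is_derive _ _ _ X]mulrC.
  apply: is_derive1_comp; first exact: is_derive_line (dh k _ si).
  by rewrite [X in is_derive _ _ _ X]wk; apply: is_deriveZ.
have [c c01 gE] : exists2 c, c \in `]0, 1[%R & g 1 - g 0 =
    w 0 k * partial k h (a + q k + c *: (w 0 k *: delta_mx 0 k)) * (1 - 0).
  apply: (@MVT _ g (fun t => w 0 k * partial k h (a + q k + t *: (w 0 k *: delta_mx 0 k)))) => //.
    by move=> t; rewrite in_itv/= => /andP[t0 t1]; apply: dline; rewrite !ltW.
  apply: derivable_within_continuous => t; rewrite in_itv/= => t01.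
  by have [] := dline t t01.
have -> : h (a + q k.+1) - h (a + q k) = g 1 - g 0.
  by rewrite /g scale1r scale0r addr0 qS addrA.
rewrite gE subr0 mulr1 -mulrBr normrM mulrC; apply: ler_pM => //; last exact: norm_coord_le.
move: c01; rewrite in_itv/= => /andP[c0 c1].
rewrite -addrA scalerA; apply: hr2; apply: le_lt_trans wr2; apply: qle.
by rewrite !ltW.
Qed.

(** The first-order expansion at increments k v gives the derivative along v; the tolerance is
    divided by |v| + 1 so that v = 0 needs no separate case. *)
Lemma is_derive_interior_line h a v (t : R) :
  (forall j y, simplex_int y -> derivable (h : 'rV[R]_d -> R^o) y (delta_mx 0 j)) ->
  (forall j y, simplex_int y -> {for y, continuous (partial j h)}) ->
  simplex_int (a + t *: v) ->
  is_derive t 1 (fun u : R => h (a + u *: v)) (\sum_(j < d) v 0 j * partial j h (a + t *: v)).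
Proof.
move=> dh ch sa; set L := \sum_(j < d) _.
suff cL : (fun k : R => k^-1 *: (((fun u : R => h (a + u *: v) : R^o) \o shift t) (k *: 1) -
    h (a + t *: v))) @ 0^' --> (L : R^o).
  by split; [apply/cvg_ex; exists L|exact: cvg_lim cL].
apply/cvgrPdist_le => e e0.
have v1 : 0 < `|v| + 1 by rewrite ltr_wpDl.
have e1 : 0 < e / (`|v| + 1) by rewrite divr_gt0.
have [r r0 hr] := partial_expansion dh (fun j => ch j _ sa) sa e1.
exists (r / (`|v| + 1)); first by rewrite /= divr_gt0.
move=> k /=; rewrite sub0r normrN => kr k0.
have kn0 : 0 < `|k| by rewrite normr_gt0.
have kv : `|k *: v| < r.
  rewrite normrZ; apply: le_lt_trans (_ : `|k| * (`|v| + 1) < r); last by rewrite -ltr_pdivlMr.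
  by rewrite ler_pM2l// lerDl.
have := hr _ kv.
have -> : \sum_(j < d) (k *: v) 0 j * partial j h (a + t *: v) = k * L.
  by rewrite /L mulr_sumr; apply: eq_bigr => j _; rewrite !mxE mulrA.
have -> : a + (k *: 1 + t) *: v = a + t *: v + k *: v.
  by rewrite [k *: 1]mulr1 scalerDl addrA addrAC.
set X := _ - h _; rewrite [_ *: X]/(k^-1 * X) => hX.
have -> : L - k^-1 * X = - (k^-1 * (X - k * L)) by field.
rewrite normrN normrM normfV mulrC ler_pdivrMr//; apply: (le_trans hX).
rewrite normrZ mulrCA mulrA [leRHS]mulrC -mulrA ler_pM2l//.
by rewrite mulrAC ler_pdivrMr// ler_pM2l// lerDl.
Qed.

Lemma extends_continuous h a : extends_continuously h -> simplex_int a -> {for a, continuous h}.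
Proof.
move=> [h' /subspace_continuousP ch' hh'] sa.
have ha : h a = h' a by apply: hh'; rewrite inE.
rewrite /prop_for /continuous_at ha.
have c1 : h' y @[y --> a] --> h' a.
  apply: cvg_trans (ch' _ (simplex_int_simplex sa)); apply: cvg_app.
  move=> A /=; rewrite /within/= => hA.
  apply: filterS2 (simplex_int_nbhs sa) hA => y sy; apply; exact: simplex_int_simplex.
have E : {near nbhs a, h' =1 h}.
  by apply: filterS (simplex_int_nbhs sa) => y sy; apply/esym/hh'; rewrite inE.
exact: cvg_trans (near_eq_cvg E) c1.
Qed.

(** Even if y lies on the boundary, the segment from an interior s is interior except possibly at
    its end. So derivatives that exist only in the interior suffice for mean value arguments up to
    boundary points. *)
Lemma simplex_segment s y (t : R) : simplex_int s -> simplex y -> 0 <= t < 1 ->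
  simplex_int (s + t *: (y - s)).
Proof.
move=> [s0 s1] sy /andP[t0 t1]; have ss : simplex s := simplex_int_simplex (conj s0 s1).
have e j : (s + t *: (y - s)) 0 j = (1 - t) * s 0 j + t * y 0 j by rewrite !mxE; ring.
have ge0 j : 0 < (s + t *: (y - s)) 0 j.
  rewrite e ltr_pwDl ?mulr_ge0 ?simplex_ge0//; have /andP[sj _] := s0 j.
  by rewrite mulr_gt0// subr_gt0.
have sum1 : \sum_(j < d) (s + t *: (y - s)) 0 j < 1.
  rewrite (eq_bigr (fun j => (1 - t) * s 0 j + t * y 0 j)) => [|j _]; last exact: e.
  rewrite big_split/= -!mulr_sumr -!norm1_simplex//.
  have h1 : t * norm1 y <= t by rewrite ler_piMr//; case: sy.
  have h2 : (1 - t) * norm1 s < 1 - t by rewrite gtr_pMr// subr_gt0.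
  by lra.
split; last first.
  by rewrite /norm1 (eq_bigr (fun j => (s + t *: (y - s)) 0 j))// => j _; rewrite gtr0_norm.
move=> j; rewrite ge0/=; apply: le_lt_trans sum1.
by rewrite (bigD1 j)//= lerDl sumr_ge0// => i _; exact: ltW.
Qed.

Lemma simplex_segment1 s y (t : R) : simplex_int s -> simplex y -> 0 <= t <= 1 ->
  simplex (s + t *: (y - s)).
Proof.
move=> si sy /andP[t0]; rewrite le_eqVlt => /predU1P[->|t1].
  by rewrite scale1r subrKC.
by apply: simplex_int_simplex; apply: simplex_segment; rewrite ?t0.
Qed.

End taylor.

Section taylor2.
Context {R : realType} {d : nat}.
Implicit Types (s y : 'rV[R]_d) (h m : 'rV[R]_d -> R).

Lemma extends_continuously_bounded (I : finType) (h : I -> 'rV[R]_d -> R) :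
  (forall i, extends_continuously (h i)) ->
  exists2 M, 0 <= M & forall i s, simplex_int s -> `|h i s| <= M.
Proof.
move=> eh.
have /choice[M hM] i : exists M, forall s, simplex_int s -> `|h i s| <= M.
  have [h' ch' hh'] := eh i; have [_ [M hM]] := bm_continuous ch'.
  exists M => s si; rewrite hh' ?inE//; apply: hM; exact: simplex_int_simplex.
exists (\sum_i `|M i|); first by rewrite sumr_ge0.
move=> i s si; apply: (le_trans (hM i s si)); rewrite (bigD1 i)//=.
by apply: (le_trans (ler_norm _)); rewrite lerDl sumr_ge0.
Qed.

Lemma extends_continuously_uniform (I : finType) (h : I -> 'rV[R]_d -> R) :
  (forall i, extends_continuously (h i)) -> forall e, 0 < e ->
  exists2 r, 0 < r & forall i s y, simplex_int s -> simplex_int y -> `|s - y| < r ->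
    `|h i s - h i y| < e.
Proof.
move=> eh e e0.
have /choice[r hr] i : exists r, 0 < r /\ forall s y, simplex_int s -> simplex_int y ->
    `|s - y| < r -> `|h i s - h i y| < e.
  have [h' ch' hh'] := eh i; have [r r0 hr] := simplex_uniformly_continuous ch' e0.
  exists r; split => // s y si yi sy; rewrite !hh' ?inE//.
  by apply: hr => //; exact: simplex_int_simplex.
exists (\big[Num.min/1]_i r i).
  by apply: lt_bigmin => // i _; have [] := hr i.
move=> i s y si yi sy; have [_ hri] := hr i; apply: hri => //.
by apply: lt_le_trans sy _; exact: bigmin_le_cond.
Qed.

Lemma continuous_segment h s y : {within @simplex R d, continuous h} ->
  simplex_int s -> simplex y ->
  {within `[0, 1], continuous (fun t : R => h (s + t *: (y - s)))}.
Proof.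
move=> ch si sy; apply/subspace_continuousP => t; rewrite /= in_itv/= => t01.
apply/cvgrPdist_lt => e e0.
have [r r0 hr] := simplex_uniformly_continuous ch e0.
have v1 : 0 < `|y - s| + 1 by rewrite ltr_wpDl.
rewrite near_withinE; exists (r / (`|y - s| + 1)); first by rewrite /= divr_gt0.
move=> u /= ut; rewrite in_itv/= => u01.
apply: hr; [exact: simplex_segment1|exact: simplex_segment1|].
rewrite opprD addrACA subrr add0r -scalerBl normrZ.
apply: le_lt_trans (_ : `|t - u| * (`|y - s| + 1) < r); last by rewrite -ltr_pdivlMr.
by rewrite ler_wpM2l// lerDl.
Qed.

(** The mean value theorem on the segment from s to y: boundedness of the first derivatives is used
    on the open segment, and continuity of [m] on the closed simplex at y. *)
Lemma C2_lipschitz m : C2_on_simplex m -> exists2 L, 0 <= L &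
  forall s y, simplex_int s -> simplex y -> `|m y - m s| <= L * `|y - s|.
Proof.
move=> [cm dm1 em1 _ _].
have [M M0 hM] := @extends_continuously_bounded _ (fun j => partial j m) em1.
exists (d%:R * M); first by rewrite mulr_ge0.
move=> s y si sy; set v := y - s.
have [c c01] := @MVT _ (fun t : R => m (s + t *: v))
  (fun t => \sum_(j < d) v 0 j * partial j m (s + t *: v)) 0 1 ltr01
  ltac:(by move=> t; rewrite in_itv/= => /andP[t0 t1]; apply: is_derive_interior_line => //;
    [move=> j z zi; exact: extends_continuous (em1 j) zi|apply: simplex_segment => //; rewrite t1 ltW])
  (continuous_segment cm si sy).
rewrite scale1r scale0r addr0 subrKC subr0 mulr1 => ->.
move: c01; rewrite in_itv/= => /andP[c0 c1].
rewrite mulrAC -mulrA mulr_natl -[X in _ *+ X](card_ord d) -sumr_const.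
apply: (le_trans (ler_norm_sum _ _ _)); apply: ler_sum => j _.
rewrite normrM; apply: ler_pM => //; first exact: norm_coord_le.
by apply: hM; apply: simplex_segment => //; rewrite (ltW c0).
Qed.

(** The radius is independent of s because the second derivatives extend continuously to the compact
    simplex and are therefore uniformly continuous. *)
Lemma taylor2 m : C2_on_simplex m -> forall e, 0 < e ->
  exists2 r, 0 < r & forall s y, simplex_int s -> simplex y -> `|y - s| < r ->
  `|m y - m s - \sum_(j < d) (y 0 j - s 0 j) * partial j m s
    - 2^-1 * \sum_(j < d) \sum_(k < d)
        (y 0 j - s 0 j) * (y 0 k - s 0 k) * partial j (partial k m) s| <= e * `|y - s| ^+ 2.
Proof.
move=> [cm dm1 em1 dm2 em2] e e0.
have dd0 : 0 < e / (d * d).+1%:R by rewrite divr_gt0.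
have [r r0 hr] := @extends_continuously_uniform _
  (fun jk : 'I_d * 'I_d => partial jk.1 (partial jk.2 m)) (fun jk => em2 jk.1 jk.2) _ dd0.
exists r => // s y si sy sr; set v := y - s.
have vE j : v 0 j = y 0 j - s 0 j by rewrite !mxE.
pose phi (t : R) := m (s + t *: v).
pose phi1 (t : R) := \sum_(k < d) v 0 k * partial k m (s + t *: v).
pose phi2 (t : R) := \sum_(k < d) v 0 k * \sum_(j < d) v 0 j * partial j (partial k m) (s + t *: v).
have dphi (t : R) : 0 <= t < 1 -> is_derive t 1 phi (phi1 t).
  move=> t01; apply: is_derive_interior_line => //; last exact: simplex_segment.
  by move=> j z zi; exact: extends_continuous (em1 j) zi.
have dphi1 (t : R) : 0 <= t < 1 -> is_derive t 1 phi1 (phi2 t).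
  move=> t01.
  rewrite (_ : phi1 = \sum_(k < d) (v 0 k \*: (fun u : R => partial k m (s + u *: v) : R^o))); last first.
    by apply/funext => u; rewrite /phi1 fct_sumE.
  apply: is_derive_sum => k; apply: is_deriveZ.
  apply: (@is_derive_interior_line _ _ (partial k m)); last exact: simplex_segment.
    by move=> j z zi; exact: dm2.
  by move=> j z zi; exact: extends_continuous (em2 j k) zi.
(* [psi] is the Taylor remainder along the segment. One mean value step for [psi] and a second one
   for [phi1] on [0, c] leave c (phi2 c' - phi2 0) with 0 < c' < c < 1, so no derivative is taken at
   t = 1, where y may be a boundary point. *)
pose psi (t : R) := phi t - t * phi1 0 - 2^-1 * t ^+ 2 * phi2 0.
have dpsi (t : R) : 0 <= t < 1 -> is_derive t 1 psi (phi1 t - phi1 0 - t * phi2 0).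
  move=> t01; have := dphi _ t01 => ?.
  rewrite (_ : psi = phi - (phi1 0 \*: (id : R -> R^o)) - ((2^-1 * phi2 0) \*: ((id : R -> R) ^+ 2))); last first.
    by apply/funext => u; rewrite /psi !fctE /=; congr (_ - _ - _); rewrite [RHS]/GRing.scale/=; ring.
  apply: is_derive_eq; rewrite /GRing.scale/= expr1; field; done.
have cphi : {within `[0, 1], continuous phi} by exact: continuous_segment.
have cpsi : {within `[0, 1], continuous psi}.
  have c1 : {within `[0, 1], continuous (fun t : R => t * phi1 0)}.
    by apply: continuous_subspaceT => t; apply: cvgM; [exact: cvg_id|exact: cvg_cst].
  have c2 : {within `[0, 1], continuous (fun t : R => 2^-1 * t ^+ 2 * phi2 0)}.
    apply: continuous_subspaceT => t; apply: cvgM; last exact: cvg_cst.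
    by apply: cvgM; [exact: cvg_cst|exact: exprn_continuous].
  move=> t; apply: cvgB; last exact: c2.
  by apply: cvgB; [exact: cphi|exact: c1].
have [c c01 psiE] := @MVT _ psi (fun t => phi1 t - phi1 0 - t * phi2 0) 0 1 ltr01
  ltac:(by move=> t; rewrite in_itv/= => /andP[t0 t1]; apply: dpsi; rewrite t1 ltW) cpsi.
move: c01; rewrite in_itv/= => /andP[c0 c1].
have [c' c'c phi1E] : exists2 c', c' \in `]0, c[%R & phi1 c - phi1 0 = phi2 c' * (c - 0).
  apply: MVT => //.
    by move=> t; rewrite in_itv/= => /andP[t0 t1]; apply: dphi1; rewrite (lt_trans t1 c1) ltW.
  apply: derivable_within_continuous => t; rewrite in_itv/= => /andP[t0 t1].
  by have [] := dphi1 t ltac:(by rewrite t0 (le_lt_trans t1 c1)).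
move: c'c; rewrite in_itv/= => /andP[c'0 c'c].
have -> : m y - m s - \sum_(j < d) (y 0 j - s 0 j) * partial j m s
    - 2^-1 * \sum_(j < d) \sum_(k < d)
        (y 0 j - s 0 j) * (y 0 k - s 0 k) * partial j (partial k m) s = psi 1 - psi 0.
  rewrite /psi /phi scale1r scale0r addr0 subrKC mul0r expr0n/= mulr0 mul0r !subr0 mul1r expr1n mulr1.
  have -> : \sum_(j < d) (y 0 j - s 0 j) * partial j m s = phi1 0.
    by rewrite /phi1 scale0r addr0; apply: eq_bigr => j _; rewrite vE.
  have -> : \sum_(j < d) \sum_(k < d)
      (y 0 j - s 0 j) * (y 0 k - s 0 k) * partial j (partial k m) s = phi2 0.
    rewrite /phi2 scale0r addr0 exchange_big/=; apply: eq_bigr => k _.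
    by rewrite mulr_sumr; apply: eq_bigr => j _; rewrite !vE; ring.
  by ring.
rewrite psiE subr0 mulr1 phi1E subr0 [c * _]mulrC -mulrBl normrM.
apply: (@le_trans _ _ `|phi2 c' - phi2 0|).
  by rewrite ler_piMr// gtr0_norm// ltW.
have -> : phi2 c' - phi2 0 = \sum_(k < d) \sum_(j < d) v 0 k * v 0 j *
    (partial j (partial k m) (s + c' *: v) - partial j (partial k m) s).
  rewrite /phi2 -sumrB; apply: eq_bigr => k _; rewrite -mulrBr -sumrB mulr_sumr.
  by apply: eq_bigr => j _; rewrite scale0r addr0 -mulrBr mulrA.
apply: (@le_trans _ _ (\sum_(k < d) \sum_(j < d) `|v| ^+ 2 * (e / (d * d).+1%:R))); last first.
  rewrite !sumr_const !card_ord -mulrnA -[leLHS]mulr_natr -mulrA [leRHS]mulrC.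
  rewrite ler_wpM2l ?exprn_ge0// mulrAC ler_pdivrMr// ler_pM2l// ler_nat.
  exact: leqnSn.
apply: (le_trans (ler_norm_sum _ _ _)); apply: ler_sum => k _.
apply: (le_trans (ler_norm_sum _ _ _)); apply: ler_sum => j _.
rewrite normrM; apply: ler_pM => //.
  by rewrite normrM expr2; apply: ler_pM => //; exact: norm_coord_le.
rewrite distrC; apply/ltW/(hr (j, k)) => //.
  by apply: simplex_segment => //; rewrite (ltW c'0) (lt_trans c'c).
rewrite opprD addrA subrr sub0r normrN normrZ gtr0_norm//.
by apply: le_lt_trans sr; rewrite ler_piMl// ltW// (lt_trans c'c).
Qed.

End taylor2.

(** * Concentration and bias of the kernel mean *)

Section kernel_bias.
Context {R : realType} {d : nat}.
Implicit Types (s y w : 'rV[R]_d) (h m : 'rV[R]_d -> R) (b : R).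

Lemma norm_rV_exp_le w n : (0 < n)%N -> `|w| ^+ n <= \sum_(j < d) `|w 0 j| ^+ n.
Proof.
move=> n0; have [->|w0] := eqVneq w 0.
  by rewrite normr0 expr0n (gtn_eqF n0)/= sumr_ge0// => j _; rewrite exprn_ge0.
have [[i j] /= e] := mx_norm_neq0 (contra_neq (@mx_norm_eq0 _ _ _ w) w0).
have -> : `|w| = `|w 0 j| by rewrite [LHS]e ord1.
by rewrite (bigD1 j)//= lerDl sumr_ge0// => k _; rewrite exprn_ge0.
Qed.

(** For even n this polynomial majorises |y - s|^n in the sup norm, and its mean is a sum of centred
    moments. *)
Definition sum_dev s y n : R := \sum_(j < d) (y 0 j - s 0 j) ^+ n.

Lemma bm_dev s (j : 'I_d) : bounded_measurable (fun y : 'rV[R]_d => y 0 j - s 0 j).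
Proof. by apply: bmB; [exact: bm_coord|exact: bm_cst]. Qed.

Lemma bm_sum_dev s n : bounded_measurable (fun y => sum_dev s y n).
Proof. by apply: bm_sum => j _; apply: bmX; exact: bm_dev. Qed.

Lemma norm_sum_dev s y n : (0 < n)%N -> ~~ odd n -> `|y - s| ^+ n <= sum_dev s y n.
Proof.
move=> n0 on; apply: (le_trans (norm_rV_exp_le _ n0)).
rewrite le_eqVlt; apply/orP; left; apply/eqP; apply: eq_bigr => j _.
by rewrite !mxE -normrX ger0_norm// exprn_even_ge0.
Qed.

Lemma simplex_mean_sum_dev2 s b : simplex_int s -> 0 < b <= 1 ->
  simplex_mean s b (fun y => sum_dev s y 2) <= d%:R * (1 + 3 * (d%:R + 4) ^+ 2) * b.
Proof.
move=> si /andP[b0 b1]; have ss := simplex_int_simplex si.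
rewrite simplex_mean_sum//; last by move=> j; apply: bmX; exact: bm_dev.
rewrite -mulrA mulr_natl -[X in _ *+ X](card_ord d) -sumr_const; apply: ler_sum => j _.
have := simplex_mean_dev2_bound j j si b0; rewrite eqxx mulr1n.
rewrite (@eq_simplex_mean _ _ _ _ _ (fun y => (y 0 j - s 0 j) ^+ 2)); last by move=> y _; rewrite expr2.
set E := simplex_mean _ _ _; set K := (3 * _) => h.
have s0 := simplex_ge0 j ss; have s1 := simplex_le1 j ss.
have h1 : b * (s 0 j * (1 - s 0 j)) <= b.
  by rewrite ler_piMr ?(ltW b0)// mulr_ile1// ?subr_ge0// gerBl.
have h2 : K * b ^+ 2 <= K * b.
  by rewrite ler_wpM2l ?mulr_ge0 ?exprn_ge0 ?addr_ge0// expr2 ler_piMr// ltW.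
by move: h; rewrite ler_norml => /andP[_]; lra.
Qed.

Lemma simplex_mean_sum_dev4 s b : simplex_int s -> 0 < b <= 1 ->
  simplex_mean s b (fun y => sum_dev s y 4) <= d%:R * (9 * (d%:R + 4) ^+ 4 * (d%:R + 6)) * b ^+ 2.
Proof.
move=> si b01; have ss := simplex_int_simplex si; have /andP[b0 b1] := b01.
rewrite simplex_mean_sum//; last by move=> j; apply: bmX; exact: bm_dev.
rewrite -mulrA mulr_natl -[X in _ *+ X](card_ord d) -sumr_const; apply: ler_sum => j _.
exact: simplex_mean_dev4_bound.
Qed.

Lemma simplex_meanZr s b r h : simplex s -> 0 < b -> bounded_measurable h ->
  simplex_mean s b (fun y => h y * r) = simplex_mean s b h * r.
Proof.
move=> ss b0 bh; rewrite mulrC -simplex_meanZ//.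
by apply: eq_simplex_mean => y _; rewrite mulrC.
Qed.

Lemma simplex_meanB s b h1 h2 : simplex s -> 0 < b ->
  bounded_measurable h1 -> bounded_measurable h2 ->
  simplex_mean s b (fun y => h1 y - h2 y) = simplex_mean s b h1 - simplex_mean s b h2.
Proof.
move=> ss b0 H1 H2; rewrite simplex_meanD//; last exact: bmN.
congr (_ + _); rewrite -mulN1r -simplex_meanZ//.
by apply: eq_simplex_mean => y _; rewrite mulN1r.
Qed.

Lemma sum_const_ord (r : R) : \sum_(j < d) r = d%:R * r.
Proof. by rewrite sumr_const card_ord mulr_natl. Qed.

(** Chebyshev's argument: |h y - h s| is at most e/2 near s, and elsewhere at most 2M <= (2M/r^2) |y
    - s|^2, whose mean is O(b). *)
Lemma simplex_mean_approx h s : {within @simplex R d, continuous h} -> simplex_int s ->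
  forall e, 0 < e -> exists2 b1, 0 < b1 &
    forall b, 0 < b < b1 -> `|simplex_mean s b h - h s| <= e.
Proof.
move=> ch si e e0; have ss := simplex_int_simplex si.
have bh := bm_continuous ch; have [_ [M hM]] := bh.
have e20 : 0 < e / 2 by rewrite divr_gt0.
have [r r0 hr] := simplex_uniformly_continuous ch e20.
have M0 : 0 <= M by apply: le_trans (hM _ ss).
pose K := 2 * M / r ^+ 2; have K0 : 0 <= K by rewrite divr_ge0 ?mulr_ge0 ?exprn_ge0// ltW.
pose C : R := d%:R * (1 + 3 * (d%:R + 4) ^+ 2).
have C0 : 0 <= C by rewrite mulr_ge0// addr_ge0// mulr_ge0// exprn_ge0// addr_ge0.
pose b1 := Num.min 1 (e / 2 / (K * C + 1)).
have KC0 : 0 < K * C + 1 by rewrite ltr_wpDl// mulr_ge0.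
exists b1; first by rewrite lt_min ltr01 divr_gt0.
move=> b /andP[b0]; rewrite lt_min => /andP[bl1 be].
have b01 : 0 < b <= 1 by rewrite b0 ltW.
have -> : simplex_mean s b h - h s = simplex_mean s b (fun y => h y - h s).
  rewrite simplex_meanD//; last exact: bm_cst.
  by rewrite simplex_mean_cst.
have bb : bounded_measurable (fun y : 'rV[R]_d => e / 2 + K * sum_dev s y 2).
  by apply: bmD; [exact: bm_cst|apply: bmM; [exact: bm_cst|exact: bm_sum_dev]].
apply: (@le_trans _ _ (simplex_mean s b (fun y => e / 2 + K * sum_dev s y 2))).
  apply: normr_simplex_mean => //; first by apply: bmB => //; exact: bm_cst.
  move=> y sy; have n2 := @norm_sum_dev s y 2 isT isT.
  have [ys|ys] := ltP `|y - s| r.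
    rewrite -[leLHS]addr0; apply: lerD; first by apply/ltW/hr.
    by rewrite mulr_ge0// (le_trans _ n2)// exprn_ge0.
  rewrite -[leLHS]add0r; apply: lerD; first exact: ltW.
  apply: (@le_trans _ _ (2 * M)).
    by apply: (le_trans (ler_normB _ _)); rewrite mulr_natl mulr2n; apply: lerD; exact: hM.
  rewrite /K mulrAC ler_pdivlMr ?exprn_gt0// ler_wpM2l ?mulr_ge0//.
  by apply: le_trans n2; rewrite ler_pXn2r ?nnegrE// ltW.
rewrite simplex_meanD//; [|exact: bm_cst|by apply: bmM; [exact: bm_cst|exact: bm_sum_dev]].
rewrite simplex_mean_cst// simplex_meanZ//; last exact: bm_sum_dev.
rewrite [leRHS](splitr e) lerD2l.
apply: (@le_trans _ _ (K * (C * b))); first by rewrite ler_wpM2l// simplex_mean_sum_dev2.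
rewrite mulrA; apply: (@le_trans _ _ ((K * C + 1) * b)).
  by rewrite ler_wpM2r ?(ltW b0)// lerDl.
by rewrite mulrC -ler_pdivlMr// ltW.
Qed.

(** The threshold [b1] precedes s: the Taylor radius, the bounds on the derivatives and the moment
    constants are valid throughout the interior. *)
Lemma kernel_bias m : C2_on_simplex m -> forall e, 0 < e ->
  exists2 b1, 0 < b1 & forall s b, simplex_int s -> 0 < b < b1 ->
    `|simplex_mean s b m - m s - b * g_fun m s| <= e * b.
Proof.
move=> Cm; have [cm dm1 em1 dm2 em2] := Cm.
have bm := bm_continuous cm; have [_ [M0 hM0]] := bm.
have [M1 M10 hM1] := @extends_continuously_bounded _ _ _ (fun j => partial j m) em1.
have [M2 M20 hM2] := @extends_continuously_bounded _ _ _
  (fun jk : 'I_d * 'I_d => partial jk.1 (partial jk.2 m)) (fun jk => em2 jk.1 jk.2).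
pose taylor s y := \sum_(j < d) (y 0 j - s 0 j) * partial j m s
    + 2^-1 * \sum_(j < d) \sum_(k < d)
        (y 0 j - s 0 j) * (y 0 k - s 0 k) * partial j (partial k m) s.
have btay s : bounded_measurable (taylor s).
  apply: bmD.
    by apply: bm_sum => j _; apply: bmM; [exact: bm_dev|exact: bm_cst].
  apply: bmM; first exact: bm_cst.
  apply: bm_sum => j _; apply: bm_sum => k _; apply: bmM; last exact: bm_cst.
  by apply: bmM; exact: bm_dev.
pose C := (d%:R + 4) ^+ 2 : R.
have C0 : 0 <= C by rewrite exprn_ge0// addr_ge0.
pose K1 := d%:R * (C * M1) + 2^-1 * (d%:R * (d%:R * (3 * C * M2))).
have tay_mean s b : simplex_int s -> 0 < b ->
    `|simplex_mean s b (taylor s) - b * g_fun m s| <= K1 * b ^+ 2.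
  move=> si b0; have ss := simplex_int_simplex si.
  have bmj j : bounded_measurable (fun y : 'rV[R]_d => (y 0 j - s 0 j) * partial j m s).
    by apply: bmM; [exact: bm_dev|exact: bm_cst].
  have bm2 j k : bounded_measurable (fun y : 'rV[R]_d => (y 0 j - s 0 j) * (y 0 k - s 0 k)).
    by apply: bmM; exact: bm_dev.
  have bmjk j k : bounded_measurable (fun y : 'rV[R]_d =>
      (y 0 j - s 0 j) * (y 0 k - s 0 k) * partial j (partial k m) s).
    by apply: bmM => //; exact: bm_cst.
  rewrite simplex_meanD//; last 2 first.
  - by apply: bm_sum => j _.
  - apply: bmM; first exact: bm_cst.
    by apply: bm_sum => j _; apply: bm_sum => k _.
  rewrite simplex_meanZ//; last by apply: bm_sum => j _; apply: bm_sum => k _.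
  rewrite !simplex_mean_sum//; last by move=> j; apply: bm_sum => k _.
  have -> : \sum_(j < d) simplex_mean s b (fun y : 'rV[R]_d => \sum_(k < d)
        (y 0 j - s 0 j) * (y 0 k - s 0 k) * partial j (partial k m) s) =
      \sum_(j < d) \sum_(k < d) simplex_mean s b (fun y : 'rV[R]_d =>
        (y 0 j - s 0 j) * (y 0 k - s 0 k)) * partial j (partial k m) s.
    apply: eq_bigr => j _; rewrite simplex_mean_sum//.
    by apply: eq_bigr => k _; rewrite simplex_meanZr.
  have -> : \sum_(j < d) simplex_mean s b (fun y : 'rV[R]_d => (y 0 j - s 0 j) * partial j m s) =
      \sum_(j < d) simplex_mean s b (fun y : 'rV[R]_d => y 0 j - s 0 j) * partial j m s.
    by apply: eq_bigr => j _; rewrite simplex_meanZr//; exact: bm_dev.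
  rewrite /g_fun mulrDr opprD addrACA [b * (2^-1 * _)]mulrCA -mulrBr.
  apply: (le_trans (ler_normD _ _)); rewrite /K1 mulrDl; apply: lerD.
    rewrite mulr_sumr -sumrB; apply: (le_trans (ler_norm_sum _ _ _)).
    rewrite -[leRHS]mulrA -sum_const_ord; apply: ler_sum => j _.
    rewrite mulrA -mulrBl normrM mulrAC; apply: ler_pM => //; last exact: hM1.
    exact: simplex_mean_dev_bound.
  rewrite normrM gtr0_norm// -[leRHS]mulrA ler_pM2l//.
  rewrite mulr_sumr -sumrB; apply: (le_trans (ler_norm_sum _ _ _)).
  rewrite -[leRHS]mulrA -sum_const_ord; apply: ler_sum => j _.
  rewrite mulr_sumr -sumrB; apply: (le_trans (ler_norm_sum _ _ _)).
  rewrite -[leRHS]mulrA -sum_const_ord; apply: ler_sum => k _.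
  rewrite mulrA -mulrBl normrM mulrAC; apply: ler_pM => //; last exact: (hM2 (j, k)).
  exact: simplex_mean_dev2_bound.
(* A crude bound for the Taylor remainder far from s, where only |y_j - s_j| <= 1 is available. *)
pose K2 := 2 * M0 + d%:R * M1 + 2^-1 * (d%:R * (d%:R * M2)).
have M00 : 0 <= M0.
  apply: le_trans (hM0 0 _) => //; apply/simplexE; split => [j|]; first by rewrite mxE.
  by rewrite big1// => j _; rewrite mxE.
have rem_bound s y : simplex_int s -> simplex y -> `|m y - m s - taylor s y| <= K2.
  move=> si sy; have ss := simplex_int_simplex si.
  have dj j : `|y 0 j - s 0 j| <= 1.
    have y0 := simplex_ge0 j sy; have y1 := simplex_le1 j sy.
    have s0 := simplex_ge0 j ss; have s1 := simplex_le1 j ss.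
    by rewrite ler_norml; apply/andP; split; lra.
  apply: (le_trans (ler_normB _ _)); rewrite /K2 -addrA; apply: lerD.
    by apply: (le_trans (ler_normB _ _)); rewrite mulr_natl mulr2n; apply: lerD; exact: hM0.
  apply: (le_trans (ler_normD _ _)); apply: lerD.
    apply: (le_trans (ler_norm_sum _ _ _)); rewrite -sum_const_ord; apply: ler_sum => j _.
    by rewrite normrM -[leRHS]mul1r; apply: ler_pM => //; exact: hM1.
  rewrite normrM gtr0_norm// ler_pM2l//.
  apply: (le_trans (ler_norm_sum _ _ _)); rewrite -sum_const_ord; apply: ler_sum => j _.
  apply: (le_trans (ler_norm_sum _ _ _)); rewrite -sum_const_ord; apply: ler_sum => k _.
  rewrite normrM -[leRHS]mul1r; apply: ler_pM => //; last exact: (hM2 (j, k)).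
  by rewrite normrM -[leRHS]mul1r; apply: ler_pM.
move=> e e0.
pose C2 : R := d%:R * (1 + 3 * (d%:R + 4) ^+ 2).
have C20 : 0 <= C2 by rewrite mulr_ge0// addr_ge0// mulr_ge0.
have C21 : 0 < C2 + 1 by rewrite ltr_wpDl.
pose C4 : R := d%:R * (9 * (d%:R + 4) ^+ 4 * (d%:R + 6)).
have C40 : 0 <= C4 by rewrite !mulr_ge0// ?exprn_ge0// addr_ge0.
(* Near s the remainder is at most e' |y - s|^2, of mean at most e' C2 b <= (e/2) b. Far from s it
   is at most (K2/r^4) |y - s|^4, of mean O(b^2). [K3] collects all coefficients of b^2, and b <=
   e/(2(K3+1)) absorbs them into the other half. *)
have e'0 : 0 < e / 2 / (C2 + 1) by rewrite !divr_gt0.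
have [r r0 hr] := taylor2 Cm e'0.
have K20 : 0 <= K2 by rewrite /K2 !addr_ge0// ?mulr_ge0// mulr_ge0.
have K10 : 0 <= K1 by rewrite /K1 !addr_ge0// ?mulr_ge0// ?mulr_ge0// mulr_ge0.
pose K3 := K2 / r ^+ 4 * C4 + K1.
have K2r : 0 <= K2 / r ^+ 4 by rewrite divr_ge0// exprn_ge0// ltW.
have K30 : 0 <= K3 by rewrite addr_ge0// mulr_ge0.
have K31 : 0 < K3 + 1 by rewrite ltr_wpDl.
exists (Num.min 1 (e / 2 / (K3 + 1))); first by rewrite lt_min ltr01 !divr_gt0.
move=> s b si /andP[b0]; rewrite lt_min => /andP[bl1 be].
have b01 : 0 < b <= 1 by rewrite b0 ltW.
have ss := simplex_int_simplex si.
have brem : bounded_measurable (fun y : 'rV[R]_d => m y - m s - taylor s y).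
  by apply: bmB => //; apply: bmB => //; exact: bm_cst.
have -> : simplex_mean s b m - m s - b * g_fun m s =
    simplex_mean s b (fun y => m y - m s - taylor s y) + (simplex_mean s b (taylor s) - b * g_fun m s).
  rewrite !simplex_meanB//; last by apply: bmB => //; exact: bm_cst.
  - by rewrite simplex_mean_cst//; ring.
  - exact: bm_cst.
set e' := e / 2 / (C2 + 1) in e'0 hr *.
have bb : bounded_measurable (fun y : 'rV[R]_d => e' * sum_dev s y 2 + K2 / r ^+ 4 * sum_dev s y 4).
  by apply: bmD; apply: bmM; [exact: bm_cst|exact: bm_sum_dev|exact: bm_cst|exact: bm_sum_dev].
have h1 : `|simplex_mean s b (fun y => m y - m s - taylor s y)| <= e' * (C2 * b) + K2 / r ^+ 4 * (C4 * b ^+ 2).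
  apply: (@le_trans _ _ (simplex_mean s b (fun y => e' * sum_dev s y 2 + K2 / r ^+ 4 * sum_dev s y 4))).
    apply: normr_simplex_mean => // y sy.
    have n2 := @norm_sum_dev s y 2 isT isT; have n4 := @norm_sum_dev s y 4 isT isT.
    have [ys|ys] := ltP `|y - s| r.
      rewrite -[leLHS]addr0; apply: lerD; last by rewrite mulr_ge0// (le_trans _ n4)// exprn_ge0.
      rewrite /taylor opprD addrA; apply: (le_trans (hr _ _ si sy ys)).
      by rewrite ler_wpM2l// ltW.
    rewrite -[leLHS]add0r; apply: lerD.
      by rewrite mulr_ge0 ?(ltW e'0)// (le_trans _ n2)// exprn_ge0.
    apply: (le_trans (rem_bound _ _ si sy)).
    rewrite mulrAC ler_pdivlMr ?exprn_gt0// ler_wpM2l//.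
    by apply: le_trans n4; rewrite ler_pXn2r ?nnegrE// ltW.
  rewrite simplex_meanD//; do ?[by apply: bmM; [exact: bm_cst|exact: bm_sum_dev]].
  rewrite !simplex_meanZ//; do ?[exact: bm_sum_dev].
  apply: lerD; first by rewrite ler_wpM2l ?(ltW e'0)// simplex_mean_sum_dev2.
  by rewrite ler_wpM2l// simplex_mean_sum_dev4.
apply: (le_trans (ler_normD _ _)).
have h2 := tay_mean _ _ si b0.
have h3 : e' * (C2 * b) <= e / 2 * b.
  rewrite mulrA ler_wpM2r ?(ltW b0)// /e' mulrAC ler_pdivrMr// ler_pM2l ?divr_gt0//.
  by rewrite lerDl.
have h4 : K3 * b ^+ 2 <= e / 2 * b.
  rewrite expr2 mulrA ler_wpM2r ?(ltW b0)//.
  apply: (@le_trans _ _ ((K3 + 1) * b)); first by rewrite ler_wpM2r ?(ltW b0)// lerDl.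
  by rewrite mulrC -ler_pdivlMr// ltW.
rewrite {1}/K3 in h4.
by lra.
Qed.

End kernel_bias.

(** * Cells *)

Section cell_geometry.
Context {R : realType} {d : nat}.
Implicit Types (s y : 'rV[R]_d) (h : 'rV[R]_d -> R) (A : set 'rV[R]_d).
Local Notation leb := (lebesgue_rV R d).

Lemma measurable_frontier A : closed A -> measurable (frontier A : set (borel R d)).
Proof.
move=> cA; apply: measurableD; first by apply: closed_measurable_borel; exact: closed_closure.
by apply: open_measurable_borel; exact: open_interior.
Qed.

(** Only the interiors are disjoint, so the cells are first reduced modulo the union N of their
    frontiers, a null set. Off N a point of a cell is interior to it, and the reduced cells form a
    partition. *)
Lemma Rintegral_cells n (B : 'I_n -> set 'rV[R]_d) h :
  (forall i, closed (B i)) ->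
  (forall i j, i != j -> (B i)° `&` (B j)° = set0) ->
  (forall i, leb (frontier (B i)) = 0%E) ->
  \bigcup_i B i = @simplex R d -> bounded_measurable h ->
  \sum_(i < n) \int[leb]_(y in B i) h y = \int[leb]_(y in @simplex R d) h y.
Proof.
move=> cB dB fB UB bh.
pose N : set (borel R d) := \big[setU/set0]_(i <- enum 'I_n) frontier (B i).
have mfr i : measurable (frontier (B i) : set (borel R d)) by exact: measurable_frontier.
have mN : measurable N by apply: bigsetU_measurable => i _.
have N0 : leb N = 0%E.
  apply: (measure_negligible mN); rewrite /N.
  elim/big_ind : _ => [|*|i _]; [exact: negligible_set0|exact: negligibleU|].
  by exists (frontier (B i)); split; [exact: mfr|exact: fB|].
have mB i : measurable (B i : set (borel R d)) by exact: closed_measurable_borel.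
have BS i : B i `<=` @simplex R d by rewrite -UB => y By; exists i.
have rem A : measurable (A : set (borel R d)) -> A `<=` @simplex R d ->
    \int[leb]_(y in A) h y = \int[leb]_(y in A `\` N) h y.
  move=> mA AS; rewrite /Rintegral; congr fine.
  by apply: negligible_integral => //; exact: bm_integrable.
rewrite (rem _ (@measurable_simplex R d))//.
rewrite (eq_bigr (fun i => \int[leb]_(y in B i `\` N) h y)); last by move=> i _; exact: rem.
have mBN i : measurable (B i `\` N : set (borel R d)) by exact: measurableD.
rewrite /Rintegral.
have UE : @simplex R d `\` N = \big[setU/set0]_(i <- enum 'I_n) (B i `\` N).
  apply/seteqP; split => y.
    move=> [Sy nN]; move: Sy; rewrite -UB => -[i _ By].
    by rewrite -bigcup_seq; exists i => //=; rewrite mem_enum.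
  rewrite -bigcup_seq => -[i _ [By nN]]; split => //; exact: BS By.
rewrite UE integral_bigsetU_EFin//; last 3 first.
- exact: enum_uniq.
- apply/trivIsetP => i j _ _ ij; rewrite -subset0 => y [[Bi nN] [Bj _]].
  have int k : B k y -> (B k)° y.
    move=> Bk; apply: contrapT => nint; apply: nN.
    rewrite /N -bigcup_seq; exists k; first by rewrite /= mem_enum.
    by split => //; exact: subset_closure.
  by rewrite -(dB _ _ ij); split; exact: int.
- rewrite -UE; apply/measurable_EFinP; case: bh => + _; apply: measurable_funS => //.
  exact: measurable_simplex.
rewrite big_enum/= sum_fine// => i _.
have ih : leb.-integrable (B i `\` N) (EFin \o h).
  by apply: bm_integrable => // y [/BS].
exact: integrable_fin_num ih.
Qed.

Lemma norm_le_dist2 s y : `|s - y| <= dist2 s y.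
Proof.
rewrite /dist2 -[leLHS]ger0_norm// -sqrtr_sqr ler_wsqrtr//.
apply: (le_trans (norm_rV_exp_le _ _)) => //.
rewrite le_eqVlt; apply/orP; left; apply/eqP; apply: eq_bigr => j _.
by rewrite !mxE real_normK// num_real.
Qed.

Lemma norm_le_diam A s y : A `<=` @simplex R d -> A s -> A y -> `|s - y| <= diam A.
Proof.
move=> AS As Ay; apply: (le_trans (norm_le_dist2 s y)).
apply: ub_le_sup; last by exists s, y.
(* The supremum bounds its elements only if the set is bounded; coordinates in [0, 1] keep all
   distances below sqrt d. *)
exists (Num.sqrt (\sum_(j < d) 1)) => _ [u [v [Au Av ->]]].
apply: ler_wsqrtr; apply: ler_sum => j _.
have u0 := simplex_ge0 j (AS _ Au); have u1 := simplex_le1 j (AS _ Au).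
have v0 := simplex_ge0 j (AS _ Av); have v1 := simplex_le1 j (AS _ Av).
by rewrite -[leRHS](expr1n _ 2) -(real_normK (num_real _)) ler_pXn2r ?nnegrE// ler_norml; lra.
Qed.

Lemma lipschitz_on_simplexP h : lipschitz_on_simplex h ->
  exists2 L, 0 <= L & forall x y, simplex x -> simplex y -> `|h x - h y| <= L * `|x - y|.
Proof.
move=> lh.
have [M [M0 hM]] : exists M, 0 < M /\
    forall p, (@simplex R d `*` @simplex R d) p -> `|h p.1 - h p.2| <= M * `|p.1 - p.2|.
  near (+oo : set_system R) => M.
  exists M; split; first by near: M; exact: nbhs_pinfty_gt.
  by near: M; exact: lh.
by exists M; [exact: ltW|move=> x y sx sy; exact: (hM (x, y))].
Unshelve. all: by end_near. Qed.

Lemma lipschitz_within_continuous h : lipschitz_on_simplex h ->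
  {within @simplex R d, continuous h}.
Proof.
move=> /lipschitz_on_simplexP[L L0 hL]; apply/subspace_continuousP => x sx.
apply/cvgrPdist_lt => e e0; have L1 : 0 < L + 1 by rewrite ltr_wpDl.
rewrite near_withinE; apply/nbhs_ballP; exists (e / (L + 1)); first by rewrite /= divr_gt0.
move=> y; rewrite mx_norm_ball /= => xy sy; apply: (le_lt_trans (hL _ _ sx sy)).
apply: le_lt_trans (_ : (L + 1) * `|x - y| < e); first by rewrite ler_wpM2r// lerDl.
by rewrite mulrC -ltr_pdivlMr.
Qed.

End cell_geometry.

(** * Oscillation of the kernel and squared weights of single cells *)

Section cell_estimates.
Context {R : realType} {d : nat}.
Implicit Types (s y : 'rV[R]_d) (h : 'rV[R]_d -> R) (A : set 'rV[R]_d) (b : R).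
Local Notation leb := (lebesgue_rV R d).

(** As u >= t/2, the base grows by a factor of at most 1 + 2D/t <= exp(2D/t); raised to the power
    t/b this is exp(2D/b), with t cancelled. Large exponents are thus harmless as soon as D =
    o(b). *)
Let powR_perturbation (t b u u' D : R) : 0 < t -> 0 < b -> t / 2 <= u -> 0 <= u' ->
  `|u' - u| <= D -> u' `^ (t / b) <= u `^ (t / b) * expR (2 * D / b).
Proof.
move=> t0 b0 tu u'0 uD; have u0 : 0 < u by apply: lt_le_trans tu; rewrite divr_gt0.
have D0 : 0 <= D by apply: le_trans uD.
have tb0 : 0 <= t / b by rewrite divr_ge0// ltW.
have -> : expR (2 * D / b) = expR (2 * D / t) `^ (t / b).
  rewrite /powR gt_eqF ?expR_gt0// expRK; congr expR.
  by field; rewrite !gt_eqF.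
rewrite -powRM ?(ltW u0) ?expR_ge0//.
apply: ge0_ler_powR => //; rewrite ?nnegrE ?mulr_ge0 ?expR_ge0 ?(ltW u0)//.
apply: (@le_trans _ _ (u * (1 + 2 * D / t))); last first.
  by rewrite ler_wpM2l ?(ltW u0)// expR_ge1Dx.
have h1 : D <= u * (2 * D / t).
  rewrite [leLHS](_ : D = t / 2 * (2 * D / t)); last by field; rewrite gt_eqF.
  by rewrite ler_wpM2r// divr_ge0 ?mulr_ge0// ltW.
by move: uD; rewrite ler_norml mulrDr mulr1 => /andP[_]; lra.
Qed.

Lemma norm1_lipschitz s y : `|norm1 s - norm1 y| <= d%:R * `|s - y|.
Proof.
rewrite /norm1 -sumrB -sum_const_ord; apply: (le_trans (ler_norm_sum _ _ _)).
apply: ler_sum => j _; apply: (le_trans (ler_dist_dist _ _)).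
by have := norm_coord_le (s - y) j; rewrite !mxE.
Qed.

(** In the ball of radius r every barycentric coordinate of y exceeds half of that of s. Each of the
    d coordinates contributes exp(2|y'-y|/b), and the slack, Lipschitz with constant d, contributes
    exp(2d|y'-y|/b), hence 4d in total. *)
Lemma kappa_oscillation s : simplex_int s -> exists2 r, 0 < r &
  forall b y y', 0 < b -> simplex y -> simplex y' -> `|s - y| < r ->
    kappa s b y' <= kappa s b y * expR (4 * d%:R * `|y' - y| / b).
Proof.
move=> si; have ss := simplex_int_simplex si.
have s0 := simplex_int_slack_gt0 si.
have [r r0 hr] : exists2 r, 0 < r & forall y, `|s - y| < r ->
    (forall j, s 0 j / 2 <= y 0 j) /\ (1 - norm1 s) / 2 <= 1 - norm1 y.
  have hj (j : 'I_d) : \forall y \near s, s 0 j / 2 <= (y : 'rV[R]_d) 0 j.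
    have cj : ((y : 'rV[R]_d) 0 j : R) @[y --> s] --> (s 0 j : R) by exact: coord_continuous.
    have sj := simplex_int_gt0 j si.
    by apply: (cvgr_ge _ cj); rewrite ltr_pdivrMr// ltr_pMr// ltr1n.
  have h0 : \forall y \near s, (1 - norm1 s) / 2 <= 1 - norm1 y.
    have : \forall y \near s, norm1 y <= 1 - (1 - norm1 s) / 2.
      by apply: (cvgr_le _ (@norm1_continuous R d s)); lra.
    by apply: filterS => y; lra.
  have hall : \forall y \near s, forall j : 'I_d, s 0 j / 2 <= (y : 'rV[R]_d) 0 j.
    exact: filter_forall hj.
  have /nbhs_ballP[r /= r0 hr] : \forall y \near s,
      (forall j, s 0 j / 2 <= (y : 'rV[R]_d) 0 j) /\ (1 - norm1 s) / 2 <= 1 - norm1 y.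
    by apply: filterS2 hall h0 => y.
  by exists r => // y sy; apply: hr; rewrite mx_norm_ball.
exists r => // b y y' b0 sy sy' /hr[yj y0].
rewrite !kappaE// -mulrA ler_pM2l ?kernel_cst_gt0// /kernel_shape.
have -> : expR (4 * d%:R * `|y' - y| / b) =
    (\prod_(j < d) expR (2 * `|y' - y| / b)) * expR (2 * (d%:R * `|y' - y|) / b).
  rewrite prodr_const card_ord -expRM_natl -expRD; congr expR.
  by field; rewrite gt_eqF.
rewrite mulrACA -big_split/=; apply: ler_pM.
- by rewrite prodr_ge0// => j _; rewrite powR_ge0.
- exact: powR_ge0.
- apply: ler_prod => j _; rewrite powR_ge0/=.
  apply: powR_perturbation => //; [exact: simplex_int_gt0|exact: simplex_ge0|].
  by have := norm_coord_le (y' - y) j; rewrite !mxE.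
- apply: powR_perturbation => //; first exact: simplex_slack_ge0.
  rewrite opprD addrACA subrr add0r opprK addrC; apply: le_trans (norm1_lipschitz _ _) _.
  by rewrite distrC.
Qed.

Section one_cell.
Variables (s : 'rV[R]_d) (b : R) (A : set 'rV[R]_d).
Hypotheses (si : simplex_int s) (b0 : 0 < b).
Hypotheses (cA : closed A) (AS : A `<=` @simplex R d).
Let ss := simplex_int_simplex si.
Let lam : R := fine (leb A).
Let w : R := \int[leb]_(y in A) kappa s b y.
(** In the application [sig] is sigma^2(x_i), [nn] is n and h is sigma^2/f. Since n Leb(B_i) is
    close to 1/f(x_i), the quantity n^-1 [q h] is the target for [sig * w ^+ 2]. *)
Let q (h : 'rV[R]_d -> R) : R := \int[leb]_(y in A) (h y * kappa s b y ^+ 2).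

Let mA : measurable (A : set (borel R d)) := closed_measurable_borel cA.

Let iA h : bounded_measurable h -> leb.-integrable A (EFin \o h).
Proof. by apply: bm_integrable. Qed.

Let bk : bounded_measurable (kappa s b) := bm_kappa ss b0.

Let bk2 : bounded_measurable (fun y => kappa s b y ^+ 2).
Proof. exact: bmX. Qed.

Let bq h : bounded_measurable h -> bounded_measurable (fun y => h y * kappa s b y ^+ 2).
Proof. by move=> bh; exact: bmM bk2. Qed.

Let bq1 : bounded_measurable (fun y => 1 * kappa s b y ^+ 2) := bq (bm_cst 1).

(* A cell near s, on which the kernel has relative oscillation at most [eta]. *)
Lemma cell_sqr_good (sig nn eta K : R) h : bounded_measurable h ->
  0 <= sig -> 0 < nn -> sig * (nn * lam) <= K ->
  (forall y y', A y -> A y' -> `|kappa s b y' - kappa s b y| <= eta * kappa s b y) ->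
  (forall y, A y -> `|sig * (nn * lam) - h y| <= eta) -> 0 <= eta ->
  `|sig * w ^+ 2 - nn^-1 * q h| <= nn^-1 * ((K + 1) * eta * q (fun=> 1)).
Proof.
move=> bh sig0 nn0 sK osc hsig eta0.
have wy y : A y -> `|w - lam * kappa s b y| <= eta * (lam * kappa s b y).
  move=> Ay; have -> : lam * kappa s b y = \int[leb]_(z in A) (kappa s b y).
    by rewrite Rintegral_cst// mulrC.
  rewrite -RintegralB//; [|exact: iA|by apply: iA; exact: bm_cst].
  rewrite -RintegralZl//; last by apply: iA; exact: bm_cst.
  apply: (le_trans (le_normr_Rintegral _ _)) => //.
    by apply: iA; apply: bmB => //; exact: bm_cst.
  apply: le_Rintegral => //.
  - by apply: iA; apply: bm_norm; apply: bmB => //; exact: bm_cst.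
  - by apply: iA; apply: bmM; exact: bm_cst.
  - by move=> z Az; exact: osc.
have lam0 : 0 <= lam by rewrite fine_ge0.
have -> : sig * w ^+ 2 - nn^-1 * q h =
    \int[leb]_(y in A) (kappa s b y * (sig * w - nn^-1 * (h y * kappa s b y))).
  rewrite /q -RintegralZl//; last by apply: iA; apply: bmM.
  (* One of the two factors w is written out as an integral, so that both quantities are compared
     under the same integral. *)
  have -> : sig * w ^+ 2 = \int[leb]_(y in A) (sig * w * kappa s b y).
    by rewrite RintegralZl//; [rewrite expr2 mulrA|exact: iA].
  rewrite -RintegralB//; first by apply: eq_Rintegral => y _; ring.
  - by apply: iA; apply: bmM => //; exact: bm_cst.
  - by apply: iA; apply: bmM; [exact: bm_cst|apply: bmM].
have bin : bounded_measurable (fun y => kappa s b y * (sig * w - nn^-1 * (h y * kappa s b y))).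
  apply: bmM => //; apply: bmB; first exact: bm_cst.
  by apply: bmM; [exact: bm_cst|exact: bmM].
apply: (le_trans (le_normr_Rintegral _ _)) => //; first exact: iA.
rewrite mulrA -[leRHS]RintegralZl//; last exact: iA.
apply: le_Rintegral => //.
- by apply: iA; exact: bm_norm.
- by apply: iA; apply: bmM; [exact: bm_cst|exact: bq1].
move=> y Ay; have k0 : 0 <= kappa s b y by exact: kappa_ge0.
rewrite mul1r normrM ger0_norm// [leRHS](_ : _ = kappa s b y *
  (nn^-1 * ((K + 1) * eta) * kappa s b y)); last by ring.
rewrite ler_wpM2l//.
(* Two errors: the weight against lam times the value of the kernel at y, and the product sig nn lam
   against h y. *)
have -> : sig * w - nn^-1 * (h y * kappa s b y) =
    sig * (w - lam * kappa s b y) + nn^-1 * (sig * (nn * lam) - h y) * kappa s b y.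
  by field; rewrite gt_eqF.
apply: (le_trans (ler_normD _ _)).
have h1 : `|sig * (w - lam * kappa s b y)| <= nn^-1 * K * eta * kappa s b y.
  rewrite normrM ger0_norm//; apply: (le_trans (ler_wpM2l sig0 (wy y Ay))).
  rewrite (_ : sig * _ = nn^-1 * (sig * (nn * lam)) * eta * kappa s b y); last by field; rewrite gt_eqF.
  by rewrite ler_wpM2r// ler_wpM2r// ler_wpM2l// invr_ge0 ltW.
have h2 : `|nn^-1 * (sig * (nn * lam) - h y) * kappa s b y| <= nn^-1 * eta * kappa s b y.
  rewrite normrM (ger0_norm k0) ler_wpM2r// normrM ger0_norm ?invr_ge0 ?(ltW nn0)//.
  by rewrite ler_wpM2l ?invr_ge0 ?(ltW nn0)//; exact: hsig.
lra.
Qed.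

(* A cell far from s, where [q] is small: Cauchy-Schwarz instead of oscillation. *)
Lemma cell_sqr_bad (sig nn K H : R) h : bounded_measurable h ->
  0 <= sig -> 0 < nn -> 0 < lam -> sig * (nn * lam) <= K ->
  (forall y, A y -> `|h y| <= H) ->
  `|sig * w ^+ 2 - nn^-1 * q h| <= nn^-1 * ((K + H) * q (fun=> 1)).
Proof.
move=> bh sig0 nn0 lam0 sK hH.
(* The mean of the kernel on the cell; expanding the integral of (kappa - t)^2 >= 0 gives w^2 <= lam
   times the integral of kappa^2. *)
pose t := w / lam.
have bt : bounded_measurable (fun y => kappa s b y - t) by apply: bmB => //; exact: bm_cst.
have q0 : 0 <= q (fun=> 1) by apply: Rintegral_ge0 => y _; rewrite mul1r sqr_ge0.
have wq : w ^+ 2 <= lam * q (fun=> 1).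
  have : 0 <= \int[leb]_(y in A) (kappa s b y - t) ^+ 2.
    by apply: Rintegral_ge0 => y _; exact: sqr_ge0.
  have -> : \int[leb]_(y in A) (kappa s b y - t) ^+ 2 =
      \int[leb]_(y in A) (1 * kappa s b y ^+ 2 + (- (2 * t) * kappa s b y + t ^+ 2)).
    by apply: eq_Rintegral => y _; ring.
  have b2 : bounded_measurable (fun y => - (2 * t) * kappa s b y) by apply: bmM => //; exact: bm_cst.
  have b3 : bounded_measurable (fun y : 'rV[R]_d => t ^+ 2) by exact: bm_cst.
  rewrite RintegralD//; [|exact: iA|by apply: iA; exact: bmD].
  rewrite RintegralD//; [|exact: iA|exact: iA].
  rewrite [X in _ + (X + _)]RintegralZl//; last exact: iA.
  rewrite Rintegral_cst// -/lam -/w -/(q (fun=> 1)) => h0.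
  rewrite -subr_ge0 -(pmulr_rge0 _ (_ : 0 < lam^-1)) ?invr_gt0//.
  have alg (u v l : R) : 0 < l ->
      l^-1 * (l * u - v ^+ 2) = u + (- (2 * (v / l)) * v + (v / l) ^+ 2 * l).
    by move=> l0; field; rewrite gt_eqF.
  rewrite alg//.
have qh : `|q h| <= H * q (fun=> 1).
  rewrite /q -RintegralZl//; last exact: iA.
  apply: (le_trans (le_normr_Rintegral _ _)) => //; first by apply: iA; apply: bmM.
  apply: le_Rintegral => //.
  - by apply: iA; apply: bm_norm; apply: bmM.
  - by apply: iA; apply: bmM; [exact: bm_cst|exact: bq1].
  by move=> y Ay; rewrite mul1r normrM [`|_ ^+ 2|]ger0_norm ?sqr_ge0// ler_wpM2r ?sqr_ge0// hH.
apply: (le_trans (ler_normB _ _)); rewrite mulrDl mulrDr; apply: lerD.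
  rewrite ger0_norm; last by apply: mulr_ge0 => //; exact: sqr_ge0.
  apply: (le_trans (ler_wpM2l sig0 wq)).
  rewrite (_ : sig * _ = nn^-1 * (sig * (nn * lam) * q (fun=> 1))); last by field; rewrite gt_eqF.
  by rewrite ler_wpM2l ?invr_ge0 ?(ltW nn0)// ler_wpM2r.
by rewrite normrM ger0_norm ?invr_ge0 ?(ltW nn0)// ler_wpM2l// invr_ge0 ltW.
Qed.

End one_cell.
End cell_estimates.

(** * Bias and variance of the estimator *)

Section bandwidth.
Context {R : realType} {d : nat}.
Implicit Types (b : nat -> R).

Definition mesh (n : nat) : R := n%:R `^ (- d%:R^-1).

Lemma bandwidth_near b : bandwidth d b -> forall e, 0 < e ->
  \forall n \near \oo, [/\ 0 < b n, b n < e & mesh n <= e * b n].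
Proof.
move=> [b0 bc /eqoP bo] e e0.
have h2 : \forall n \near \oo, b n < e by apply: (cvgr_lt _ bc).
have h3 := bo _ e0.
near=> n; have bn0 : 0 < b n by apply: b0; near: n; exact: nbhs_infty_gt.
split => //; first by near: n.
have : `|mesh n| <= e * `|b n| by near: n; exact: h3.
by rewrite (gtr0_norm bn0) ger0_norm// powR_ge0.
Unshelve. all: by end_near. Qed.

Lemma bandwidth_at_right b : bandwidth d b -> b @ \oo --> (0 : R)^'+.
Proof.
move=> [b0 bc _] A [e /= e0 eA].
have h2 : \forall n \near \oo, `|0 - b n| < e by move/cvgrPdist_lt : bc; apply.
suff : \forall n \near \oo, A (b n) by [].
near=> n; apply: eA; first by near: n.
by apply: b0; near: n; exact: nbhs_infty_gt.
Unshelve. all: by end_near. Qed.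

Lemma powR_half_dim (b : R) : 0 < b -> b `^ (- (d%:R / 2)) = (Num.sqrt b ^+ d)^-1.
Proof.
move=> b0; rewrite powRN; congr (_^-1).
by rewrite mulrC powRrM powR12_sqrt ?(ltW b0)// powR_mulrn// sqrtr_ge0.
Qed.

End bandwidth.

Section cells_facts.
Context {R : realType} {d : nat}.
Local Notation leb := (lebesgue_rV R d).
Implicit Types (f h : 'rV[R]_d -> R).

Lemma uniform_bigO_ge0 (a : forall n, 'I_n -> R) (e : nat -> R) : uniform_bigO a e ->
  exists2 C, 0 <= C & \forall n \near \oo, forall i, `|a n i| <= C * `|e n|.
Proof.
move=> [C hC]; exists `|C| => //; apply: filterS hC => n hn i.
by apply: (le_trans (hn i)); rewrite ler_wpM2r// ler_norm.
Qed.

(** By the Lipschitz property, the mass of a cell is f(x_i) lam up to O(mesh) lam; by the mass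
    condition it is 1/n up to O(mesh)/n. Comparing the two and multiplying by n/f(x_i) gives n lam
    close to 1/f(x_i). *)
Lemma cells_facts f (x : forall n, 'I_n -> 'rV[R]_d) (B : forall n, 'I_n -> set 'rV[R]_d) :
  cells f x B -> lipschitz_on_simplex f -> positive_min_on_simplex f ->
  (@mesh R d n @[n --> \oo] --> (0 : R)) ->
  exists2 C, 0 <= C & \forall n \near \oo,
    [/\ (0 < n)%N, forall i, closed (B n i) /\ B n i `<=` @simplex R d,
      forall i, B n i (x n i),
      forall i y y', B n i y -> B n i y' -> `|y - y'| <= C * @mesh R d n &
      forall i, `|n%:R * fine (leb (B n i)) - (f (x n i))^-1| <= C * @mesh R d n].
Proof.
move=> [_ cB _ UB xB _ dB mB] fL [s0 ss0 [f0 fmin]] mesh0.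
have [L L0 hL] := lipschitz_on_simplexP fL.
have bf := bm_continuous (lipschitz_within_continuous fL).
have [C1 C10 hC1] := uniform_bigO_ge0 dB.
have [C2 C20 hC2] := uniform_bigO_ge0 mB.
pose c0 := f s0; have c00 : 0 < c0 by [].
(* The Lipschitz error, with n lam bounded by 2(1 + C2)/c0, plus the mass error, all divided by the
   lower bound c0 of f. *)
pose C3 := (L * C1 * (2 / c0 * (1 + C2)) + C2) / c0.
have C30 : 0 <= C3.
  rewrite divr_ge0 ?(ltW c00)// addr_ge0// !mulr_ge0// ?addr_ge0//.
  by rewrite invr_ge0 ltW.
exists (C1 + C3); first exact: addr_ge0.
have LC1 : 0 < L * C1 + 1 by rewrite ltr_wpDl// mulr_ge0.
have e1 : 0 < Num.min 1 (c0 / 2 / (L * C1 + 1)) by rewrite lt_min ltr01 !divr_gt0.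
have m1 : \forall n \near \oo, @mesh R d n < Num.min 1 (c0 / 2 / (L * C1 + 1)) by apply: (cvgr_lt _ mesh0).
near=> n.
have n0 : (0 < n)%N by near: n; exact: nbhs_infty_gt.
have nR : 0 < n%:R :> R by rewrite ltr0n.
have BS i : B n i `<=` @simplex R d by rewrite -(UB _ n0) => y By; exists i.
have clB i : closed (B n i) by apply: compact_closed; [exact: norm_hausdorff|exact: cB].
have Bx i : B n i (x n i) by apply: interior_subset; exact: xB.
have r0 : 0 <= @mesh R d n by exact: powR_ge0.
have : @mesh R d n < Num.min 1 (c0 / 2 / (L * C1 + 1)) by near: n.
rewrite lt_min => /andP[r1 r2].
have hd i y y' : B n i y -> B n i y' -> `|y - y'| <= C1 * @mesh R d n.
  move=> By By'; apply: (le_trans (norm_le_diam (BS i) By By')).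
  apply: (le_trans (ler_norm _)).
  have : forall i, `|diam (B n i)| <= C1 * `|@mesh R d n| by near: n; exact: hC1.
  by move=> /(_ i); rewrite (ger0_norm r0).
split => //.
  by move=> i y y' By By'; apply: (le_trans (hd i y y' By By')); rewrite ler_wpM2r// lerDl.
move=> i.
have mBi : measurable (B n i : set (borel R d)) by exact: closed_measurable_borel.
set lam := fine (leb (B n i)); have lam0 : 0 <= lam by rewrite fine_ge0.
have sx := BS _ _ (Bx i).
have fx : c0 <= f (x n i) by exact: fmin.
have fx0 : 0 < f (x n i) by exact: lt_le_trans fx.
set I := \int[leb]_(t in B n i) f t.
have h1 : `|I - f (x n i) * lam| <= L * (C1 * @mesh R d n) * lam.
  rewrite -[leRHS]Rintegral_cst//.
  have ic r : leb.-integrable (B n i) (EFin \o (fun=> r)) by apply: bm_integrable => //; exact: bm_cst.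
  have ifB : leb.-integrable (B n i) (EFin \o f) by exact: bm_integrable.
  have -> : I - f (x n i) * lam = \int[leb]_(t in B n i) (f t - f (x n i)).
    by rewrite RintegralB ?Rintegral_cst//; exact: ic.
  have iD : leb.-integrable (B n i) (EFin \o (fun t => f t - f (x n i))).
    by apply: bm_integrable => //; apply: bmB => //; exact: bm_cst.
  apply: (le_trans (le_normr_Rintegral _ iD)) => //.
  apply: le_Rintegral => //.
    by apply: bm_integrable => //; apply: bm_norm; apply: bmB => //; exact: bm_cst.
  move=> t Bt; apply: (le_trans (hL _ _ (BS _ _ Bt) sx)).
  by rewrite ler_wpM2l// (hd i).
have h2 : `|I - n%:R^-1| <= C2 * (n%:R^-1 * @mesh R d n).
  have : forall i, `|\int[leb]_(t in B n i) f t - n%:R^-1| <= C2 * `|(n%:R `^ (- 1 - d%:R^-1) : R)|.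
    by near: n; exact: hC2.
  move=> /(_ i); rewrite (ger0_norm (powR_ge0 _ _)) powRD; last by apply/implyP => _; rewrite gt_eqF.
  by rewrite powR_inv1// ltW.
set rho := @mesh R d n in r0 r1 r2 hd h1 h2 *.
have LC : L * C1 * rho <= c0 / 2.
  apply: (@le_trans _ _ ((L * C1 + 1) * rho)); first by rewrite ler_wpM2r// lerDl.
  by rewrite mulrC -ler_pdivlMr// ltW.
have h3 : `|f (x n i) * lam - n%:R^-1| <= L * C1 * rho * lam + C2 * (n%:R^-1 * rho).
  rewrite (_ : f (x n i) * lam - n%:R^-1 = (I - n%:R^-1) - (I - f (x n i) * lam)); last by ring.
  rewrite -[L * C1 * rho]mulrA.
  by apply: (le_trans (ler_normB _ _)); rewrite addrC lerD.
(* The error in [h3] contains lam itself. The mesh is so small that this part is at most (c0/2) lam,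
   which is absorbed by c0 lam <= f(x_i) lam; this a priori bound is needed before the rate can be
   read off. *)
have nl : n%:R * lam <= 2 / c0 * (1 + C2).
  have : c0 * lam <= f (x n i) * lam by rewrite ler_wpM2r.
  have : L * C1 * rho * lam <= c0 / 2 * lam by rewrite ler_wpM2r.
  have : C2 * (n%:R^-1 * rho) <= C2 * n%:R^-1.
    by rewrite ler_wpM2l// ler_piMr ?invr_ge0 ?(ltW nR)// ltW.
  move: h3; rewrite ler_norml => /andP[_ h3] h4 h5 h6.
  have : c0 / 2 * lam <= n%:R^-1 * (1 + C2) by lra.
  move=> h7; rewrite -[leLHS]/(n%:R * lam) mulrC -ler_pdivlMr//.
  rewrite -(ler_pM2l (_ : 0 < c0 / 2)) ?divr_gt0//; apply: (le_trans h7).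
  by rewrite le_eqVlt; apply/orP; left; apply/eqP; field; rewrite !gt_eqF.
apply: (@le_trans _ _ (C3 * rho)); last by rewrite ler_wpM2r// lerDr.
have -> : n%:R * lam - (f (x n i))^-1 = n%:R / f (x n i) * (f (x n i) * lam - n%:R^-1).
  by field; rewrite !gt_eqF.
rewrite normrM ger0_norm ?divr_ge0 ?(ltW fx0)//.
apply: (@le_trans _ _ (n%:R / c0 * (L * C1 * rho * lam + C2 * (n%:R^-1 * rho)))).
  apply: ler_pM => //; first by rewrite divr_ge0// ltW.
  by rewrite ler_pM2l// lef_pV2.
rewrite (_ : n%:R / c0 * _ = (L * C1 * (n%:R * lam) + C2) / c0 * rho); last first.
  by field; rewrite !gt_eqF.
rewrite ler_wpM2r// /C3 ler_wpM2r ?invr_ge0 ?(ltW c00)// lerD2r.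
by rewrite ler_wpM2l// mulr_ge0.
Unshelve. all: by end_near. Qed.

End cells_facts.

Section gm_asymptotics.
Context {R : realType} {d : nat}.
Local Notation leb := (lebesgue_rV R d).
Implicit Types (f h : 'rV[R]_d -> R).

Lemma mean_square s b h : simplex_int s -> 0 < b -> bounded_measurable h ->
  \int[leb]_(y in @simplex R d) (h y * kappa s b y ^+ 2) =
  square_cst s b * simplex_mean s (b / 2) h.
Proof.
move=> si b0 bh; have ss := simplex_int_simplex si.
have b20 : 0 < b / 2 by rewrite divr_gt0.
rewrite /simplex_mean -RintegralZl//; last 2 first.
- exact: measurable_simplex.
- by apply: bm_integrable_simplex; apply: bmM => //; exact: bm_kappa.
apply: eq_Rintegral => y; rewrite inE => sy.
by rewrite kappa_sqr// mulrCA; congr (_ * _); exact: mulrC.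
Qed.

Lemma square_cst_gt0 s b : simplex_int s -> 0 < b -> 0 < @square_cst R d s b.
Proof.
move=> si b0; have ss := simplex_int_simplex si.
by rewrite /square_cst divr_gt0 ?exprn_gt0 ?kernel_cst_gt0// divr_gt0.
Qed.

Lemma mesh_cvg0 b : @bandwidth R d b -> @mesh R d n @[n --> \oo] --> (0 : R).
Proof.
move=> hb; apply/cvgrPdist_le => e e0.
have e1 : 0 < Num.min 1 e by rewrite lt_min ltr01.
apply: filterS (bandwidth_near hb e1) => n [b0 be h].
rewrite sub0r normrN ger0_norm ?powR_ge0//; apply: (le_trans h).
move: be; rewrite lt_min => /andP[b1 be].
apply: le_trans (ltW be); apply: ler_piMl; first exact: ltW.
by rewrite ge_min lexx.
Qed.

(** Near and far cells obey one common bound, n^-1 times a constant times the integral of g kappa^2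
    for a suitable weight g. Summed over the cells this is the mean of g under the kernel of
    bandwidth b/2, which is at most twice the tolerance. *)
Lemma gm_variance_sum f sigma2 (x : forall n, 'I_n -> 'rV[R]_d)
    (B : forall n, 'I_n -> set 'rV[R]_d) (b : nat -> R) s :
  cells f x B -> lipschitz_on_simplex f -> lipschitz_on_simplex sigma2 ->
  positive_min_on_simplex f -> positive_min_on_simplex sigma2 ->
  bandwidth d b -> simplex_int s -> forall e, 0 < e ->
  \forall n \near \oo,
  `|\sum_(i < n) sigma2 (x n i) * (\int[leb]_(y in B n i) kappa s (b n) y) ^+ 2
     - n%:R^-1 * b n `^ (- (d%:R / 2)) * v_fun f sigma2 s| <=
  e * (n%:R^-1 * b n `^ (- (d%:R / 2))).
Proof.
move=> cB fL sL fmin smin hb si e e0; have ss := simplex_int_simplex si.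
have [C C0 hC] := cells_facts cB fL fmin (mesh_cvg0 hb).
have [_ _ dB UB _ fB _ _] := cB.
have cf := lipschitz_within_continuous fL; have cs := lipschitz_within_continuous sL.
have [_ [S hS]] := bm_continuous cs; have [_ [Fm hFm]] := bm_continuous cf.
have [sf ssf [f0 hf0]] := fmin; have [sg ssg [g0 hg0]] := smin.
have fpos y : simplex y -> 0 < f y by move=> sy; apply: lt_le_trans (hf0 _ sy).
have spos y : simplex y -> 0 < sigma2 y by move=> sy; apply: lt_le_trans (hg0 _ sy).
have S0 : 0 < S by apply: lt_le_trans g0 (le_trans (ler_norm _) (hS _ ssg)).
have Fm0 : 0 < Fm by apply: lt_le_trans f0 (le_trans (ler_norm _) (hFm _ ssf)).
pose h y := sigma2 y / f y.
have ch : {within @simplex R d, continuous h}.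
  have /subspace_continuousP cs' := cs; have /subspace_continuousP cf' := cf.
  apply/subspace_continuousP => y sy; apply: cvgM; first exact: cs'.
  by apply: cvgV; [rewrite gt_eqF// fpos|exact: cf'].
have bh := bm_continuous ch; have [_ [H hH]] := bh.
have H0 : 0 <= H by apply: le_trans (hH _ ss).
have [r r0 hr] := kappa_oscillation si.
(* Bounds sigma^2(x_i) n Leb(B_i), as n Leb(B_i) is within 1 of 1/f(x_i). [Kt] then dominates both K
   + 1, for the near cells, and K + H, for the far ones. *)
pose K := S * ((f sf)^-1 + 1).
have K0 : 0 <= K by rewrite mulr_ge0 ?(ltW S0)// addr_ge0// invr_ge0 ltW.
pose Kt := K + 1 + H; have Kt0 : 0 < Kt by rewrite /Kt ltr_wpDr// ltr_wpDl.
pose C2 : R := d%:R * (1 + 3 * (d%:R + 4) ^+ 2).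
have C20 : 0 <= C2 by rewrite mulr_ge0// addr_ge0// mulr_ge0.
have psi0pos : 0 <= psi0 s by exact: powR_ge0.
(* [eta] absorbs every relative error *)
have [eta eta0 etaE] : exists2 eta, 0 < eta & eta * ((psi0 s + 1) * (2 * Kt + 1)) = e / 2.
  have P0 : 0 < (psi0 s + 1) * (2 * Kt + 1).
    by rewrite mulr_gt0// ltr_wpDl// mulr_ge0// ltW.
  exists (e / 2 / ((psi0 s + 1) * (2 * Kt + 1))); first by rewrite !divr_gt0.
  by rewrite divfK// gt_eqF.
have eta2 : 0 < eta / 2 by rewrite divr_gt0.
have [rh rh0 hrh] := simplex_uniformly_continuous ch eta2.
have [bh1 bh10 hbh] := simplex_mean_approx ch si eta0.
have acvg : square_cst s (b n) * Num.sqrt (b n) ^+ d @[n --> \oo] --> psi0 s.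
  exact: cvg_comp (bandwidth_at_right hb) (square_cst_cvg si).
have a1 : \forall n \near \oo, square_cst s (b n) * Num.sqrt (b n) ^+ d < psi0 s + 1.
  by apply: (cvgr_lt _ acvg); rewrite ltrDl.
have h10 : 0 < `|h s| + 1 by rewrite ltr_wpDl.
have a2 : \forall n \near \oo, `|psi0 s - square_cst s (b n) * Num.sqrt (b n) ^+ d| <= e / 2 / (`|h s| + 1).
  by move/cvgrPdist_le : acvg; apply; rewrite !divr_gt0.
have m1 (c t : R) : 0 <= c -> 0 < t -> \forall n \near \oo, c * @mesh R d n <= t * Num.min 1 (b n).
  move=> c0 t0; have e1 : 0 < Num.min 1 (t / (c + 1)) by rewrite lt_min ltr01 divr_gt0// ltr_wpDl.
  apply: filterS2 (bandwidth_near hb e1) (bandwidth_near hb ltr01) => n [b0 _ hm] [_ b1 _].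
  apply: (@le_trans _ _ (c * (t / (c + 1) * b n))).
    by rewrite ler_wpM2l//; apply: (le_trans hm); rewrite ler_pM2r// ge_min lexx orbT.
  have -> : Num.min 1 (b n) = b n by apply/min_idPr/ltW.
  rewrite mulrA ler_pM2r// mulrA ler_pdivrMr ?ltr_wpDl// mulrC ler_pM2l//.
  by rewrite lerDl.
have bsmall t : 0 < t -> \forall n \near \oo, 0 < b n < t.
  by move=> t0; apply: filterS (bandwidth_near hb t0) => n [-> ->].
have eta1 : 0 < ln (1 + eta) by rewrite ln_gt0// ltrDl.
have d0 : 0 <= d%:R :> R by [].
(* What the mesh must satisfy: r/4 keeps near cells inside the ball of radius r and far cells away
   from s, rh/2 controls the oscillation of h, eta/(2S) the error of n Leb(B_i) times sigma^2, and
   the last two entries bound n Leb(B_i) from above and below. *)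
pose t1 := Num.min (r / 4) (Num.min (rh / 2) (Num.min (eta / 2 / S) (Num.min 1 ((2 * Fm)^-1)))).
have t10 : 0 < t1.
  rewrite !lt_min; apply/and5P; split; rewrite ?ltr01 ?divr_gt0//.
  by rewrite invr_gt0 mulr_gt0.
have nD1 := m1 _ _ C0 t10.
(* With the logarithm of 1 + eta as threshold, the exponential factor of [kappa_oscillation] is at
   most 1 + eta on a cell. *)
have dC0 : 0 <= 4 * d%:R * C by apply: mulr_ge0 => //; apply: mulr_ge0.
have nD6 := m1 _ _ dC0 eta1.
near=> n.
have [n0 clBS Bx hdiam hlam] : [/\ (0 < n)%N, forall i, closed (B n i) /\ B n i `<=` @simplex R d,
      forall i, B n i (x n i),
      forall i y y', B n i y -> B n i y' -> `|y - y'| <= C * @mesh R d n &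
      forall i, `|n%:R * fine (leb (B n i)) - (f (x n i))^-1| <= C * @mesh R d n].
  by near: n.
have nR : 0 < n%:R :> R by rewrite ltr0n.
have clB i := (clBS i).1; have BS i := (clBS i).2.
(* The factor in 2 bh1 is there because the means are taken at b/2; the last bound makes the
   second-moment part of the mean of g at most eta. *)
have /andP[b0 b1] : 0 < b n < Num.min 1 (Num.min (2 * bh1) (r ^+ 2 * eta / (16 * (C2 + 1)))).
  near: n; apply: bsmall; rewrite !lt_min ltr01 /=; apply/andP; split; first by rewrite mulr_gt0.
  apply: divr_gt0; apply: mulr_gt0 => //; first by rewrite exprn_gt0.
  by rewrite ltr_wpDl.
move: b1; rewrite !lt_min => /and3P[b1 b2 b3].
have min01 : Num.min 1 (b n) <= 1 by rewrite ge_min lexx.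
have minb : Num.min 1 (b n) <= b n by rewrite ge_min lexx orbT.
have D1 : C * @mesh R d n <= t1.
  apply: (@le_trans _ _ (t1 * Num.min 1 (b n))); first by near: n; exact: nD1.
  by apply: ler_piMr => //; exact: ltW.
have D6 : 4 * d%:R * (C * @mesh R d n) <= ln (1 + eta) * b n.
  apply: (@le_trans _ _ (ln (1 + eta) * Num.min 1 (b n))); last by rewrite ler_pM2l.
  by rewrite mulrA; near: n; exact: nD6.
have D0 : 0 <= C * @mesh R d n by rewrite mulr_ge0// powR_ge0.
set D := C * @mesh R d n in hdiam hlam D0 D1 D6.
move: D1; rewrite !le_min => /and5P[D1 D2 D3 D4 D5].
(* [eta] bounds the error on the cells near s, and [g] is at least 1 on the others. *)
pose g y := eta + 16 / r ^+ 2 * sum_dev s y 2.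
have bg : bounded_measurable g.
  by apply: bmD; [exact: bm_cst|apply: bmM; [exact: bm_cst|exact: bm_sum_dev]].
have bk := bm_kappa ss b0.
pose q A h := \int[leb]_(y in A) (h y * kappa s (b n) y ^+ 2).
have cell i : `|sigma2 (x n i) * (\int[leb]_(y in B n i) kappa s (b n) y) ^+ 2 -
    n%:R^-1 * q (B n i) h| <= n%:R^-1 * (Kt * q (B n i) g).
  have Bxi := Bx i; have sx := BS _ _ Bxi.
  have fx0 := fpos _ sx; have sx0 := spos _ sx.
  have hl := hlam i; set lam := fine _ in hl.
  have fxF : f (x n i) <= Fm by apply: le_trans (ler_norm _) (hFm _ sx).
  have sxS : sigma2 (x n i) <= S by apply: le_trans (ler_norm _) (hS _ sx).
  (* Gives lam > 0, by which the Cauchy-Schwarz estimate on far cells divides. *)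
  have nl0 : (2 * Fm)^-1 <= n%:R * lam.
    have : Fm^-1 <= (f (x n i))^-1 by rewrite lef_pV2.
    move: hl; rewrite ler_norml => /andP[h1 _].
    have -> : Fm^-1 = 2 * (2 * Fm)^-1 by field; rewrite gt_eqF.
    by have := D5; have := h1; clear; lra.
  have nl1 : n%:R * lam <= (f sf)^-1 + 1.
    have : (f (x n i))^-1 <= (f sf)^-1 by rewrite lef_pV2 ?posrE// hf0.
    by move: hl D4; rewrite ler_norml => /andP[_]; clear; lra.
  have nlp : 0 < n%:R * lam by apply: lt_le_trans nl0; rewrite invr_gt0 mulr_gt0.
  have lam0 : 0 < lam by move: nlp; rewrite pmulr_rgt0.
  have sK : sigma2 (x n i) * (n%:R * lam) <= K by apply: ler_pM => //; exact: ltW.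
  have b1q : bounded_measurable (fun y => 1 * kappa s (b n) y ^+ 2).
    by apply: bmM; [exact: bm_cst|exact: bmX].
  have mB : measurable (B n i : set (borel R d)) by exact: closed_measurable_borel.
  have q_le c : 0 <= c -> (forall y, B n i y -> c <= g y) -> c * q (B n i) (fun=> 1) <= q (B n i) g.
    move=> c0 hc; rewrite /q -RintegralZl//; last exact: bm_integrable.
    apply: le_Rintegral => //.
    - by apply: bm_integrable => //; apply: bmM => //; exact: bm_cst.
    - by apply: bm_integrable => //; apply: bmM => //; exact: bmX.
    by move=> y By; rewrite mul1r ler_wpM2r ?sqr_ge0// hc.
  have sd0 y : 0 <= sum_dev s y 2 by apply: sumr_ge0 => j _; exact: sqr_ge0.
  have g0y y : eta <= g y by rewrite lerDl mulr_ge0// divr_ge0// exprn_ge0// ltW.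
  have q0 : 0 <= q (B n i) (fun=> 1) by apply: Rintegral_ge0 => y _; rewrite mul1r sqr_ge0.
  have [xs|xs] := ltP `|s - x n i| (r / 2).
    have ys y : B n i y -> `|s - y| < r.
      move=> By; apply: le_lt_trans (ler_distD (x n i) _ _) _.
      rewrite (splitr r); apply: ltr_leD => //; apply: (le_trans (hdiam i _ _ Bxi By)).
      by have := r0; have := D1; clear; lra.
    have osc1 y y' : B n i y -> B n i y' -> kappa s (b n) y' <= kappa s (b n) y * (1 + eta).
      move=> By By'; apply: (le_trans (hr _ _ _ b0 (BS _ _ By) (BS _ _ By') (ys y By))).
      rewrite ler_wpM2l ?kappa_ge0// -[leRHS](@lnK R) ?posrE ?addr_gt0// ler_expR.
      rewrite ler_pdivrMr//; apply: le_trans D6; rewrite ler_wpM2l ?mulr_ge0//.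
      by rewrite distrC; exact: (hdiam i).
    apply: (@le_trans _ _ (n%:R^-1 * ((K + 1) * eta * q (B n i) (fun=> 1)))).
      apply: cell_sqr_good => //; [exact: ltW| | |exact: ltW].
      - move=> y y' By By'; have h1 := osc1 _ _ By By'; have h2 := osc1 _ _ By' By.
        have k0 := kappa_ge0 y ss b0; have k0' := kappa_ge0 y' ss b0.
        have h3 : kappa s (b n) y' * eta <= kappa s (b n) y * (1 + eta) * eta.
          by rewrite ler_wpM2r// ltW.
        rewrite ler_norml; apply/andP; split; last by have := h1; clear; lra.
        have [kk|kk] := leP (kappa s (b n) y) (kappa s (b n) y').
          by apply: le_trans (_ : 0 <= _); rewrite ?subr_ge0// oppr_le0 mulr_ge0// ltW.
        have : eta * kappa s (b n) y' <= eta * kappa s (b n) y by rewrite ler_pM2l// ltW.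
        by have := h2; clear; lra.
      - move=> y By; rewrite -/lam.
        have -> : sigma2 (x n i) * (n%:R * lam) - h y =
          sigma2 (x n i) * (n%:R * lam - (f (x n i))^-1) + (h (x n i) - h y).
          by rewrite /h; ring.
        apply: (le_trans (ler_normD _ _)); rewrite [leRHS](splitr eta); apply: lerD.
          rewrite normrM gtr0_norm//; apply: (@le_trans _ _ (S * D)).
            by apply: ler_pM => //; exact: ltW.
          by rewrite mulrC -ler_pdivlMr.
        apply/ltW/hrh => //; first exact: BS By.
        by apply: (le_lt_trans (hdiam i _ _ Bxi By)); have := rh0; have := D2; clear; lra.
    rewrite ler_wpM2l ?invr_ge0 ?(ltW nR)// -mulrA; apply: ler_pM.
    - by rewrite addr_ge0.
    - by rewrite mulr_ge0// ltW.
    - by rewrite /Kt lerDl.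
    - by apply: q_le => [|y _]; [exact: ltW|exact: g0y].
  have ys y : B n i y -> 1 <= g y.
    (* The design point is at distance at least r/2 from s and the cell is narrower than r/4; this
       is the origin of the factor 16/r^2 in g. *)
    move=> By; have h1 : r / 4 <= `|y - s|.
      have := hdiam i _ _ Bxi By.
      have := ler_distD y s (x n i); rewrite [`|y - x n i|]distrC [`|s - y|]distrC.
      by have := D1; have := xs; clear; lra.
    apply: (@le_trans _ _ (16 / r ^+ 2 * sum_dev s y 2)); last by rewrite lerDr ltW.
    rewrite mulrAC ler_pdivlMr ?exprn_gt0// mul1r.
    have n2 := @norm_sum_dev R d s y 2 isT isT.
    have : (r / 4) ^+ 2 <= `|y - s| ^+ 2 by rewrite ler_pXn2r ?nnegrE// divr_ge0// ltW.
    have -> : (r / 4) ^+ 2 = r ^+ 2 / 16 by field.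
    by move: n2; set u := `|_| ^+ 2; set v := sum_dev _ _ _; clear; lra.
  apply: (@le_trans _ _ (n%:R^-1 * ((K + H) * q (B n i) (fun=> 1)))).
    apply: cell_sqr_bad => //; first exact: ltW.
    by move=> y By; apply: hH; exact: BS By.
  rewrite ler_wpM2l ?invr_ge0 ?(ltW nR)//; apply: ler_pM.
  - by rewrite addr_ge0.
  - exact: q0.
  - by rewrite /Kt -addrA lerD2l lerDr.
  - by rewrite -[leLHS]mul1r; exact: q_le.
have bq u : bounded_measurable u -> bounded_measurable (fun y => u y * kappa s (b n) y ^+ 2).
  by move=> bu; apply: bmM => //; exact: bmX.
have qsum u : bounded_measurable u ->
    \sum_(i < n) q (B n i) u = square_cst s (b n) * simplex_mean s (b n / 2) u.
  move=> bu; rewrite -mean_square//; apply: Rintegral_cells => //; last exact: bq.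
  - by move=> i j; exact: dB.
  - exact: UB n0.
have AT1 : square_cst s (b n) * Num.sqrt (b n) ^+ d < psi0 s + 1 by near: n; exact: a1.
have AT2' : `|psi0 s - square_cst s (b n) * Num.sqrt (b n) ^+ d| <= e / 2 / (`|h s| + 1).
  by near: n; exact: a2.
set A := square_cst s (b n) in AT1 AT2' *; set T := Num.sqrt (b n) ^+ d in AT1 AT2' *.
have A0 : 0 < A by exact: square_cst_gt0.
have T0 : 0 < T by rewrite exprn_gt0// sqrtr_gt0.
have b20 : 0 < b n / 2 by rewrite divr_gt0.
have b21 : b n / 2 <= 1 by have := b1; have := b0; clear; lra.
set mh := simplex_mean s (b n / 2) h.
have hmh : `|mh - h s| <= eta by apply: hbh; rewrite b20 ltr_pdivrMr// mulrC.
have tot : `|\sum_(i < n) sigma2 (x n i) * (\int[leb]_(y in B n i) kappa s (b n) y) ^+ 2 -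
    n%:R^-1 * (A * mh)| <= n%:R^-1 * (Kt * (A * (2 * eta))).
  rewrite -qsum// mulr_sumr -sumrB; apply: (le_trans (ler_norm_sum _ _ _)).
  apply: (@le_trans _ _ (\sum_(i < n) n%:R^-1 * (Kt * q (B n i) g))); first exact: ler_sum.
  rewrite -!mulr_sumr qsum// ler_pM2l ?invr_gt0// ler_pM2l// ler_pM2l//.
  rewrite simplex_meanD//; [|exact: bm_cst|by apply: bmM; [exact: bm_cst|exact: bm_sum_dev]].
  rewrite simplex_mean_cst// simplex_meanZ//; last exact: bm_sum_dev.
  rewrite [leRHS]mulr_natl mulr2n lerD2l.
  have h1 : simplex_mean s (b n / 2) (fun y => sum_dev s y 2) <= C2 * (b n / 2).
    by apply: simplex_mean_sum_dev2 => //; rewrite b20 b21.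
  have r2 : 0 < r ^+ 2 by rewrite exprn_gt0.
  apply: (@le_trans _ _ (16 / r ^+ 2 * ((C2 + 1) * b n))).
    rewrite ler_pM2l ?divr_gt0//; apply: (le_trans h1).
    by apply: ler_pM => //; [exact: ltW|rewrite lerDl|have := b0; clear; lra].
  have C21 : 0 < C2 + 1 by rewrite ltr_wpDl.
  rewrite -ler_pdivlMl ?divr_gt0// mulrC -ler_pdivlMr//; apply: (le_trans (ltW b3)).
  by rewrite le_eqVlt; apply/orP; left; apply/eqP; field; rewrite !gt_eqF.
rewrite powR_half_dim// -/T.
have -> : v_fun f sigma2 s = psi0 s * h s by rewrite /v_fun /h mulrA.
set Sum := \sum_(i < n) _ in tot *.
(* Apart from the cell errors there remain the mean of h against h(s), and the rescaled constant A T
   against psi_0(s). *)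
have -> : Sum - n%:R^-1 / T * (psi0 s * h s) = (Sum - n%:R^-1 * (A * mh)) +
    n%:R^-1 / T * (A * T * (mh - h s) - (psi0 s - A * T) * h s).
  by field; rewrite !gt_eqF.
apply: (le_trans (ler_normD _ _)).
have AT2 : `|psi0 s - A * T| * `|h s| <= e / 2.
  by move: AT2'; rewrite ler_pdivlMr//; apply: le_trans; rewrite ler_wpM2l// lerDl.
have AT0 : 0 < A * T by rewrite mulr_gt0.
have h2 : `|n%:R^-1 / T * (A * T * (mh - h s) - (psi0 s - A * T) * h s)| <=
    n%:R^-1 / T * (A * T * eta + e / 2).
  rewrite normrM gtr0_norm ?divr_gt0 ?invr_gt0// ler_pM2l ?divr_gt0 ?invr_gt0//.
  apply: (le_trans (ler_normB _ _)); apply: lerD; last by rewrite normrM.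
  by rewrite normrM gtr0_norm// ler_pM2l.
apply: (le_trans (lerD tot h2)).
have -> : n%:R^-1 * (Kt * (A * (2 * eta))) + n%:R^-1 / T * (A * T * eta + e / 2) =
    n%:R^-1 / T * (eta * (A * T * (2 * Kt + 1)) + e / 2).
  by field; rewrite !gt_eqF.
rewrite mulrC ler_pM2r ?divr_gt0 ?invr_gt0// [leRHS](splitr e) lerD2r -etaE.
by rewrite ler_pM2l// ler_wpM2r ?(ltW AT1)// addr_ge0// mulr_ge0// ltW.
Unshelve. all: by end_near. Qed.

End gm_asymptotics.

Section gm_bias.
Context {R : realType} {d : nat}.
Local Notation leb := (lebesgue_rV R d).

(** The kernel is non-negative of total mass one, so moving m(x_i) to m(y) costs at most the
    Lipschitz constant times the cell size, whatever s is. With the uniform kernel bias this makes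
    the whole estimate uniform in s. *)
Lemma gm_bias_sum f m (x : forall n, 'I_n -> 'rV[R]_d)
    (B : forall n, 'I_n -> set 'rV[R]_d) (b : nat -> R) :
  cells f x B -> lipschitz_on_simplex f -> positive_min_on_simplex f ->
  C2_on_simplex m -> (forall n i, simplex_int (x n i)) -> bandwidth d b ->
  forall e, 0 < e -> \forall n \near \oo, forall s, simplex_int s ->
  `|\sum_(i < n) m (x n i) * \int[leb]_(y in B n i) kappa s (b n) y - m s - b n * g_fun m s|
    <= e * b n.
Proof.
move=> cB fL fmin Cm xint hb e e0.
have [C C0 hC] := cells_facts cB fL fmin (mesh_cvg0 hb).
have [_ _ dB UB _ fB _ _] := cB.
have [L L0 hL] := C2_lipschitz Cm.
have e2 : 0 < e / 2 by rewrite divr_gt0.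
have [b1 b10 hb1] := kernel_bias Cm e2.
have LC0 : 0 < L * C + 1 by rewrite ltr_wpDl// mulr_ge0.
have e3 : 0 < Num.min b1 (e / 2 / (L * C + 1)) by rewrite lt_min b10 divr_gt0.
near=> n.
have [n0 clBS Bx hdiam _] : [/\ (0 < n)%N, forall i, closed (B n i) /\ B n i `<=` @simplex R d,
      forall i, B n i (x n i),
      forall i y y', B n i y -> B n i y' -> `|y - y'| <= C * @mesh R d n &
      forall i, `|n%:R * fine (leb (B n i)) - (f (x n i))^-1| <= C * @mesh R d n].
  by near: n.
have [b0 bb hm] : [/\ 0 < b n, b n < Num.min b1 (e / 2 / (L * C + 1)) &
    @mesh R d n <= Num.min b1 (e / 2 / (L * C + 1)) * b n].
  by near: n; exact: bandwidth_near.
move=> s si; have ss := simplex_int_simplex si.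
have bm : bounded_measurable m by case: Cm => cm _ _ _ _; exact: bm_continuous.
have bk := bm_kappa ss b0.
have clB i := (clBS i).1; have BS i := (clBS i).2.
have cells_sum u : bounded_measurable u ->
    \sum_(i < n) \int[leb]_(y in B n i) u y = \int[leb]_(y in @simplex R d) u y.
  by move=> bu; apply: Rintegral_cells => //; [move=> i j; exact: dB|exact: UB n0].
have -> : \sum_(i < n) m (x n i) * \int[leb]_(y in B n i) kappa s (b n) y - m s - b n * g_fun m s =
    (\sum_(i < n) m (x n i) * \int[leb]_(y in B n i) kappa s (b n) y - simplex_mean s (b n) m) +
    (simplex_mean s (b n) m - m s - b n * g_fun m s) by ring.
apply: (le_trans (ler_normD _ _)).
have h2 : `|simplex_mean s (b n) m - m s - b n * g_fun m s| <= e / 2 * b n.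
  by apply: hb1 => //; rewrite b0 (lt_le_trans bb)// ge_min lexx.
have h1 : `|\sum_(i < n) m (x n i) * \int[leb]_(y in B n i) kappa s (b n) y - simplex_mean s (b n) m|
    <= e / 2 * b n; last by rewrite (splitr e) mulrDl lerD.
apply: (@le_trans _ _ (L * (C * @mesh R d n) * simplex_mean s (b n) (fun=> 1))); last first.
  rewrite simplex_mean_cst// mulr1 mulrA.
  apply: (@le_trans _ _ ((L * C + 1) * (e / 2 / (L * C + 1) * b n))); last first.
    by rewrite le_eqVlt; apply/orP; left; apply/eqP; field; rewrite gt_eqF.
  apply: ler_pM; [by rewrite mulr_ge0|exact: powR_ge0|by rewrite lerDl|].
  by apply: (le_trans hm); rewrite ler_pM2r// ge_min lexx orbT.
have bk1 : bounded_measurable (fun y => kappa s (b n) y * 1) by apply: bmM => //; exact: bm_cst.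
have bkm : bounded_measurable (fun y => kappa s (b n) y * m y) by exact: bmM.
rewrite /simplex_mean -(cells_sum _ bkm) -(cells_sum _ bk1).
rewrite mulr_sumr -sumrB; apply: (le_trans (ler_norm_sum _ _ _)); apply: ler_sum => i _.
have mB : measurable (B n i : set (borel R d)) by exact: closed_measurable_borel.
have ik u : bounded_measurable u -> leb.-integrable (B n i) (EFin \o u).
  by move=> bu; exact: bm_integrable.
have bmk : bounded_measurable (fun y => m (x n i) * kappa s (b n) y).
  by apply: bmM => //; exact: bm_cst.
rewrite -RintegralZl//; last exact: ik.
rewrite -RintegralB//; [|exact: ik|exact: ik].
rewrite -[leRHS]RintegralZl//; last exact: ik.
apply: (le_trans (le_normr_Rintegral _ _)) => //; first by apply: ik; exact: bmB.
apply: le_Rintegral => //.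
- by apply: ik; apply: bm_norm; exact: bmB.
- by apply: ik; apply: bmM => //; exact: bm_cst.
move=> y By; rewrite mulr1 [kappa _ _ _ * m y]mulrC -mulrBl normrM [`|kappa _ _ _|]ger0_norm ?kappa_ge0//.
rewrite ler_wpM2r ?kappa_ge0//; apply: (@le_trans _ _ (L * `|y - x n i|)).
  by rewrite distrC; apply: hL => //; exact: BS By.
rewrite ler_wpM2l//; exact: (hdiam i).
Unshelve. all: by end_near. Qed.

End gm_bias.

(** * Mean, variance and mean squared error of the estimator *)

Section second_moments.
Context {R : realType} d {T : measurableType d} (P : probability T R).
Implicit Types X Y : {RV P >-> R}.

(** The integral is the difference of those of the positive and negative parts; a difference of
    extended reals is finite only when both terms are. *)
Lemma integrable_of_fin_num_integral (f : T -> \bar R) : measurable_fun setT f ->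
  (\int[P]_w f w)%E \is a fin_num -> P.-integrable setT f.
Proof.
move=> mf; rewrite integralE => h.
have := h; rewrite fin_numD => /andP[hp]; rewrite fin_numN => hn.
apply/integrableP; split => //.
rewrite (eq_integral (fun w => (f^\+ w + f^\- w)%E)); last by move=> w _; rewrite -[LHS]/((abse \o f) w) fune_abse.
rewrite ge0_integralD//; [|exact: measurable_funepos|exact: measurable_funeneg].
rewrite -ge0_fin_numE; first by rewrite fin_numD hp hn.
by apply: adde_ge0; exact: integral_ge0.
Qed.

Lemma integrable_mul_of_sqr X Y :
  P.-integrable setT (EFin \o (fun w => X w ^+ 2)) ->
  P.-integrable setT (EFin \o (fun w => Y w ^+ 2)) ->
  P.-integrable setT (EFin \o (fun w => X w * Y w)).
Proof.
move=> hX hY; apply: le_integrable (integrableD measurableT hX hY) => //=.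
  by apply/measurable_EFinP; exact: measurable_funM.
move=> w _; rewrite lee_fin normrM [leRHS]ger0_norm ?addr_ge0 ?sqr_ge0//.
rewrite -(real_normK (num_real (X w))) -(real_normK (num_real (Y w))).
have := normr_ge0 (X w); have := normr_ge0 (Y w).
move: (`|X w|) (`|Y w|) => a b; clear; nra.
Qed.

(** Independence says that the joint law agrees with the product of the marginals on rectangles,
    hence everywhere; Fubini for (x, y) -> x y then factors the integral. *)
Lemma expectation_mul_independent X Y :
  (forall A B, measurable A -> measurable B ->
     P (X @^-1` A `&` Y @^-1` B) = (P (X @^-1` A) * P (Y @^-1` B))%E) ->
  P.-integrable setT (EFin \o X) -> P.-integrable setT (EFin \o Y) ->
  P.-integrable setT (EFin \o (fun w => X w * Y w)) ->
  (\int[P]_w (X w * Y w)%:E = (\int[P]_w (X w)%:E) * (\int[P]_w (Y w)%:E))%E.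
Proof.
move=> ind iX iY iXY.
pose phi w : R * R := (X w, Y w).
have mX : measurable_fun setT X by [].
have mY : measurable_fun setT Y by [].
have mphi : measurable_fun setT phi by apply/measurable_fun_pairP.
pose joint := pushforward_measure P mphi.
pose m1 := distribution P X; pose m2 := distribution P Y.
pose g (p : R * R) : \bar R := (p.1 * p.2)%:E.
have mg : measurable_fun setT g.
  by apply/measurable_EFinP; apply: measurable_funM; [exact: measurable_fst|exact: measurable_snd].
have jointE A : measurable A -> joint A = (m1 \x m2)%E A.
  move=> mA; apply/esym; apply: product_measure_unique => //.
have ig : joint.-integrable setT g by exact: integrable_pushforward.
have ig' : (m1 \x m2)%E.-integrable setT g.
  have /integrableP[_ goo] := ig; apply/integrableP; split => //.
  by rewrite (eq_measure_integral joint)// => A mA _; rewrite jointE.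
transitivity (\int[joint]_p g p)%E.
  by rewrite [RHS]integral_pushforward.
rewrite (eq_measure_integral (m1 \x m2)%E); last by move=> A mA _; exact: jointE.
have EY : (\int[m2]_y y%:E = \int[P]_w (Y w)%:E)%E by rewrite integral_distribution.
have EX : (\int[m1]_y y%:E = \int[P]_w (X w)%:E)%E by rewrite integral_distribution.
have iid (Z : {RV P >-> R}) : P.-integrable setT (EFin \o Z) -> (distribution P Z).-integrable setT EFin.
  by move=> iZ; exact: integrable_pushforward.
have finY : (\int[m2]_y y%:E)%E \is a fin_num by apply: integrable_fin_num => //; exact: iid.
rewrite -integral12_prod_meas1// /fubini_F.
under eq_integral => u _ do
  rewrite (eq_integral (fun y => u%:E * y%:E)%E)// (integralZl measurableT (iid _ iY))
    -(fineK finY) muleC.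
by rewrite (integralZl measurableT (iid _ iX)) fineK// EX EY muleC.
Qed.

(** One computation for two uses: c = 0 gives the variance, and c equal to the bias gives the mean
    squared error. *)
Lemma integral_affine_sqr n (X : 'I_n -> {RV P >-> R}) (v w : 'I_n -> R) c :
  (forall i, P.-integrable setT (EFin \o X i)) ->
  (forall i, (\int[P]_t (X i t)%:E = 0)%E) ->
  (forall i, P.-integrable setT (EFin \o (fun t => X i t ^+ 2))) ->
  (forall i j, (\int[P]_t (X i t * X j t)%:E = ((i == j)%:R * v i)%:E)%E) ->
  (\int[P]_t ((c + \sum_(i < n) w i * X i t) ^+ 2)%:E =
    (c ^+ 2 + \sum_(i < n) w i ^+ 2 * v i)%:E)%E.
Proof.
move=> iX EX iX2 EXX.
have iXX i j : P.-integrable setT (EFin \o (fun t => X i t * X j t)).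
  exact: integrable_mul_of_sqr.
pose S1 t := (\sum_(i < n) (2 * c * w i)%:E * (X i t)%:E)%E.
pose S2 t := (\sum_(i < n) \sum_(j < n) (w i * w j)%:E * (X i t * X j t)%:E)%E.
have i1 : P.-integrable setT S1.
  by apply: integrable_sum => // i _; apply: integrableZl => //; exact: iX.
have i2' i : P.-integrable setT (fun t => \sum_(j < n) (w i * w j)%:E * (X i t * X j t)%:E)%E.
  by apply: integrable_sum => // j _; apply: integrableZl => //; exact: iXX.
have i2 : P.-integrable setT S2 by apply: integrable_sum => // i _; exact: i2'.
have ic : P.-integrable setT (cst (c ^+ 2)%:E) by exact: finite_measure_integrable_cst.
transitivity (\int[P]_t ((c ^+ 2)%:E + (S1 t + S2 t)))%E.
  apply: eq_integral => t _.
  have -> : S1 t = (\sum_(i < n) 2 * c * w i * X i t)%:E by rewrite -sumEFin.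
  have -> : S2 t = (\sum_(i < n) \sum_(j < n) w i * w j * (X i t * X j t))%:E.
    by rewrite -sumEFin; apply: eq_bigr => i _; rewrite -sumEFin.
  rewrite -!EFinD; congr EFin; rewrite sqrrD -addrA; congr (_ + (_ + _)).
    by rewrite -mulr_natl mulrA mulr_sumr; apply: eq_bigr => i _; rewrite mulrA.
  rewrite expr2 big_distrlr /=; apply: eq_bigr => i _; apply: eq_bigr => j _.
  by ring.
have Ec : (\int[P]_t (cst (c ^+ 2)%:E t) = (c ^+ 2)%:E)%E.
  by have := expectation_cst P (c ^+ 2); rewrite unlock.
rewrite integralD//; last exact: integrableD.
rewrite Ec integralD//.
rewrite integral_sum//; last by move=> i; apply: integrableZl => //; exact: iX.
rewrite big1 ?add0e; last by move=> i _; rewrite integralZl ?EX ?mule0//; exact: iX.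
rewrite integral_sum// EFinD -sumEFin; congr (_ + _)%E; apply: eq_bigr => i _.
rewrite integral_sum//; last by move=> j; apply: integrableZl => //; exact: iXX.
rewrite (bigD1 i)//= big1 ?adde0; last first.
  move=> j ji; rewrite integralZl//; last exact: iXX.
  by rewrite EXX eq_sym (negbTE ji) mul0r mule0.
by rewrite integralZl ?EXX ?eqxx ?mul1r -?EFinM ?expr2//; exact: iXX.
Qed.

End second_moments.

Section gm_moments.
Context {R : realType} {d : nat} disp (T : measurableType disp) (P : probability T R).
Context (n : nat) (m sigma2 : 'rV[R]_d -> R) (x : 'I_n -> 'rV[R]_d) (eps : 'I_n -> {RV P >-> R}).
Hypothesis errors : error_model sigma2 x eps.

Lemma error_integrable i : P.-integrable setT (EFin \o eps i).
Proof.
have [_ E0 _] := errors; apply: integrable_of_fin_num_integral; first exact/measurable_EFinP.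
by have := E0 i; rewrite unlock => ->.
Qed.

Lemma error_sqr i : (\int[P]_t (eps i t ^+ 2)%:E = (sigma2 (x i))%:E)%E.
Proof.
have [_ E0 V] := errors; rewrite -V /variance unlock E0 unlock.
by apply: eq_integral => t _; rewrite !fctE /= !subr0 expr2.
Qed.

Lemma error_sqr_integrable i : P.-integrable setT (EFin \o (fun t => eps i t ^+ 2)).
Proof.
apply: integrable_of_fin_num_integral; last by rewrite error_sqr.
by apply/measurable_EFinP; exact: measurable_funX.
Qed.

Lemma error_uncorrelated i j :
  (\int[P]_t (eps i t * eps j t)%:E = ((i == j)%:R * sigma2 (x i))%:E)%E.
Proof.
have [<-|ij] := eqVneq i j; first by rewrite mul1r -error_sqr.
have [ind E0 _] := errors; rewrite mul0r expectation_mul_independent.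
- by have := E0 i; rewrite unlock => ->; rewrite mul0e.
(* Independence of the pair is mutual independence for the index set {i, j}; the events at other
   indices are immaterial. *)
- move=> A C mA mC; pose D k := if k == i then A else C.
  have Di : D i = A by rewrite /D eqxx.
  have Dj : D j = C by rewrite /D eq_sym (negbTE ij).
  have := ind [set i; j]%SET D; rewrite big_setU1 ?inE//= big_set1 Di Dj => <-.
    congr (P _); apply/seteqP; split => t /=.
      move=> [tA tC] k /=; rewrite !inE => /orP[] /eqP ->; by rewrite ?Di ?Dj.
    move=> h; split; [rewrite -Di|rewrite -Dj]; apply: h; rewrite /= !inE eqxx//.
    by rewrite orbT.
  by move=> k; rewrite /D; case: ifP.
- exact: error_integrable.
- exact: error_integrable.
- by apply: integrable_mul_of_sqr; exact: error_sqr_integrable.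
Qed.

Lemma gm_moments (B : 'I_n -> set 'rV[R]_d) b s theta :
  let X := gm_estimator (response m x eps) B b s in
  let w i := \int[lebesgue_rV R d]_(y in B i) kappa s b y in
  [/\ ('E_P[X] = (\sum_(i < n) m (x i) * w i)%:E)%E,
      ('V_P[X] = (\sum_(i < n) sigma2 (x i) * w i ^+ 2)%:E)%E &
      mse P X theta = ((\sum_(i < n) m (x i) * w i - theta) ^+ 2
        + \sum_(i < n) sigma2 (x i) * w i ^+ 2)%:E].
Proof.
move=> X w.
have [_ E0 _] := errors.
have XE t : X t = \sum_(i < n) m (x i) * w i + \sum_(i < n) w i * eps i t.
  rewrite /X /gm_estimator /response -big_split/=; apply: eq_bigr => i _.
  by rewrite mulrDl [eps i t * _]mulrC.
have E0' i : (\int[P]_t (eps i t)%:E = 0)%E by have := E0 i; rewrite unlock.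
have sqrE c : (\int[P]_t ((c + \sum_(i < n) w i * eps i t) ^+ 2)%:E =
    (c ^+ 2 + \sum_(i < n) sigma2 (x i) * w i ^+ 2)%:E)%E.
  rewrite (integral_affine_sqr _ _ error_integrable E0' error_sqr_integrable error_uncorrelated).
  by congr (_ + _)%:E; apply: eq_bigr => i _; rewrite mulrC.
have EX : ('E_P[X] = (\sum_(i < n) m (x i) * w i)%:E)%E.
  have iw i : P.-integrable setT (fun t => (w i * eps i t)%:E).
    by have := integrableZl measurableT (w i) (error_integrable i); exact: eq_integrable.
  rewrite unlock; move: XE; move: (\sum_(i < n) m (x i) * w i) => c XE.
  under eq_integral => t _ do rewrite XE EFinD -sumEFin.
  have Ec : (\int[P]_t (cst c%:E t) = c%:E)%E by have := expectation_cst P c; rewrite unlock.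
  rewrite integralD//; [|exact: finite_measure_integrable_cst|exact: integrable_sum].
  rewrite Ec integral_sum// big1 ?adde0// => i _.
  under eq_integral => t _ do rewrite EFinM.
  by rewrite integralZl ?E0' ?mule0//; exact: error_integrable.
split => //.
- rewrite /variance unlock EX unlock.
  have := sqrE 0; rewrite expr0n/= add0r => <-; apply: eq_integral => t _.
  by rewrite !fctE /= XE addrAC subrr -expr2.
- rewrite /mse unlock -sqrE; apply: eq_integral => t _.
  by rewrite XE addrAC.
Qed.

End gm_moments.

(** * The optimal bandwidth *)

Section optimal_bandwidth.
Context {R : realType}.
Implicit Types (D N G v b : R).

(** [b_opt] with d, n, g^2 and v replaced by free positive reals. Written as exponentials, these
    reduce every identity between powers to a linear identity between exponents. *)
Definition opt_bandwidth D N G v : R :=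
  N `^ (- (2 / (D + 4))) * (D / 4 * (v / G)) `^ (2 / (D + 4)).

(** Squaring the weak inequality at x/2 leaves x^2/4 to spare. *)
Lemma expR_gt1D (x : R) : x != 0 -> 1 + x < expR x.
Proof.
move=> x0; have [x2|x2] := ltP (1 + x / 2) 0.
  by apply: lt_trans (expR_gt0 x); have := x2; clear; lra.
have -> : x = 2%:R * (x / 2) by field.
rewrite expRM_natl; apply: (@lt_le_trans _ _ ((1 + x / 2) ^+ 2)).
  have : 0 < x ^+ 2 by rewrite exprn_even_gt0.
  by clear; nra.
by rewrite lerXn2r ?nnegrE ?expR_ge0// expR_ge1Dx.
Qed.

Lemma expR_surj (x : R) : 0 < x -> exists t, x = expR t.
Proof. by move=> x0; exists (ln x); rewrite lnK. Qed.

Lemma powR_expR (x y : R) : expR x `^ y = expR (x * y). Proof. by rewrite expRM. Qed.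

Lemma opt_bandwidthE D N G v : 0 < D -> 0 < N -> 0 < G -> 0 < v ->
  opt_bandwidth D N G v = expR (2 / (D + 4) * (ln (D / 4) + ln v - ln G - ln N)).
Proof.
move=> D0 /expR_surj[n ->] /expR_surj[g ->] /expR_surj[w ->].
have /expR_surj[q qE] : 0 < D / 4 by rewrite divr_gt0.
rewrite /opt_bandwidth qE !expRK -expRN -!expRD !powR_expR -expRD; congr expR; ring.
Qed.

Lemma opt_bandwidth_gt0 D N G v : 0 < D -> 0 < N -> 0 < G -> 0 < v ->
  0 < opt_bandwidth D N G v.
Proof. by move=> *; rewrite opt_bandwidthE// expR_gt0. Qed.

Lemma opt_bandwidth_sqr D N G v : 0 < D -> 0 < N -> 0 < G -> 0 < v ->
  opt_bandwidth D N G v ^+ 2 =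
    (D / 4 * (v / G)) `^ (4 / (D + 4)) * N `^ (- (4 / (D + 4))).
Proof.
move=> D0 N0 G0 v0; rewrite /opt_bandwidth exprMn -!powR_mulrn ?powR_ge0// -!powRrM mulrC.
by congr (_ `^ _ * _ `^ _); ring.
Qed.

(** The stationarity condition 2 b G = (D/2) N^-1 b^(-D/2-1) v, multiplied by 2b/D. *)
Lemma opt_bandwidth_balance D N G v : 0 < D -> 0 < N -> 0 < G -> 0 < v ->
  N^-1 * opt_bandwidth D N G v `^ (- (D / 2)) * v = G * opt_bandwidth D N G v ^+ 2 / (D / 4).
Proof.
move=> D0 N0 G0 v0; have q0 : 0 < D / 4 by rewrite divr_gt0.
rewrite opt_bandwidthE// powR_expR -expRM_natl.
move: N0 G0 v0 q0 => /expR_surj[n ->] /expR_surj[g ->] /expR_surj[w ->] /expR_surj[q qE].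
rewrite qE !expRK -!expRN -!expRD; congr expR; field.
by rewrite gt_eqF// addr_gt0.
Qed.

Lemma opt_bandwidth_value D N G v : 0 < D -> 0 < N -> 0 < G -> 0 < v ->
  opt_bandwidth D N G v ^+ 2 * G + N^-1 * opt_bandwidth D N G v `^ (- (D / 2)) * v =
  N `^ (- (4 / (D + 4))) * ((1 + D / 4) / (D / 4) `^ (D / (D + 4)))
    * v `^ (4 / (D + 4)) * G `^ (D / (D + 4)).
Proof.
move=> D0 N0 G0 v0; have q0 : 0 < D / 4 by rewrite divr_gt0.
rewrite opt_bandwidth_balance//.
have -> : opt_bandwidth D N G v ^+ 2 * G + G * opt_bandwidth D N G v ^+ 2 / (D / 4) =
    (1 + D / 4) * (opt_bandwidth D N G v ^+ 2 * G / (D / 4)).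
  by field; rewrite gt_eqF.
have -> : N `^ (- (4 / (D + 4))) * ((1 + D / 4) / (D / 4) `^ (D / (D + 4)))
    * v `^ (4 / (D + 4)) * G `^ (D / (D + 4)) = (1 + D / 4) *
   (N `^ (- (4 / (D + 4))) / (D / 4) `^ (D / (D + 4)) * v `^ (4 / (D + 4)) * G `^ (D / (D + 4))).
  by ring.
congr (_ * _); rewrite opt_bandwidthE// -expRM_natl.
move: N0 G0 v0 q0 => /expR_surj[n ->] /expR_surj[g ->] /expR_surj[w ->] /expR_surj[q qE].
rewrite qE !expRK !powR_expR -!expRN -!expRD; congr expR.
by field; rewrite gt_eqF// addr_gt0.
Qed.

Lemma opt_bandwidth_min D N G v b : 0 < D -> 0 < N -> 0 < G -> 0 < v -> 0 < b ->
  b != opt_bandwidth D N G v ->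
  opt_bandwidth D N G v ^+ 2 * G + N^-1 * opt_bandwidth D N G v `^ (- (D / 2)) * v <
  b ^+ 2 * G + N^-1 * b `^ (- (D / 2)) * v.
Proof.
move=> D0 N0 G0 v0 b0 bo; have o0 := opt_bandwidth_gt0 D0 N0 G0 v0.
pose u := ln (b / opt_bandwidth D N G v).
have bu : b = opt_bandwidth D N G v * expR u.
  by rewrite /u lnK ?posrE ?divr_gt0// mulrC divfK// gt_eqF.
have u0 : u != 0.
  by apply: contra bo => /eqP u0; rewrite bu u0 expR0 mulr1.
rewrite bu powRM ?expR_ge0 ?ltW// powR_expR.
rewrite [in ltRHS]mulrA [X in _ < _ + X]mulrAC !opt_bandwidth_balance//.
rewrite [(_ * expR u) ^+ 2]exprMn -expRM_natl; move: (opt_bandwidth D N G v ^+ 2) (exprn_gt0 2 o0) => B B0.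
have h1 : 1 + 2 * u < expR (2 * u) by rewrite expR_gt1D// mulf_neq0 ?pnatr_eq0.
have h2 : 1 + u * - (D / 2) < expR (u * - (D / 2)).
  by rewrite expR_gt1D// mulf_neq0// oppr_eq0 gt_eqF// divr_gt0.
(* The linear terms cancel, 2u - (D/2)u/(D/4) = 0, so the value at u = 0 is the sum of the two
   tangent lines at any u. *)
have -> : B * G + G * B / (D / 4) =
  B * G * ((1 + 2 * u) + (1 + u * - (D / 2)) / (D / 4)) by field; rewrite gt_eqF.
have -> : B * expR (2 * u) * G + G * B / (D / 4) * expR (u * - (D / 2)) =
   B * G * (expR (2 * u) + expR (u * - (D / 2)) / (D / 4)) by ring.
by rewrite ltr_pM2l ?mulr_gt0// ltrD// ltr_pM2r// invr_gt0 divr_gt0.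
Qed.

Lemma powR_nat_near (a e : R) : 0 < a -> 0 < e ->
  \forall n \near \oo, n%:R `^ (- a) <= e.
Proof.
move=> a0 e0; near=> n.
have n0 : 0 < n%:R :> R by rewrite ltr0n; near: n; exact: nbhs_infty_gt.
have hn : e^-1 `^ a^-1 <= n%:R :> R by near: n; exact: nbhs_infty_ger.
rewrite powRN -[leRHS]invrK lef_pV2 ?posrE ?powR_gt0 ?invr_gt0//.
have -> : e^-1 = (e^-1 `^ a^-1) `^ a by rewrite -powRrM mulVf ?lt0r_neq0// powRr1// invr_ge0 ltW.
apply: ge0_ler_powR => //; [exact: ltW|by rewrite nnegrE powR_ge0|by rewrite nnegrE ltW].
Unshelve. all: by end_near. Qed.

End optimal_bandwidth.

(** * Admissibility of the optimal bandwidth and final assembly *)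

Section assembly.
Context {R : realType} {d : nat}.
Implicit Types (f m : 'rV[R]_d -> R) (s : 'rV[R]_d).

(** The optimal rate is n^(-2/(d+4)), and n^(-1/d) is negligible against it exactly when 1/d >
    2/(d+4), that is d < 4. This is the origin of the restriction on the dimension. *)
Lemma opt_bandwidth_bandwidth (G v : R) : (0 < d)%N -> (d <= 3)%N -> 0 < G -> 0 < v ->
  bandwidth d (fun n => opt_bandwidth d%:R n%:R G v).
Proof.
move=> d0 d3 G0 v0; have D0 : 0 < d%:R :> R by rewrite ltr0n.
have D4 : 0 < d%:R + 4 :> R by rewrite addr_gt0.
have a0 : 0 < 2 / (d%:R + 4) :> R by rewrite divr_gt0.
pose c := (d%:R / 4 * (v / G)) `^ (2 / (d%:R + 4)).
have c0 : 0 < c by rewrite powR_gt0// mulr_gt0// divr_gt0.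
have oE n : opt_bandwidth d%:R n%:R G v = n%:R `^ (- (2 / (d%:R + 4))) * c by [].
have o0 n : (0 < n)%N -> 0 < opt_bandwidth d%:R n%:R G v.
  by move=> n0; apply: opt_bandwidth_gt0; rewrite ?ltr0n.
split => //.
- apply/cvgr0Pnorm_le => e e0.
  have := @powR_nat_near R _ (e / c) a0; rewrite divr_gt0// => /(_ isT).
  apply: filterS => n h; rewrite oE ger0_norm ?mulr_ge0 ?powR_ge0//.
  by rewrite -ler_pdivlMr.
- apply/eqoP => e e0.
  have g0 : 0 < d%:R^-1 - 2 / (d%:R + 4) :> R.
    rewrite subr_gt0 ltr_pdivrMr// mulrC ltr_pdivlMr//.
    have : d%:R <= 3 :> R by rewrite ler_nat.
    clear; lra.
  have h := powR_nat_near g0 (mulr_gt0 e0 c0).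
  near=> n; have n0 : (0 < n)%N by near: n; exact: nbhs_infty_gt.
  have nR : 0 < n%:R :> R by rewrite ltr0n.
  rewrite /= ger0_norm ?powR_ge0// ger0_norm ?(ltW (o0 n n0))// oE.
  have -> : - d%:R^-1 = - (d%:R^-1 - 2 / (d%:R + 4)) + - (2 / (d%:R + 4)) :> R by ring.
  rewrite powRD; last by rewrite (gt_eqF nR) implybT.
  rewrite [n%:R `^ (- (2 / _)) * c]mulrC mulrA ler_wpM2r ?powR_ge0//.
  by near: n.
Unshelve. all: by end_near. Qed.

(** Squaring the bias b g + r produces the cross term 2 b g r; a bound on g keeps it o(b^2)
    uniformly in s. *)
Lemma g_fun_bounded m : C2_on_simplex m ->
  exists2 M, 0 <= M & forall s, simplex_int s -> `|g_fun m s| <= M.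
Proof.
move=> [_ _ em1 _ em2].
have [M1 M10 hM1] := @extends_continuously_bounded _ _ _ (fun j => partial j m) em1.
have [M2 M20 hM2] := @extends_continuously_bounded _ _ _
  (fun jk : 'I_d * 'I_d => partial jk.1 (partial jk.2 m)) (fun jk => em2 jk.1 jk.2).
exists (\sum_(j < d) (1 + (d%:R + 1)) * M1 + 2^-1 * \sum_(j < d) \sum_(k < d) 2 * M2).
  by rewrite addr_ge0 ?mulr_ge0 ?sumr_ge0// => *; rewrite ?sumr_ge0 ?mulr_ge0// => *; rewrite mulr_ge0.
move=> s si; have s01 j : 0 <= s 0 j <= 1.
  by have [+ _] := si => /(_ j)/andP[? ?]; rewrite !ltW.
apply: (le_trans (ler_normD _ _)); apply: lerD.
  apply: (le_trans (ler_norm_sum _ _ _)); apply: ler_sum => j _; rewrite normrM.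
  apply: ler_pM => //; last exact: hM1.
  rewrite (le_trans (ler_normB _ _))// normr1 lerD2l normrM ger0_norm ?addr_ge0//.
  by have /andP[? ?] := s01 j; rewrite ger0_norm// ler_piMr// addr_ge0.
rewrite normrM ger0_norm ?invr_ge0// ler_pM2l ?invr_gt0//.
apply: (le_trans (ler_norm_sum _ _ _)); apply: ler_sum => j _.
apply: (le_trans (ler_norm_sum _ _ _)); apply: ler_sum => k _; rewrite normrM.
apply: ler_pM => //; last exact: (hM2 (j, k)).
have /andP[? ?] := s01 j; have /andP[? ?] := s01 k.
rewrite normrM ger0_norm// -[leRHS]mul1r; apply: ler_pM => //.
rewrite (le_trans (ler_normB _ _))// [`|s 0 k|]ger0_norm//.
by apply: lerD => //; case: (j == k); rewrite ?normr1 ?normr0.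
Qed.

Lemma v_fun_gt0 f (sigma2 : 'rV[R]_d -> R) s : positive_min_on_simplex f -> positive_min_on_simplex sigma2 ->
  simplex_int s -> 0 < v_fun f sigma2 s.
Proof.
move=> [sf sfS [f0 hf]] [sg sgS [g0 hg]] si; have ss := simplex_int_simplex si.
rewrite divr_gt0 ?(lt_le_trans f0 (hf _ ss))//.
rewrite mulr_gt0 ?(lt_le_trans g0 (hg _ ss))// powR_gt0//.
rewrite !mulr_gt0 ?exprn_gt0 ?mulr_gt0 ?pi_gt0//.
  by have [_ s1] := si; rewrite subr_gt0.
by apply: prodr_gt0 => j _; exact: simplex_int_gt0.
Qed.

End assembly.

Theorem corollary4p3 (R : realType) (d : nat) (d_gt0 : (0 < d)%N)
  (f sigma2 m : 'rV[R]_d -> R)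
  (x : forall n, 'I_n -> 'rV[R]_d)
  (B : forall n, 'I_n -> set 'rV[R]_d)
  (disp : nat -> measure_display) (T : forall n, measurableType (disp n))
  (P : forall n, probability (T n) R)
  (eps : forall n, 'I_n -> {RV (P n) >-> R})
  (f_density : density_on_simplex f)
  (x_design : design f x)
  (errors : forall n, error_model sigma2 (x n) (eps n))
  (f_lipschitz : lipschitz_on_simplex f)
  (sigma2_lipschitz : lipschitz_on_simplex sigma2)
  (m_C2 : C2_on_simplex m)
  (f_min : positive_min_on_simplex f)
  (sigma2_min : positive_min_on_simplex sigma2)
  (B_cells : cells f x B) :
  let mhat n b s := gm_estimator (response m (x n) (eps n)) (B n) b s in
  (forall b : nat -> R, bandwidth d b ->
    exists r1 r2 : 'rV[R]_d -> nat -> R,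
    [/\ uniform_littleo (@simplex_int R d) r1 (fun n => b n ^+ 2),
        forall s, simplex_int s ->
          (r2 s : nat -> R^o)
            =o_\oo (fun n => n%:R^-1 * b n `^ (- (d%:R / 2)) : R^o) &
        forall s, simplex_int s -> forall n, (0 < n)%N ->
          mse (P n) (mhat n (b n) s) (m s) =
            (bias (P n) (mhat n (b n) s) (m s) ^+ 2
             + 'V_(P n)[mhat n (b n) s])%E /\
          mse (P n) (mhat n (b n) s) (m s) =
            (b n ^+ 2 * g_fun m s ^+ 2
             + n%:R^-1 * b n `^ (- (d%:R / 2)) * v_fun f sigma2 s
             + r1 s n + r2 s n)%:E])
  /\
  (forall s, simplex_int s -> g_fun m s * sigma2 s != 0 -> (d <= 3)%N ->
    (forall n, (0 < n)%N ->
      0 < b_opt f sigma2 m s n /\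
      forall b : R, 0 < b -> b != b_opt f sigma2 m s n ->
        asymptotic_mse f sigma2 m s n (b_opt f sigma2 m s n)
          < asymptotic_mse f sigma2 m s n b) /\
    exists2 r : nat -> R,
      (r : nat -> R^o) =o_\oo (fun n => n%:R `^ (- (4 / (d%:R + 4))) : R^o) &
      forall n, (0 < n)%N ->
        mse (P n) (mhat n (b_opt f sigma2 m s n) s) (m s) =
          (n%:R `^ (- (4 / (d%:R + 4)))
           * ((1 + d%:R / 4) / (d%:R / 4) `^ (d%:R / (d%:R + 4)))
           * v_fun f sigma2 s `^ (4 / (d%:R + 4))
           * (g_fun m s ^+ 2) `^ (d%:R / (d%:R + 4)) + r n)%:E).
Proof.
move=> mhat.
have xint : forall n i, simplex_int (x n i) by case: x_design.
pose w n b s i := \int[lebesgue_rV R d]_(y in B n i) kappa s b y.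
pose be n b s := \sum_(i < n) m (x n i) * w n b s i - m s.
pose va n b s := \sum_(i < n) sigma2 (x n i) * w n b s i ^+ 2.
have biasE n b s : bias (P n) (mhat n b s) (m s) = (be n b s)%:E.
  by rewrite /bias; have [-> _ _] := gm_moments m (errors n) (B n) b s (m s).
have varE n b s : ('V_(P n)[mhat n b s] = (va n b s)%:E)%E.
  by have [_ -> _] := gm_moments m (errors n) (B n) b s (m s).
have mseE n b s : mse (P n) (mhat n b s) (m s) = (be n b s ^+ 2 + va n b s)%:E.
  by have [_ _ ->] := gm_moments m (errors n) (B n) b s (m s).
have be_o b : bandwidth d b -> uniform_littleo (@simplex_int R d)
    (fun s n => be n (b n) s ^+ 2 - b n ^+ 2 * g_fun m s ^+ 2) (fun n => b n ^+ 2).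
  move=> hb e e0; have [M M0 hM] := g_fun_bounded m_C2.
  have c0 : 0 < 2 * M + 1 by rewrite ltr_wpDl// mulr_ge0.
  (* With |r| <= c b, the error 2 b g r + r^2 is at most c (2M + c) b^2 <= c (2M + 1) b^2, which
     dictates c. *)
  have [c [cp c1 ce]] : exists c, [/\ 0 < c, c <= 1 & c * (2 * M + 1) <= e].
    exists (Num.min 1 (e / (2 * M + 1))); split.
    - by rewrite lt_min ltr01 divr_gt0.
    - by rewrite ge_min lexx.
    - by rewrite -ler_pdivlMr// ge_min lexx orbT.
  have h := gm_bias_sum B_cells f_lipschitz f_min m_C2 xint hb cp.
  have hb' := bandwidth_near hb ltr01.
  near=> n => s si.
  have [b0 _ _] : [/\ 0 < b n, b n < 1 & @mesh R d n <= 1 * b n] by near: n.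
  have : `|be n (b n) s - b n * g_fun m s| <= c * b n.
    by move: s si; near: n; exact: h.
  move: (be n (b n) s) => q hq; pose r := q - b n * g_fun m s.
  have hr : `|r| <= c * b n by [].
  rewrite (_ : _ - _ = 2 * b n * g_fun m s * r + r ^+ 2); last by rewrite /r; ring.
  move: (r) hr => {}r hr.
  rewrite (le_trans (ler_normD _ _))// normrX [`|b n ^+ 2|]ger0_norm ?sqr_ge0//.
  apply: (@le_trans _ _ (2 * b n * M * (c * b n) + (c * b n) ^+ 2)).
    apply: lerD; last by apply: lerXn2r; rewrite ?nnegrE// (le_trans _ hr).
    rewrite normrM; apply: ler_pM => //.
    by rewrite normrM ger0_norm ?ler_wpM2l ?hM// mulr_ge0// ltW.
  rewrite (_ : _ + _ = c * (2 * M + c) * b n ^+ 2); last by ring.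
  rewrite ler_wpM2r ?sqr_ge0// (le_trans _ ce)// ler_wpM2l ?(ltW cp)//.
  by rewrite lerD2l.
have va_o b s : bandwidth d b -> simplex_int s ->
    ((fun n => va n (b n) s - n%:R^-1 * b n `^ (- (d%:R / 2)) * v_fun f sigma2 s) : nat -> R^o)
      =o_\oo (fun n => n%:R^-1 * b n `^ (- (d%:R / 2)) : R^o).
  move=> hb si; apply/eqoP => e e0.
  have := gm_variance_sum B_cells f_lipschitz sigma2_lipschitz f_min sigma2_min hb si e0.
  apply: filterS => n h; rewrite /= [`|n%:R^-1 * _|]ger0_norm//.
  by rewrite mulr_ge0 ?powR_ge0.
split.
  move=> b hb.
  exists (fun s n => be n (b n) s ^+ 2 - b n ^+ 2 * g_fun m s ^+ 2).
  exists (fun s n => va n (b n) s - n%:R^-1 * b n `^ (- (d%:R / 2)) * v_fun f sigma2 s).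
  split => [|s si|s si n n0]; [exact: be_o|exact: va_o|].
  rewrite mseE biasE varE; split; first by rewrite EFinD EFin_expe.
  by congr EFin; ring.
move=> s si gs d3.
have g0 : 0 < g_fun m s ^+ 2.
  by rewrite exprn_even_gt0//=; apply: contra gs => /eqP ->; rewrite mul0r.
have v0 := v_fun_gt0 f_min sigma2_min si.
have D0 : 0 < d%:R :> R by rewrite ltr0n.
split.
  move=> n n0; have nR : 0 < n%:R :> R by rewrite ltr0n.
  split; first exact: opt_bandwidth_gt0.
  by move=> b b0 bo; exact: opt_bandwidth_min.
pose bo n := b_opt f sigma2 m s n.
have hb : bandwidth d bo by exact: opt_bandwidth_bandwidth.
pose r n := be n (bo n) s ^+ 2 + va n (bo n) s - asymptotic_mse f sigma2 m s n (bo n).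
exists r; last first.
  move=> n n0; have nR : 0 < n%:R :> R by rewrite ltr0n.
  rewrite mseE -(opt_bandwidth_value D0 nR g0 v0) /r /asymptotic_mse; congr EFin.
  by rewrite /bo /b_opt -/(opt_bandwidth d%:R n%:R (g_fun m s ^+ 2) (v_fun f sigma2 s)); ring.
(* At the optimal bandwidth both error scales, b^2 and n^-1 b^(-d/2), are exact multiples of
   n^(-4/(d+4)); c1 and c2 are the factors, the second obtained from the balance equation. *)
pose c1 := (d%:R / 4 * (v_fun f sigma2 s / g_fun m s ^+ 2)) `^ (4 / (d%:R + 4)).
pose c2 := c1 * (g_fun m s ^+ 2 / (d%:R / 4) / v_fun f sigma2 s).
have c10 : 0 <= c1 by exact: powR_ge0.
have c20 : 0 <= c2.
  by apply: mulr_ge0 => //; apply: ltW; do 2!apply: divr_gt0 => //; exact: divr_gt0.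
have rate1 n : (0 < n)%N -> bo n ^+ 2 = c1 * n%:R `^ (- (4 / (d%:R + 4))).
  by move=> n0; apply: opt_bandwidth_sqr; rewrite ?ltr0n.
have rate2 n : (0 < n)%N ->
    n%:R^-1 * bo n `^ (- (d%:R / 2)) = c2 * n%:R `^ (- (4 / (d%:R + 4))).
  move=> n0; have nR : 0 < n%:R :> R by rewrite ltr0n.
  apply: (mulIf (lt0r_neq0 v0)); rewrite (opt_bandwidth_balance D0 nR g0 v0) -/(bo n) rate1//.
  by rewrite /c2; field; rewrite ?gt_eqF.
clearbody c2; clearbody c1.
apply/eqoP => e e0.
have cc0 : 0 < c1 + c2 + 1 by rewrite ltr_wpDl// addr_ge0.
have e1 : 0 < e / (c1 + c2 + 1) by rewrite divr_gt0.
have h1 : \forall n \near \oo, `|be n (bo n) s ^+ 2 - bo n ^+ 2 * g_fun m s ^+ 2|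
    <= e / (c1 + c2 + 1) * `|bo n ^+ 2|.
  by apply: filterS (be_o _ hb _ e1) => n; exact.
have /eqoP /(_ _ e1) h2 := va_o _ _ hb si.
near=> n; have n0 : (0 < n)%N by near: n; exact: nbhs_infty_gt.
have k1 : `|be n (bo n) s ^+ 2 - bo n ^+ 2 * g_fun m s ^+ 2|
    <= e / (c1 + c2 + 1) * `|bo n ^+ 2|.
  by near: n.
have k2 : `|va n (bo n) s - n%:R^-1 * bo n `^ (- (d%:R / 2)) * v_fun f sigma2 s|
    <= e / (c1 + c2 + 1) * `|n%:R^-1 * bo n `^ (- (d%:R / 2))| by near: n.
rewrite /= /r (_ : _ - _ = (be n (bo n) s ^+ 2 - bo n ^+ 2 * g_fun m s ^+ 2) +
  (va n (bo n) s - n%:R^-1 * bo n `^ (- (d%:R / 2)) * v_fun f sigma2 s)); last first.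
  by rewrite /asymptotic_mse; ring.
rewrite (le_trans (ler_normD _ _))// (le_trans (lerD k1 k2))//.
rewrite rate1// rate2// [`|c1 * _|]ger0_norm ?[`|c2 * _|]ger0_norm ?mulr_ge0 ?powR_ge0//.
rewrite -mulrDr -mulrDl mulrA [`|_|]ger0_norm ?powR_ge0// ler_wpM2r ?powR_ge0//.
by rewrite mulrAC ler_pdivrMr// ler_wpM2l ?(ltW e0)// lerDl.
Unshelve. all: by end_near. Qed.
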